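(* Let $d\ge 2$. Let $f:\mathbb{R}^d\times[0,\infty)\to\mathbb{R}^d$ be measurable and such that, for some $\epsilon>0$ and a.e. $x\in\mathbb{R}^d$, $t\ge 0$, $$|f(x,t)|\le \epsilon\min\{(1+|x|)^{-d-2},(1+t)^{-(d+2)/2}\},\qquad \|f\|_{L^1(\mathbb{R}^d\times\mathbb{R}^+)}\le\epsilon ,$$ and such that, for some $C_f>0$ and all $t\ge0$, $\big\|\,|x|f(\cdot,t)\big\|_{L^1(\mathbb{R}^d)}\le C_f(1+t)^{-1/2}$. Let $a\in L^1(\mathbb{R}^d)^d$ be a divergence-free vector field with $\|a\|_{1}<\epsilon$, $|a(x)|\le\epsilon(1+|x|)^{-d}$ for a.e. $x$, and $a(x)=o(|x|^{-d})$ as $|x|\to\infty$. Assume that $\epsilon$ is small enough (depending only on $d$) for the unique strong solution $u$ of the Navier--Stokes equations described in the context to exist. Assume moreover that $$\int_0^\infty\!\!\int_{\mathbb{R}^d}f(y,s)\,dy\,ds\neq 0 .$$ Then: (1) For all $\alpha\ge0$ and $1<p<\infty$ with $\alpha+d/p<d$, and also for $(\alpha,p)=(d,\infty)$ (with $d/p=0$), there are $t_0>0$ and constants $c,c'>0$ such that for all $t>t_0$ $$c\,t^{-\frac12(d-\alpha-\frac dp)}\le\big\|(1+|x|)^\alpha u(\cdot,t)\big\|_{L^p(\mathbb{R}^d)}\le c'\,t^{-\frac12(d-\alpha-\frac dp)} .$$ (2) For all $\alpha\ge0$ and $1\le p<\infty$ with $\alpha+d/p\ge d$, and also for $p=\infty$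 and $\alpha>d$, there is $t_0>0$ such that for all $t>t_0$ $$\big\|(1+|x|)^\alpha u(\cdot,t)\big\|_{L^p(\mathbb{R}^d)}=+\infty .$$
   Context: $\mathbb{P}$ is the Leray projector onto divergence-free fields and $e^{t\Delta}$ the heat semigroup on $\mathbb{R}^d$. For $t>0$ the operator $e^{t\Delta}\mathbb{P}$ is convolution with the smooth matrix kernel $\mathbb{K}(\cdot,t)$ whose Fourier transform is $e^{-t|\xi|^2}(\delta_{j,k}-\xi_j\xi_k/|\xi|^2)$; this defines $e^{t\Delta}\mathbb{P}f$ also for $f\in L^1$, and similarly $e^{t\Delta}\mathbb{P}\nabla\cdot(u\otimes u)$ has $j$-th component $\sum_{h,k}\partial_h\mathbb{K}_{j,k}(\cdot,t)*(u_hu_k)$. Here $f$ is not assumed divergence-free. Strong solution: the Navier--Stokes equations $\partial_tu+u\cdot\nabla u=\Delta u-\nabla p+f$, $\operatorname{div}u=0$, $u(\cdot,0)=a$ in $\mathbb{R}^d$ are understood in the integral form $$u(t)=e^{t\Delta}a-\int_0^te^{(t-s)\Delta}\mathbb{P}\nabla\cdot(u\otimes u)(s)\,ds+\int_0^te^{(t-s)\Delta}\mathbb{P}f(s)\,ds,\qquad \operatorname{div}a=0,$$ the values $u(x,t)$, $t>0$, being those of the right-hand side. For $\epsilon$ small enough (depending only on $d$) and $f,a$ satisfying the bounds involving $\epsilon$ in the claim, there is a unique such solution $u$ on $\mathbb{R}^d\times(0,\infty)$ satisfying, for some constant $C>0$, $$|u(x,t)|\le C\epsilon\min\{(1+|x|)^{-d},(1+t)^{-d/2}\},$$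 and with $u(t)\to a$ a.e. and in the sense of distributions as $t\to0$. This is the solution $u$ of the claim. The condition $a(x)=o(|x|^{-d})$ means $\operatorname{ess\,sup}_{|x|\ge r}|x|^d|a(x)|\to0$ as $r\to\infty$. *)

(* Defs.v *)
(* MathComp-Analysis, over an abstract [R : realType]. *)
From HB Require Import structures.
From mathcomp Require Import all_boot all_order all_algebra.
From mathcomp Require Import all_classical all_reals all_analysis ess_sup_inf.

Set Implicit Arguments.
Unset Strict Implicit.
Unset Printing Implicit Defensive.

Import Order.TTheory GRing.Theory Num.Theory.
Import numFieldNormedType.Exports.

Local Open Scope classical_set_scope.
Local Open Scope ring_scope.

(* R^n is ['rV[R]_n] with the Borel sigma-algebra, generated by the coordinate
   maps as the library does for [n.-tuple T]. *)
Definition rV_display : measure_display.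
Proof. exact: default_measure_display. Qed.

Section measurable_rV.
Context {R : realType} (n : nat).

Definition rV_coord (i : 'I_n) (x : 'rV[R]_n) : measurableTypeR R := x ord0 i.

Let rV_set0 : g_sigma_preimage rV_coord set0.
Proof. exact: sigma_algebra0. Qed.

Let rV_setC A : g_sigma_preimage rV_coord A -> g_sigma_preimage rV_coord (~` A).
Proof. exact: sigma_algebraC. Qed.

Let rV_bigcup (F : _^nat) : (forall i, g_sigma_preimage rV_coord (F i)) ->
  g_sigma_preimage rV_coord (\bigcup_i (F i)).
Proof. exact: sigma_algebra_bigcup. Qed.

HB.instance Definition _ := @isMeasurable.Build rV_display
  'rV[R]_n (g_sigma_preimage rV_coord) rV_set0 rV_setC rV_bigcup.

Lemma measurable_rV_coord (i : 'I_n) : measurable_fun setT (rV_coord i).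
Proof.
move=> _ Y mY; rewrite setTI; apply: sub_sigma_algebra => /=.
rewrite -bigcup_seq/=; exists i => /=; first by rewrite mem_index_enum.
by exists Y => //; rewrite setTI.
Qed.

Lemma measurable_fun_rVP d (T : measurableType d) (f : T -> 'rV[R]_n) :
  measurable_fun setT f <->
  forall i, measurable_fun setT (rV_coord i \o f).
Proof.
split=> [mf i|mf].
  by apply: measurableT_comp => //; exact: measurable_rV_coord.
move=> _ A mA; rewrite setTI.
have : g_sigma_preimage rV_coord `<=` [set B | measurable (f @^-1` B)].
  apply: smallest_sub.
    split => /=.
    - by rewrite preimage_set0.
    - by move=> B mB; rewrite setTD -preimage_setC; exact: measurableC.
    - by move=> F mF; rewrite preimage_bigcup; exact: bigcupT_measurable.
  move=> B; rewrite -bigcup_seq/= => -[i _ [Y mY <-]] /=.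
  by rewrite setTI -comp_preimage -[X in measurable X]setTI; exact: mf.
exact.
Qed.

End measurable_rV.

Section lebesgue_rV.
Context {R : realType}.

Definition rV_cons n (p : measurableTypeR R * 'rV[R]_n) : 'rV[R]_n.+1 :=
  \row_(i < n.+1) if unlift ord0 i is Some j then p.2 ord0 j else p.1.

Definition rV_uncons n (x : 'rV[R]_n.+1) : measurableTypeR R * 'rV[R]_n :=
  (x ord0 ord0, \row_(j < n) x ord0 (lift ord0 j)).

Lemma rV_consK n : cancel (@rV_cons n) (@rV_uncons n).
Proof.
move=> [a x]; rewrite /rV_uncons mxE unlift_none; congr (_, _).
by apply/rowP => j; rewrite !mxE liftK.
Qed.

Lemma measurable_rV_cons n : measurable_fun setT (@rV_cons n).
Proof.
apply/measurable_fun_rVP => i; rewrite /rV_coord /comp.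
under eq_fun do rewrite mxE.
case: unliftP => [j _|_]; last exact: measurable_fst.
apply: (@measurableT_comp _ _ _ _ _ _ (rV_coord j)) => //.
exact: measurable_rV_coord.
Qed.

Lemma measurable_rV_uncons n : measurable_fun setT (@rV_uncons n).
Proof.
apply: measurable_fun_pair; first exact: measurable_rV_coord.
apply/measurable_fun_rVP => i.
rewrite (_ : _ \o _ = rV_coord (lift ord0 i)); first exact: measurable_rV_coord.
by apply/funext => x /=; rewrite /rV_coord mxE.
Qed.

Section step.
Context n (mu : {sigma_finite_measure set 'rV[R]_n -> \bar R}).

Definition lebesgue_rV_step :=
  pushforward (@lebesgue_measure R \x mu)%E (@rV_cons n).

HB.instance Definition _ := Measure.copy lebesgue_rV_step
  (measure_function_pushforward__canonical__measure_function_Measure _ (@measurable_rV_cons n)).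

Let step_sigma_finite : sigma_finite setT lebesgue_rV_step.
Proof.
have /sigma_finiteP[F [TF ndF Foo]] := sigma_finiteT (@lebesgue_measure R).
have /sigma_finiteP[G [TG ndG Goo]] := sigma_finiteT mu.
exists (fun k => @rV_uncons n @^-1` (F k `*` G k)).
  apply/esym; rewrite -subTset => x _.
  have [i _ Fi] : (\bigcup_i F i) (rV_uncons x).1 by rewrite -TF.
  have [j _ Gj] : (\bigcup_i G i) (rV_uncons x).2 by rewrite -TG.
  exists (maxn i j) => //; split => /=.
    by move: Fi; exact/subsetPset/ndF/leq_maxl.
  by move: Gj; exact/subsetPset/ndG/leq_maxr.
move=> k; have [mF Fk] := Foo k; have [mG Gk] := Goo k.
have mFG : measurable (F k `*` G k) by exact: measurableX.
split; first by rewrite -[X in measurable X]setTI; exact: measurable_rV_uncons.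
rewrite /lebesgue_rV_step /pushforward -comp_preimage.
rewrite (_ : _ \o _ = id) ?preimage_id.
  by rewrite product_measure1E// lte_mul_pinfty// ge0_fin_numE.
by apply/funext => p; exact: rV_consK.
Qed.

HB.instance Definition _ := Measure_isSigmaFinite.Build _ _ _ lebesgue_rV_step
  step_sigma_finite.

End step.

Fixpoint lebesgue_rV n : {sigma_finite_measure set 'rV[R]_n -> \bar R} :=
  if n is n'.+1 then lebesgue_rV_step (lebesgue_rV n') else dirac (0 : 'rV[R]_0).

Lemma lebesgue_rV_box n (A : 'I_n -> set (measurableTypeR R)) :
  (forall i, measurable (A i)) ->
  lebesgue_rV n [set x | forall i, A i (x ord0 i)] =
  (\prod_(i < n) lebesgue_measure (A i))%E.
Proof.
elim: n A => [A mA|n ih A mA].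
  rewrite big_ord0 /= diracE mem_set//.
  by case.
rewrite big_ord_recl -ih// -product_measure1E//.
  rewrite /= /lebesgue_rV_step /pushforward; congr product_measure1.
  apply/seteqP; split => -[a x] /=.
    move=> H; split; first by have := H ord0; rewrite mxE unlift_none.
    by move=> i; have := H (lift ord0 i); rewrite mxE liftK.
  move=> [Ha Hx] i; rewrite mxE.
  by case: unliftP => [j ->|->].
rewrite (_ : (fun x => _) = \big[setI/setT]_(i < n)
    (rV_coord i @^-1` A (lift ord0 i))).
  apply: bigsetI_measurable => i _; rewrite -[X in measurable X]setTI.
  exact: measurable_rV_coord.
by rewrite -bigcap_seq; apply/seteqP; split => x /= H i;
  [move=> _|]; apply: (H i) => /=; rewrite mem_index_enum.
Qed.

End lebesgue_rV.

(* Measurability for the completed (Lebesgue) sigma-algebra: equality almost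
   everywhere with a Borel function. *)
Definition lmeasurable {R : realType} d (T : measurableType d)
    d' (T' : measurableType d') (mu : {measure set T -> \bar R})
    (D : set T) (f : T -> T') :=
  exists2 g : T -> T', measurable_fun D g &
    {ae mu, forall x, D x -> f x = g x}.

Section navier_stokes.
Context {R : realType} {d : nat}.
Implicit Types (t eps : R) (x y xi : 'rV[R]_d) (a : 'rV[R]_d -> 'rV[R]_d).
Implicit Types (f u : 'rV[R]_d -> R -> 'rV[R]_d).

Definition edot x y : R := \sum_i x ord0 i * y ord0 i.

(* The library norm of ['rV[R]_d] is the sup norm. *)
Definition enorm x : R := Num.sqrt (edot x x).

Definition partial (h : 'I_d) (phi : 'rV[R]_d -> R) : 'rV[R]_d -> R :=
  'D_(delta_mx ord0 h : 'rV[R]_d) phi.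

Definition smooth (phi : 'rV[R]_d -> R) :=
  forall (s : seq 'I_d) x, differentiable (foldr partial phi s) x.

Definition test_function (phi : 'rV[R]_d -> R) :=
  smooth phi /\ exists M, forall x, M < enorm x -> phi x = 0.

(* In the sense of distributions. *)
Definition divergence_free a := forall phi, test_function phi ->
  \int[lebesgue_rV d]_x (\sum_j a x ord0 j * partial j phi x) = 0.

Definition convolution (g v : 'rV[R]_d -> R) x : R :=
  \int[lebesgue_rV d]_y (g (x - y) * v y).

Definition heat_kernel t x : R :=
  (4 * pi * t) `^ (- (d%:R / 2)) * expR (- (enorm x ^+ 2 / (4 * t))).

Definition stokes_symbol t (j k : 'I_d) xi : R :=
  expR (- t * enorm xi ^+ 2) *
  ((j == k)%:R - xi ord0 j * xi ord0 k / enorm xi ^+ 2).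

(* Fourier inversion: since the symbol is integrable and even, its inverse
   Fourier transform is real and reduces to a cosine integral. *)
Definition stokes_kernel t (j k : 'I_d) x : R :=
  (2 * pi) ^- d *
  \int[lebesgue_rV d]_xi (cos (edot x xi) * stokes_symbol t j k xi).

Definition heat_op t a x : 'rV[R]_d :=
  \row_j convolution (heat_kernel t) (fun y => a y ord0 j) x.

Definition stokes_op t (v : 'rV[R]_d -> 'rV[R]_d) x : 'rV[R]_d :=
  \row_j \sum_k convolution (stokes_kernel t j k) (fun y => v y ord0 k) x.

(* [e^{t Delta} P div (v (x) v)]; the derivative falls on the kernel. *)
Definition stokes_div_op t (v : 'rV[R]_d -> 'rV[R]_d) x : 'rV[R]_d :=
  \row_j \sum_h \sum_k convolution (partial h (stokes_kernel t j k))
                         (fun y => v y ord0 h * v y ord0 k) x.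

Definition duhamel (S : R -> ('rV[R]_d -> 'rV[R]_d) -> 'rV[R]_d -> 'rV[R]_d)
    (g : 'rV[R]_d -> R -> 'rV[R]_d) x t : 'rV[R]_d :=
  \row_j \int[@lebesgue_measure R]_(s in `]0, t[) S (t - s) (g^~ s) x ord0 j.

(* The strong solution with force [f] and datum [a], in the class where it is
   unique; only its values at positive times matter. *)
Definition strong_solution eps f a u :=
  [/\ lmeasurable (lebesgue_rV d \x @lebesgue_measure R)%E
        ([set: 'rV[R]_d] `*` `]0, +oo[) (fun z => u z.1 z.2),
      forall x t, 0 < t ->
        u x t = heat_op t a x - duhamel stokes_div_op u x t
                + duhamel stokes_op f x t,
      exists2 C : R, 0 < C & forall x t, 0 < t ->
        enorm (u x t) <=
          C * eps * Num.min ((1 + enorm x) ^- d) ((1 + t) `^ (- (d%:R / 2))),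
      {ae lebesgue_rV d, forall x, u x t @[t --> 0^'+] --> a x} &
      forall phi, test_function phi -> forall j,
        \int[lebesgue_rV d]_x (u x t ord0 j * phi x) @[t --> 0^'+] -->
        \int[lebesgue_rV d]_x (a x ord0 j * phi x)].

(* [a(x) = o(|x|^{-d})] *)
Definition far_field_o a :=
  ess_sup (lebesgue_rV d)
    (fun x => (\1_[set y | r <= enorm y] x * enorm x ^+ d * enorm (a x))%:E)
    @[r --> +oo] --> 0%E.

(* [|| (1 + |x|)^alpha v ||_p] *)
Definition weighted_Lnorm (alpha : R) (p : \bar R) (v : 'rV[R]_d -> 'rV[R]_d) :=
  ('N[lebesgue_rV d]_p [(fun x => ((1 + enorm x) `^ alpha * enorm (v x))%:E)])%E.

End navier_stokes.

(* [d / p], with [d / oo = 0] *)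
Definition dim_over {R : realType} (d : nat) (p : \bar R) : R :=
  if p is r%:E then d%:R / r else 0.

(* Main.v *)
(* Put m = \int\int f.  In the region |x|^2 >= M t each term of the integral
   equation is compared with K(x,t) m: the heat term is o(|x|^{-d}), while the
   nonlinear term and the error made by freezing the kernel of the force term
   at (x,t) are O((t/|x|^2)^{1/2} |x|^{-d}).  Since |xi|^{-2} e^{-t|xi|^2} is the
   integral of e^{-s|xi|^2} over s > t, K_{jk}(x,t) equals delta_{jk} G_t plus the
   integral of d_j d_k G_s over s > t, and m . K(x,t) m <= -c |m|^2 |x|^{-d} for x
   close to the hyperplane orthogonal to m; hence |u(x,t)| >= c' |x|^{-d} there.
   A box of size (M t)^{1/2} in that region yields the lower bounds, and the
   dyadic dilates of the box yield the infinite norms.  The upper bounds only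
   integrate the decay assumed of u. *)
Require Import Defs.
From HB Require Import structures.
From mathcomp Require Import all_boot all_order all_algebra.
From mathcomp Require Import all_classical all_reals all_analysis ess_sup_inf.
From mathcomp Require Import measurable_realfun ring lra.

Set Implicit Arguments.
Unset Strict Implicit.
Unset Printing Implicit Defensive.

Import Order.TTheory GRing.Theory Num.Theory.
Import numFieldNormedType.Exports.

Local Open Scope classical_set_scope.
Local Open Scope ring_scope.

(** * Integration preliminaries *)

(** Two obstacles shape the development. The data are measurable only up to null sets of the
    product, so at a fixed time an integrand may fail to be measurable; every estimate is therefore
    an almost everywhere comparison with integrable functions. And the kernel is known only as a
    superposition of heat kernels, so its bounds are all powers of the parabolic weight
    [W = |x|^2 + s]: Gaussian factors are traded for such powers, which have an explicit primitive
    in [s] and reduce to one-variable integrals in space. The rate [(t/|x|^2)^{1/2}] has one source.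
    [W^{-d/2}] is not integrable in space, while [W^{-(d+1)/2}] is, with mass of order [s^{-1/2}];
    the time integral of that mass over []0, t[] is of order [t^{1/2}], and the extra half power is
    paid for by [1/|x|]. The quadratic form of the kernel in the direction [m] has a controlled sign
    only in a cone, so the lower bound is proved there alone. This suffices because the cone
    contains boxes whose volume is a fixed fraction of that of a ball of the same scale. Such boxes
    are centred on a nonzero vector orthogonal to [m], which is where dimension at least two
    enters. *)

Section integral_without_measurability.
Context d (T : measurableType d) (R : realType).
Variable mu : {measure set T -> \bar R}.
Local Open Scope ereal_scope.

Import HBNNSimple.

(* The library integral of a nonnegative function is a supremum over simple
   functions below it, hence monotone even on non-measurable functions. *)
Lemma ge0_le_integral_ae (D : set T) (f g : T -> \bar R) :
  (forall x, D x -> 0 <= f x) -> (forall x, D x -> 0 <= g x) ->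
  {ae mu, forall x, D x -> f x <= g x} ->
  \int[mu]_(x in D) f x <= \int[mu]_(x in D) g x.
Proof.
move=> f0 g0 [N [mN N0 fgN]].
rewrite !ge0_integralE//; apply: ge_ereal_sup => _ [h /= hf <-].
(* Setting the simple function to zero on the null set where the comparison fails leaves its
   integral unchanged and puts it below [g] everywhere. *)
pose h' := proj_nnsfun h (measurableC mN).
have -> : sintegral mu h = sintegral mu h'.
  rewrite -!integralT_nnsfun; apply: ge0_ae_eq_integral => //.
  - exact/measurable_EFinP.
  - exact/measurable_EFinP.
  - by move=> x _; rewrite lee_fin.
  - by move=> x _; rewrite lee_fin.
  - exists N; split=> // x /=; apply: contra_notP => Nx _ /=.
    by rewrite mindicE mem_set ?mulr1.
apply: ereal_sup_ubound; exists h' => //= x; rewrite mindicE.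
have [xN|xN] := boolP (x \in ~` N); last first.
  rewrite mulr0 patchE; case: ifPn => // /set_mem; exact: g0.
rewrite mulr1; apply: (le_trans (hf x)); rewrite !patchE; case: ifPn => // /set_mem Dx.
have := set_mem xN; apply: contra_notP => nfg; apply: fgN => /= /(_ Dx).
exact: nfg.
Qed.

Lemma ge0_le_integral_pw (D : set T) (f g : T -> \bar R) :
  (forall x, D x -> 0 <= f x) -> (forall x, D x -> f x <= g x) ->
  \int[mu]_(x in D) f x <= \int[mu]_(x in D) g x.
Proof.
move=> f0 fg; apply: ge0_le_integral_ae => //; last exact: aeW.
by move=> x Dx; rewrite (le_trans (f0 _ Dx))// fg.
Qed.

(** Antisymmetry of the monotonicity above, applied to positive and negative parts separately;
    neither side has to be measurable. *)
Lemma eq_integral_ae (D : set T) (f g : T -> \bar R) :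
  {ae mu, forall x, D x -> f x = g x} ->
  \int[mu]_(x in D) f x = \int[mu]_(x in D) g x.
Proof.
move=> fg; rewrite integralE [RHS]integralE; congr (_ - _); apply/eqP;
  rewrite eq_le; apply/andP; split; apply: ge0_le_integral_ae => //;
  by apply: filterS fg => x /[apply]; rewrite ?funeposE ?funenegE => ->.
Qed.

(** Positive parts are ordered like the functions and negative parts in reverse, so the extended
    integral of [f] lies between two finite numbers. Finiteness of the outer integrals thus replaces
    integrability of [f]. *)
Lemma Rintegral_ae_bounds (D : set T) (f L U : T -> R) :
  measurable D ->
  mu.-integrable D (EFin \o L) -> mu.-integrable D (EFin \o U) ->
  {ae mu, forall x, D x -> (L x <= f x <= U x)%R} ->
  (\int[mu]_(x in D) L x <= \int[mu]_(x in D) f x <= \int[mu]_(x in D) U x)%R.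
Proof.
move=> mD iL iU LfU.
have le_pos (g h : T -> R) : {ae mu, forall x, D x -> (g x <= h x)%R} ->
    \int[mu]_(x in D) (EFin \o g)^\+ x <= \int[mu]_(x in D) (EFin \o h)^\+ x.
  move=> gh; apply: ge0_le_integral_ae => //.
  apply: filterS gh => x /[apply] gh; rewrite !funeposE/=.
  by rewrite ge_max le_max lee_fin gh/= le_max lexx orbT.
have le_neg (g h : T -> R) : {ae mu, forall x, D x -> (g x <= h x)%R} ->
    \int[mu]_(x in D) (EFin \o h)^\- x <= \int[mu]_(x in D) (EFin \o g)^\- x.
  move=> gh; apply: ge0_le_integral_ae => //.
  apply: filterS gh => x /[apply] gh; rewrite !funenegE/=.
  by rewrite ge_max le_max lee_fin lerN2 gh/= le_max lexx orbT.
have Lf : {ae mu, forall x, D x -> (L x <= f x)%R}.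
  by apply: filterS LfU => x /[apply] /andP[].
have fU : {ae mu, forall x, D x -> (f x <= U x)%R}.
  by apply: filterS LfU => x /[apply] /andP[].
have Lf' : \int[mu]_(x in D) (L x)%:E <= \int[mu]_(x in D) (f x)%:E.
  by rewrite integralE [leRHS]integralE; apply: leeB; [exact: le_pos|exact: le_neg].
have fU' : \int[mu]_(x in D) (f x)%:E <= \int[mu]_(x in D) (U x)%:E.
  by rewrite integralE [leRHS]integralE; apply: leeB; [exact: le_pos|exact: le_neg].
have finL := integrable_fin_num mD iL; have finU := integrable_fin_num mD iU.
have finf : \int[mu]_(x in D) (f x)%:E \is a fin_num.
  rewrite fin_numElt (lt_le_trans _ Lf') ?(le_lt_trans fU')//.
    by move: finU; rewrite fin_numElt => /andP[].
  by move: finL; rewrite fin_numElt => /andP[].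
by rewrite /Rintegral !fine_le.
Qed.

Lemma normr_Rintegral_le_ae (D : set T) (f U : T -> R) :
  measurable D -> mu.-integrable D (EFin \o U) ->
  {ae mu, forall x, D x -> (`|f x| <= U x)%R} ->
  (`|\int[mu]_(x in D) f x| <= \int[mu]_(x in D) U x)%R.
Proof.
move=> mD iU fU.
have iN : mu.-integrable D (EFin \o (fun x => - U x)%R).
  by have := integrableN iU.
have /andP[h1 h2] : (\int[mu]_(x in D) - U x <= \int[mu]_(x in D) f x
    <= \int[mu]_(x in D) U x)%R.
  by apply: Rintegral_ae_bounds => //; apply: filterS fU => x /[apply]; rewrite ler_norml.
rewrite ler_norml h2 andbT; apply: le_trans h1.
have -> : (\int[mu]_(x in D) - U x = \int[mu]_(x in D) (-1 * U x))%R.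
  by apply: eq_Rintegral => x _; rewrite mulN1r.
by rewrite RintegralZl// mulN1r.
Qed.

(** Subtracting under the integral would require [f] to be integrable; enclosing [f] between [g - H]
    and [g + H] does not. *)
Lemma Rintegral_near_ae (D : set T) (f g H : T -> R) :
  measurable D -> mu.-integrable D (EFin \o g) ->
  mu.-integrable D (EFin \o H) ->
  {ae mu, forall x, D x -> (`|f x - g x| <= H x)%R} ->
  (`|\int[mu]_(x in D) f x - \int[mu]_(x in D) g x| <=
     \int[mu]_(x in D) H x)%R.
Proof.
move=> mD ig iH fgH.
have iL : mu.-integrable D (EFin \o (fun x => g x - H x)%R).
  by have := integrableB mD ig iH.
have iU : mu.-integrable D (EFin \o (fun x => g x + H x)%R).
  by have := integrableD mD ig iH.
rewrite ler_distl -RintegralB// -RintegralD//.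
apply: Rintegral_ae_bounds => //.
by apply: filterS fgH => x /[apply]; rewrite ler_distl.
Qed.

End integral_without_measurability.

Lemma measurable_fun_powRl d (T : measurableType d) (R : realType) (f : T -> R)
    (q : R) :
  measurable_fun setT f -> measurable_fun setT (fun x => f x `^ q).
Proof. by move=> mf; apply: (measurableT_comp (measurable_powR q) mf). Qed.

(** * One-variable integrals of powers *)

Section one_dimensional_integrals.
Context {R : realType}.
Notation mu := (@lebesgue_measure R).

Lemma is_derive_continuous (F : R -> R) (x df : R) :
  is_derive x 1 F df -> {for x, continuous F}.
Proof. by move=> [dF _]; exact/differentiable_continuous/derivable1_diffP. Qed.

Lemma integral_is_derive_cy (f F : R -> R) (a l : R) :
  (forall x, a <= x -> 0 <= f x) ->
  (forall x, a <= x -> is_derive x 1 F (f x)) ->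
  (forall x, a <= x -> {for x, continuous f}) ->
  F x @[x --> +oo] --> l ->
  (\int[mu]_(x in `[a, +oo[) (f x)%:E = (l - F a)%:E)%E.
Proof.
move=> f0 dF cf Fl; rewrite EFinB; apply: ge0_continuous_FTC2y => //.
- apply/continuous_within_itvcyP; split.
    by move=> x; rewrite in_itv/= andbT => /ltW; exact: cf.
  exact/cvg_at_right_filter/cf.
- by move=> x /ltW /dF[].
- exact/cvg_at_right_filter/(is_derive_continuous (dF _ _)).
- move=> x; rewrite in_itv/= andbT => /ltW /dF[? <-].
  by rewrite derive1E.
Qed.

Lemma integral_is_derive_cc (f F : R -> R) (a b : R) : a < b ->
  (forall x, a <= x <= b -> is_derive x 1 F (f x)) ->
  (forall x, a <= x <= b -> {for x, continuous f}) ->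
  (\int[mu]_(x in `[a, b]) (f x)%:E = (F b - F a)%:E)%E.
Proof.
move=> ab dF cf; have aab : a <= a <= b by rewrite lexx ltW.
have bab : a <= b <= b by rewrite lexx ltW.
rewrite EFinB; apply: continuous_FTC2 => //.
- apply/continuous_within_itvP => //; split.
  + by move=> x; rewrite in_itv/= => /andP[/ltW ? /ltW ?]; apply/cf/andP.
  + exact/cvg_at_right_filter/cf.
  + exact/cvg_at_left_filter/cf.
- split.
  + move=> x; rewrite in_itv/= => /andP[/ltW ax /ltW xb].
    by have [] : is_derive x 1 F (f x) by apply/dF/andP.
  + exact/cvg_at_right_filter/(is_derive_continuous (dF _ _)).
  + exact/cvg_at_left_filter/(is_derive_continuous (dF _ _)).
- move=> x; rewrite in_itv/= => /andP[/ltW ax /ltW xb].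
  have [_ <-] : is_derive x 1 F (f x) by apply/dF/andP.
  by rewrite derive1E.
Qed.

Lemma cvg_powRN_y (r q : R) : 0 < q -> (r + s) `^ (- q) @[s --> +oo] --> 0.
Proof.
move=> q0; apply/cvgrPdist_lt => e e0; near=> s.
have rs : e `^ (- q^-1) < r + s.
  by rewrite -ltrBlDl; near: s; apply: nbhs_pinfty_gt; exact: num_real.
have rs0 : 0 < r + s by apply: le_lt_trans rs; exact: powR_ge0.
rewrite sub0r normrN ger0_norm ?powR_ge0// powRN.
have : (e `^ (- q^-1)) `^ q < (r + s) `^ q.
  by apply: gt0_ltr_powR => //; rewrite nnegrE ?powR_ge0// ltW.
rewrite -powRrM mulNr mulVf ?gt_eqF// powR_inv1 ?ltW// => h.
by rewrite -[ltRHS]invrK ltf_pV2// posrE ?invr_gt0// powR_gt0.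
Unshelve. all: by end_near. Qed.

Lemma is_derive_powR_shift (r q s : R) : 0 < r + s ->
  is_derive s 1 (fun x => (r + x) `^ q) (q * (r + s) `^ (q - 1)).
Proof.
move=> rs; have hp : is_derive (r + s) 1 (fun x : R => x `^ q) (q * (r + s) `^ (q - 1)).
  exact: is_derive1_powR.
have hs : is_derive s 1 (fun x => r + x) 1.
  have := is_deriveD (is_derive_cst r s 1) (is_derive_id s 1); rewrite add0r; exact.
have := @is_derive1_comp _ (fun x : R => x `^ q) (fun x => r + x) s _ _ hp hs.
by rewrite mulr1.
Qed.

(** Used with [r = |x|^2]: integrating a bound in powers of [W] over all times beyond [t] regains
    one power of [W]. *)
Lemma integral_powR_shift (r t q : R) : 0 < q -> 0 < r + t ->
  (\int[mu]_(s in `[t, +oo[) ((r + s) `^ (- q - 1))%:E =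
   (q^-1 * (r + t) `^ (- q))%:E)%E.
Proof.
move=> q0 rt.
have rs s : t <= s -> 0 < r + s by move=> ts; rewrite (lt_le_trans rt)// lerD2l.
have dF s : t <= s -> is_derive s 1 (fun s => - q^-1 * (r + s) `^ (- q))
    ((r + s) `^ (- q - 1)).
  move=> ts; have h := is_derive_powR_shift (- q) (rs s ts).
  have := is_deriveZ (- q^-1) h.
  rewrite (_ : _ *: (_ * _) = (r + s) `^ (- q - 1))//.
  by rewrite /GRing.scale/= mulrA mulrNN mulVf ?gt_eqF// mul1r.
rewrite (integral_is_derive_cy _ dF _ (l := 0)).
- by rewrite /= sub0r mulNr opprK.
- by move=> s _; exact: powR_ge0.
- by move=> s ts; exact: is_derive_continuous (is_derive_powR_shift _ (rs s ts)).
- rewrite -(mulr0 (- q^-1)); apply: cvgM; first exact: cvg_cst.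
  exact: cvg_powRN_y.
Qed.

Lemma integral_inv_sqrt_shift_le (t : R) : 0 < t ->
  (\int[mu]_(s in `]0%R, t[) ((1 + s) `^ (- 2^-1))%:E <=
   (2 * (1 + t) `^ (2^-1))%:E)%E.
Proof.
move=> t0; have s1 s : 0 <= s <= t -> 0 < 1 + s by move=> /andP[? _]; lra.
have -> : (2 * (1 + t) `^ 2^-1 = 2 * (1 + t) `^ 2^-1 - 2 * (1 + 0) `^ 2^-1 + 2)%R.
  by rewrite addr0 powR1; ring.
apply: (@le_trans _ _ (\int[mu]_(s in `[0%R, t]) ((1 + s) `^ (- 2^-1))%:E)%E).
  apply: ge0_subset_integral => //.
  - apply/measurable_EFinP/measurable_funTS.
    by apply: measurable_fun_powRl; exact: measurable_funD.
  - by move=> s _; rewrite lee_fin powR_ge0.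
  - by move=> x /=; exact: subset_itv_oo_cc.
have dF s : 0 <= s <= t ->
    is_derive s 1 (fun s => 2 * (1 + s) `^ 2^-1) ((1 + s) `^ (- 2^-1)).
  move=> /s1 s0; have := is_deriveZ 2 (is_derive_powR_shift (2^-1) s0).
  rewrite (_ : _ *: (_ * _) = (1 + s) `^ (- 2^-1))//.
  by rewrite /GRing.scale/= mulrA divff// mul1r; congr (_ `^ _); lra.
rewrite (integral_is_derive_cc _ dF)//.
- by rewrite lee_fin lerDl.
- by move=> s /s1 s0; exact: is_derive_continuous (is_derive_powR_shift _ s0).
Qed.

(* The integrand blows up at [t], so the bound is obtained on [0, t - 1/n] first. *)
Lemma integral_inv_sqrt_sub_le (t : R) : 0 < t ->
  (\int[mu]_(s in `]0%R, t[) ((t - s) `^ (- 2^-1))%:E <= (2 * t `^ (2^-1))%:E)%E.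
Proof.
(* Cutting off [t / (n + 2)] rather than [t / (n + 1)] makes the interval nondegenerate already for
   [n = 0]. *)
move=> t0; pose F n := [set` `[0, t - t / n.+2%:R]] : set R.
pose g s : R := (t - s) `^ (- 2^-1).
have tn n : 0 < t / n.+2%:R < t.
  by rewrite divr_gt0//= ltr_pdivrMr// ltr_pMr// ltr1n.
have mg : measurable_fun setT g.
  by apply: measurable_fun_powRl; exact: measurable_funB.
have sub : `]0, t[ `<=` \bigcup_n F n.
  move=> s /=; rewrite in_itv/= => /andP[s0 st].
  have ts : 0 < t - s by rewrite subr_gt0.
  have /ltr_add_invr[k hk] : 0 < (t - s) / t by rewrite divr_gt0.
  rewrite add0r in hk; exists k => //=; rewrite /F/= in_itv/= (ltW s0)/=.
  rewrite lerBrDr -lerBrDl ltW// (le_lt_trans (y := t * k.+1%:R^-1))//.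
    by rewrite ler_pM2l// lef_pV2 ?posrE// ler_nat.
  by rewrite mulrC -ltr_pdivlMr.
have mF n : measurable (F n) by exact: measurable_itv.
have ndF : nondecreasing_seq F.
  move=> m n mn; apply/subsetPset => s; rewrite /F/= !in_itv/= => /andP[-> ]/=.
  move=> /le_trans; apply; rewrite lerD2l lerN2 ler_pM2l//.
  by rewrite lef_pV2 ?posrE// ler_nat.
apply: (@le_trans _ _ (\int[mu]_(s in \bigcup_n F n) (g s)%:E)%E).
  apply: ge0_subset_integral => //.
  - by apply: bigcup_measurable => n _; exact: mF.
  - exact/measurable_EFinP/measurable_funTS.
  - by move=> s _; rewrite lee_fin powR_ge0.
have h : (\int[mu]_(s in F i) (g s)%:E)%E @[i --> \oo] -->
    (\int[mu]_(s in \bigcup_i F i) (g s)%:E)%E.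
  apply: ge0_nondecreasing_set_cvg_integral => //.
  - by move=> n; exact/measurable_EFinP/measurable_funTS.
  - by move=> n s _; rewrite lee_fin powR_ge0.
rewrite -(cvg_lim _ h)//; apply: lime_le; first exact: (cvgP _ h).
apply: nearW => n; have /andP[tn0 tnt] := tn n.
have ts s : 0 <= s <= t - t / n.+2%:R -> 0 < t - s.
  by move=> /andP[s0 st]; rewrite subr_gt0 (le_lt_trans st)// gtrBl.
have dq q s : 0 < t - s ->
    is_derive s 1 (fun s => (t - s) `^ q) (- (q * (t - s) `^ (q - 1))).
  move=> s0; have hp : is_derive (t - s) 1 (fun x : R => x `^ q) (q * (t - s) `^ (q - 1)).
    exact: is_derive1_powR.
  have hs := is_deriveB (is_derive_cst t s 1) (is_derive_id s 1).
  have := @is_derive1_comp _ (fun x : R => x `^ q) (fun x => t - x) s _ _ hp hs.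
  by rewrite sub0r mulrN1.
have dF s : 0 <= s <= t - t / n.+2%:R ->
    is_derive s 1 (fun s => - 2 * (t - s) `^ 2^-1) (g s).
  move=> /ts s0; have := is_deriveZ (- 2) (dq (2^-1) s s0).
  rewrite (_ : _ *: - (_ * _) = g s)//.
  rewrite /GRing.scale/= mulrNN mulrA divff// mul1r /g; congr (_ `^ _); lra.
rewrite /F (integral_is_derive_cc _ dF)//.
- rewrite lee_fin/= subr0 !mulNr opprK gerDr oppr_le0.
  by rewrite mulr_ge0// powR_ge0.
- by rewrite subr_gt0.
- by move=> s /ts s0; exact: is_derive_continuous (dq _ _ s0).
Qed.

End one_dimensional_integrals.

Lemma le_powRN (R : realType) (x y q : R) :
  0 <= q -> 0 < x -> x <= y -> y `^ (- q) <= x `^ (- q).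
Proof.
move=> q0 x0 xy; have y0 := lt_le_trans x0 xy.
rewrite !powRN lef_pV2 ?posrE ?powR_gt0//.
by rewrite ge0_ler_powR// nnegrE ltW.
Qed.

Section one_dimensional_power_bound.
Context {R : realType}.
Notation mu := (@lebesgue_measure R).

Lemma continuous_sqr_powR (a q : R) : 0 < a ->
  continuous (fun z : R => (z ^+ 2 + a) `^ q).
Proof.
move=> a0 z; have za : 0 < z ^+ 2 + a by rewrite ltr_wpDl// sqr_ge0.
apply: (@continuous_comp _ _ _ (fun z : R => z ^+ 2 + a) (fun x => x `^ q)).
  by apply: continuousD; [exact: exprn_continuous|exact: cvg_cst].
exact: is_derive_continuous (is_derive1_powR q za).
Qed.

Lemma integral_translation (G : R -> R) (c : R) :
  continuous G -> (forall x, 0 <= G x) ->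
  (\int[mu]_x (G (x - c))%:E = \int[mu]_x (G x)%:E)%E.
Proof.
move=> cG G0.
have dF (x : R) : is_derive x 1 (fun x : R => x - c) 1.
  by have := is_deriveB (is_derive_id x 1) (is_derive_cst c x 1); rewrite subr0.
have F' : ((fun x : R => x - c)^`() = cst 1)%classic.
  by apply/funext => x; rewrite derive1E; have [_ ->] := dF x.
rewrite [RHS](@increasing_ge0_integration_by_substitutionT _ (fun x => x - c)) //.
- by apply: eq_integral => x _; rewrite F' /= mulr1.
- by move=> x y xy; rewrite ltrD2r.
- by rewrite F'; exact: cst_continuous.
- by rewrite F'; exact: is_cvg_cst.
- by rewrite F'; exact: is_cvg_cst.
- by apply/cvgrNyPle => A; near=> x; rewrite lerBlDr; near: x; apply: nbhs_ninfty_le; exact: num_real.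
- by apply/cvgryPge => A; near=> x; rewrite lerBrDr; near: x; apply: nbhs_pinfty_ge; exact: num_real.
Unshelve. all: by end_near. Qed.

(** After translation and folding onto the half-line, [z^2 + b^2 >= (b + z)^2 / 2] with [b^2 = a]
    replaces the integrand by a pure power of [b + z], whose integral is explicit. The exponent of
    [a] is the one dictated by scaling. *)
Lemma integral_sqr_powR_le (g : R) : 0 < g ->
  exists2 C : R, 0 < C & forall a c : R, 0 < a ->
  (\int[mu]_z (((c - z) ^+ 2 + a) `^ (- ((1 + g) / 2)))%:E <=
   (C * a `^ (- (g / 2)))%:E)%E.
Proof.
move=> g0; pose q := (1 + g) / 2; have q0 : 0 < q by rewrite divr_gt0// addr_gt0.
(* The outer 2 comes from folding, [2^q] from the elementary inequality between squares, and [1/g]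
   from the primitive. *)
exists (2 * (2 `^ q * g^-1)).
  by rewrite !mulr_gt0 ?powR_gt0 ?invr_gt0.
move=> a c a0; pose b := Num.sqrt a; have b0 : 0 < b by rewrite sqrtr_gt0.
have ab : a = b ^+ 2 by rewrite sqr_sqrtr// ltW.
pose G z : R := (z ^+ 2 + a) `^ (- q).
have cG : continuous G by exact: continuous_sqr_powR.
have G0 z : 0 <= G z by exact: powR_ge0.
have -> : (\int[mu]_z (((c - z) ^+ 2 + a) `^ (- q))%:E = \int[mu]_z (G z)%:E)%E.
  rewrite -(integral_translation c cG G0).
  by apply: eq_integral => z _; rewrite /G -sqrrN opprB.
rewrite ge0_symfun_integralT//; last by move=> z /=; rewrite /G sqrrN.
rewrite -mulrA EFinM lee_pmul2l//= -set_itvcy.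
have mb : measurable_fun setT (fun z => (b + z) `^ (- g - 1)).
  by apply: measurable_fun_powRl; exact: measurable_funD.
apply: (@le_trans _ _ (\int[mu]_(z in `[0%R, +oo[) ((2 `^ q)%:E * ((b + z) `^ (- g - 1))%:E)))%E.
  apply: ge0_le_integral_pw => [z _|]; first by rewrite lee_fin.
  move=> z; rewrite /= in_itv/= andbT => z0; rewrite -EFinM lee_fin /G.
  have bz : 0 < b + z by rewrite ltr_pwDl.
  apply: (@le_trans _ _ (((b + z) ^+ 2 / 2) `^ (- q))).
    apply: le_powRN; [exact: ltW|by rewrite divr_gt0// exprn_gt0|].
    by rewrite ab; have := sqr_ge0 (b - z); lra.
  rewrite powRM ?sqr_ge0 ?invr_ge0// mulrC; apply: ler_pM; rewrite ?powR_ge0//.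
    by rewrite -powR_inv1// -powRrM mulN1r opprK.
  rewrite -(powR_mulrn _ (ltW bz)) -powRrM (_ : 2%:R * - q = - g - 1)//.
  by rewrite /q mulrN mulrC divfK// opprD addrC.
rewrite ge0_integralZl; first last.
- by rewrite lee_fin powR_ge0.
- by move=> z _; rewrite lee_fin powR_ge0.
- exact/measurable_EFinP/measurable_funTS.
- exact: measurable_itv.
rewrite integral_powR_shift ?addr0// -EFinM lee_fin -mulrA ler_pM2l ?powR_gt0//.
rewrite ler_pM2l ?invr_gt0// ab -(powR_mulrn _ (ltW b0)) -powRrM (_ : 2%:R * - (g / 2) = - g)//.
by rewrite mulrN mulrC divfK.
Qed.

End one_dimensional_power_bound.

Section measurable_vector_functions.
Context {R : realType} {n : nat} d (T : measurableType d).
Implicit Types f g : T -> 'rV[R]_n.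

Lemma measurable_fun_rV_coord f (i : 'I_n) : measurable_fun setT f ->
  measurable_fun setT (fun x => f x ord0 i : R).
Proof. by move=> /measurable_fun_rVP /(_ i). Qed.

Lemma measurable_fun_rVB f g : measurable_fun setT f -> measurable_fun setT g ->
  measurable_fun setT (fun x => f x - g x).
Proof.
move=> mf mg; apply/measurable_fun_rVP => i.
rewrite (_ : _ \o _ = (fun x => f x ord0 i - g x ord0 i)).
  by apply: measurable_funB; exact: measurable_fun_rV_coord.
by apply/funext => x; rewrite /rV_coord /= !mxE.
Qed.

Lemma measurable_fun_edot f g : measurable_fun setT f -> measurable_fun setT g ->
  measurable_fun setT (fun x => edot (f x) (g x)).
Proof.
move=> mf mg; apply: measurable_sum => i.
by apply: measurable_funM; exact: measurable_fun_rV_coord.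
Qed.

Lemma measurable_fun_enorm f : measurable_fun setT f ->
  measurable_fun setT (fun x => enorm (f x)).
Proof.
move=> mf; apply: (measurableT_comp (f := @Num.sqrt R)).
  by apply: continuous_measurable_fun => x; exact: sqrt_continuous.
exact: measurable_fun_edot.
Qed.

End measurable_vector_functions.

(** * Integration and Euclidean estimates in [n] variables *)

Section integrals_over_vectors.
Context {R : realType}.
Local Open Scope ereal_scope.

Lemma ge0_integral_rVS n (F : 'rV[R]_n.+1 -> \bar R) :
  measurable_fun setT F -> (forall x, 0 <= F x) ->
  \int[lebesgue_rV n.+1]_x F x =
  \int[@lebesgue_measure R]_s \int[lebesgue_rV n]_v F (rV_cons (s, v)).
Proof.
move=> mF F0.
have -> : \int[lebesgue_rV n.+1]_x F x =
    \int[(@lebesgue_measure R \x lebesgue_rV n)]_p F (rV_cons p).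
  exact: (ge0_integral_pushforward (@measurable_rV_cons R n) _ measurableT mF).
rewrite fubini_tonelli1//.
by apply: measurableT_comp => //; exact: measurable_rV_cons.
Qed.

Lemma integral_rVS n (F : 'rV[R]_n.+1 -> \bar R) :
  (lebesgue_rV n.+1).-integrable setT F ->
  \int[lebesgue_rV n.+1]_x F x =
  \int[@lebesgue_measure R]_s \int[lebesgue_rV n]_v F (rV_cons (s, v)).
Proof.
move=> iF; have mF := measurable_int _ iF.
have mc := @measurable_rV_cons R n.
have iF' : (@lebesgue_measure R \x lebesgue_rV n).-integrable setT (F \o @rV_cons R n).
  apply/integrableP; split; first exact: measurableT_comp.
  move/integrableP : iF => [_]; apply: le_lt_trans.
  by rewrite (ge0_integral_pushforward mc _ measurableT)//; exact: measurableT_comp.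
transitivity (\int[(@lebesgue_measure R \x lebesgue_rV n)]_p (F \o @rV_cons R n) p).
  exact: (integral_pushforward mc mF iF' measurableT).
exact/esym/(integral12_prod_meas1 iF').
Qed.

Lemma ge0_integral_tensor n (p : 'I_n -> R -> R) :
  (forall i, measurable_fun setT (p i)) -> (forall i s, 0 <= p i s)%R ->
  \int[lebesgue_rV n]_x (\prod_i p i (x ord0 i))%:E =
  \prod_i \int[@lebesgue_measure R]_s (p i s)%:E.
Proof.
elim: n p => [p mp p0|n ih p mp p0].
  rewrite big_ord0; under eq_integral do rewrite big_ord0.
  by rewrite integral_cst//= diracE in_setT mule1.
have mprod m (r : 'I_m -> R -> R) : (forall i, measurable_fun setT (r i)) ->
    measurable_fun setT (fun x : 'rV[R]_m => \prod_i r i (x ord0 i))%R.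
  move=> mr; apply: measurable_prod => i _.
  exact: (measurableT_comp (mr i) (measurable_rV_coord i)).
rewrite ge0_integral_rVS.
- rewrite big_ord_recl -ih//.
  have mI : measurable_fun setT (fun x : 'rV[R]_n =>
      \prod_i p (lift ord0 i) (x ord0 i))%R.
    by apply: (mprod n (fun i => p (lift ord0 i))).
  have I0 : 0 <= \int[lebesgue_rV n]_x (\prod_i p (lift ord0 i) (x ord0 i))%:E.
    by apply: integral_ge0 => x _; rewrite lee_fin; apply: prodr_ge0.
  rewrite -ge0_integralZr//.
  + apply: eq_integral => s _.
    rewrite -ge0_integralZl//.
    * apply: eq_integral => v _; rewrite big_ord_recl EFinM.
      rewrite {1}/rV_cons mxE unlift_none/=; congr (_ * _)%E.
      by congr EFin; apply: eq_bigr => i _; rewrite mxE liftK.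
    * exact/measurable_EFinP.
    * by move=> x _; rewrite lee_fin; apply: prodr_ge0.
    * by rewrite lee_fin.
  + by apply/measurable_EFinP; exact: mp.
  + by move=> s _; rewrite lee_fin.
- by apply/measurable_EFinP; exact: (mprod n.+1 p).
- by move=> x; rewrite lee_fin; apply: prodr_ge0.
Qed.

End integrals_over_vectors.

Section euclidean_norm.
Context {R : realType} {n : nat}.
Implicit Types x y z : 'rV[R]_n.

Lemma edotC x y : edot x y = edot y x.
Proof. by apply: eq_bigr => i _; rewrite mulrC. Qed.

Lemma edotDl x y z : edot (x + y) z = edot x z + edot y z.
Proof. by rewrite -big_split; apply: eq_bigr => i _; rewrite mxE mulrDl. Qed.

Lemma edotZl (c : R) x y : edot (c *: x) y = c * edot x y.
Proof. by rewrite mulr_sumr; apply: eq_bigr => i _; rewrite mxE mulrA. Qed.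

Lemma edotNl x y : edot (- x) y = - edot x y.
Proof. by rewrite -scaleN1r edotZl mulN1r. Qed.

Lemma edotDr x y z : edot x (y + z) = edot x y + edot x z.
Proof. by rewrite edotC edotDl !(edotC x). Qed.

Lemma edotZr (c : R) x y : edot x (c *: y) = c * edot x y.
Proof. by rewrite edotC edotZl edotC. Qed.

Lemma edotNr x y : edot x (- y) = - edot x y.
Proof. by rewrite edotC edotNl edotC. Qed.

Lemma edot_ge0 x : 0 <= edot x x.
Proof. by apply: sumr_ge0 => i _; rewrite -expr2 sqr_ge0. Qed.

Lemma enorm_ge0 x : 0 <= enorm x. Proof. exact: sqrtr_ge0. Qed.

Lemma sqr_enorm x : enorm x ^+ 2 = edot x x.
Proof. by rewrite sqr_sqrtr// edot_ge0. Qed.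

Lemma enormN x : enorm (- x) = enorm x.
Proof. by rewrite /enorm edotNl edotNr opprK. Qed.

Lemma enormZ (c : R) x : enorm (c *: x) = `|c| * enorm x.
Proof.
by rewrite /enorm edotZl edotZr mulrA -expr2 sqrtrM ?sqr_ge0// sqrtr_sqr.
Qed.

Lemma sqr_coord_le_edot x i : x ord0 i ^+ 2 <= edot x x.
Proof.
rewrite /edot (bigD1 i)//= -expr2 lerDl.
by apply: sumr_ge0 => j _; rewrite -expr2 sqr_ge0.
Qed.

Lemma coord_le_enorm x i : `|x ord0 i| <= enorm x.
Proof. by rewrite -sqrtr_sqr ler_wsqrtr// sqr_coord_le_edot. Qed.

Lemma enorm_eq0 x : (enorm x == 0) = (x == 0).
Proof.
apply/idP/idP => [/eqP x0|/eqP ->]; last first.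
  by rewrite -(scale0r 0) enormZ normr0 mul0r.
apply/eqP/rowP => i; rewrite mxE; apply/eqP; rewrite -normr_eq0.
by rewrite eq_le normr_ge0 andbT -x0 coord_le_enorm.
Qed.

Lemma enorm_gt0 x : (0 < enorm x) = (x != 0).
Proof. by rewrite lt_def enorm_ge0 andbT enorm_eq0. Qed.

Lemma sqr_edot_le x y : edot x y ^+ 2 <= edot x x * edot y y.
Proof.
have [->|y0] := eqVneq y 0.
  have -> : (0 : 'rV[R]_n) = 0 *: 0 by rewrite scale0r.
  by rewrite !edotZr !mul0r mulr0 expr0n.
have yy : 0 < edot y y by rewrite -sqr_enorm exprn_gt0// enorm_gt0.
(* The squared length of this vector is [|y|^2] times the defect in the Cauchy-Schwarz
   inequality. *)
have := edot_ge0 (edot y y *: x - edot x y *: y).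
rewrite !(edotDl, edotDr, edotNl, edotNr, edotZl, edotZr) (edotC y x).
set A := edot x x; set B := edot x y; set D := edot y y.
rewrite (_ : _ + _ = D * (A * D - B ^+ 2)); last by ring.
by rewrite pmulr_rge0// subr_ge0.
Qed.

Lemma edot_le x y : `|edot x y| <= enorm x * enorm y.
Proof.
rewrite -(@ler_pXn2r _ 2)// ?nnegrE ?mulr_ge0 ?enorm_ge0//.
by rewrite exprMn !sqr_enorm real_normK ?num_real// sqr_edot_le.
Qed.

Lemma enormD x y : enorm (x + y) <= enorm x + enorm y.
Proof.
rewrite -(@ler_pXn2r _ 2)// ?nnegrE ?addr_ge0 ?enorm_ge0//.
rewrite sqrrD !sqr_enorm !(edotDl, edotDr) (edotC y x).
have := le_trans (ler_norm _) (edot_le x y); lra.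
Qed.

Lemma enorm_le_add x y : enorm x <= enorm (x - y) + enorm y.
Proof. by apply: le_trans (enormD _ _); rewrite subrK. Qed.

Lemma enorm_le_sum x : enorm x <= \sum_i `|x ord0 i|.
Proof.
rewrite -(@ler_pXn2r _ 2)// ?nnegrE ?enorm_ge0 ?sumr_ge0//.
rewrite sqr_enorm expr2 mulr_suml; apply: ler_sum => i _.
rewrite -expr2 -(real_normK (num_real _)) expr2 ler_wpM2l//.
by rewrite (bigD1 i)//= lerDl sumr_ge0.
Qed.

End euclidean_norm.

Lemma lee_prod (R : realDomainType) (I : finType) (f g : I -> \bar R) :
  (forall i, 0 <= f i <= g i)%E -> (\prod_i f i <= \prod_i g i)%E.
Proof.
move=> fg; suff /andP[] : (0 <= \prod_i f i <= \prod_i g i)%E by [].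
elim/big_ind2 : _ => [|a b a' b' /andP[a0 ab] /andP[a0' ab']|i _]//.
- by rewrite lee01 lexx.
- by rewrite mule_ge0//= lee_pmul.
Qed.

Section power_kernel.
Context {R : realType} {n : nat}.

(** Polar coordinates are avoided: the exponent [(n + b)/2] is cut into [n] equal shares
    [q = (1 + b/n)/2], and in the [i]-th share [|x - y|^2] is lowered to the square of its [i]-th
    coordinate. The majorant is then a product of one-variable functions. *)
Lemma integral_enorm_powR_le (b : R) : (0 < n)%N -> 0 < b ->
  exists2 C : R, 0 < C & forall (a : R) (x : 'rV[R]_n), 0 < a ->
  (\int[lebesgue_rV n]_y
     ((enorm (x - y) ^+ 2 + a) `^ (- ((n%:R + b) / 2)))%:E <=
   (C * a `^ (- (b / 2)))%:E)%E.
Proof.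
move=> n0 b0; have nR : 0 < n%:R :> R by rewrite ltr0n.
have [C C0 hC] := integral_sqr_powR_le (divr_gt0 b0 nR).
exists (C ^+ n); first exact: exprn_gt0.
move=> a x a0; set q := (1 + b / n%:R) / 2 in hC.
have q0 : 0 <= q by rewrite divr_ge0// addr_ge0// divr_ge0 ?ltW.
pose p (i : 'I_n) (s : R) := ((x ord0 i - s) ^+ 2 + a) `^ (- q).
have powRX (w e : R) : 0 <= w -> (w `^ e) ^+ n = w `^ (n%:R * e).
  by move=> w0; rewrite -powR_mulrn ?powR_ge0// -powRrM mulrC.
have nq : n%:R * - q = - ((n%:R + b) / 2).
  rewrite /q mulrN; congr (- _); rewrite mulrA mulrDr mulr1; congr ((_ + _) / _).
  by rewrite mulrC divfK// gt_eqF.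
apply: (@le_trans _ _ (\int[lebesgue_rV n]_y (\prod_i p i (y ord0 i))%:E)%E).
  apply: ge0_le_integral_pw => [y _|y _]; first by rewrite lee_fin powR_ge0.
  have w0 : 0 < enorm (x - y) ^+ 2 + a by rewrite ltr_wpDl// sqr_ge0.
  rewrite lee_fin -nq -(powRX _ _ (ltW w0)).
  have prodE (z : R) : z ^+ n = \prod_(i < n) z by rewrite prodr_const card_ord.
  rewrite prodE; apply: ler_prod => i _; rewrite powR_ge0/=; apply: le_powRN => //.
    by rewrite ltr_wpDl// sqr_ge0.
  rewrite lerD2r sqr_enorm; apply: le_trans (sqr_coord_le_edot _ i).
  by rewrite !mxE.
rewrite ge0_integral_tensor.
- apply: (@le_trans _ _ (\prod_(i < n) (C * a `^ (- (b / n%:R / 2)))%:E)%E).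
    apply: lee_prod => i; rewrite hC// andbT; apply: integral_ge0 => s _; rewrite lee_fin; exact: powR_ge0.
  rewrite prodEFin lee_fin prodr_const card_ord exprMn ler_pM2l ?exprn_gt0//.
  rewrite (powRX _ _ (ltW a0)) (_ : n%:R * _ = - (b / 2))//.
  by rewrite mulrN mulrA (mulrC n%:R) divfK// gt_eqF.
- move=> i; apply: measurable_fun_powRl; apply: measurable_funD => //.
  by apply: measurable_funX; exact: measurable_funB.
- by move=> i s; exact: powR_ge0.
Qed.

End power_kernel.

(* [1 + x <= e^x] at [x = k (1 + w) / q - 1], raised to the power [q]. *)
Lemma powR_expRN_le (R : realType) (k q : R) : 0 < k -> 0 < q ->
  exists2 C : R, 0 < C &
    forall w, 0 <= w -> expR (- (k * w)) <= C * (1 + w) `^ (- q).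
Proof.
move=> k0 q0; exists ((q / k) `^ q * expR (k - q)).
  by rewrite mulr_gt0 ?powR_gt0 ?expR_gt0 ?divr_gt0.
move=> w w0; have w1 : 0 < 1 + w by rewrite ltr_pwDl.
have wk : 0 < k * (1 + w) / q by rewrite divr_gt0 ?mulr_gt0.
have h : ((k / q) * (1 + w)) `^ q <= expR (k * (1 + w) - q).
  rewrite [X in expR X](_ : _ = (k * (1 + w) / q - 1) * q); last first.
    by rewrite mulrBl divfK ?gt_eqF// mul1r.
  rewrite expRM mulrAC ge0_ler_powR ?nnegrE ?(ltW q0) ?(ltW wk) ?expR_ge0//.
  by have := expR_ge1Dx (k * (1 + w) / q - 1); rewrite addrC subrK.
rewrite powRN ler_pdivlMr ?powR_gt0//.
have qk0 : 0 < q / k by rewrite divr_gt0.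
have kq0 : 0 < k / q by rewrite divr_gt0.
have -> : (1 + w) `^ q = (q / k) `^ q * ((k / q) * (1 + w)) `^ q.
  rewrite -(powRM _ (ltW qk0) (ltW (mulr_gt0 kq0 w1))).
  by rewrite mulrA mulf_div [k * q]mulrC divff ?mulf_neq0 ?gt_eqF// mul1r.
rewrite mulrCA ler_pM2l ?powR_gt0//.
apply: (@le_trans _ _ (expR (- (k * w)) * expR (k * (1 + w) - q))).
  by rewrite ler_pM2l ?expR_gt0.
by rewrite -expRD ler_expR; lra.
Qed.

Section derivation_of_integrals.
Context {R : realType}.

Lemma is_derive_under_integral d (Y : measurableType d)
    (mu : {measure set Y -> \bar R}) (D : set Y) (f df : R -> Y -> R)
    (G : Y -> R) (a : R) :
  measurable D ->
  (forall x, mu.-integrable D (EFin \o f x)) ->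
  (forall (x : R) y, D y -> is_derive x 1 (f^~ y) (df x y)) ->
  (forall y, 0 <= G y) -> mu.-integrable D (EFin \o G) ->
  (forall x y, D y -> `|df x y| <= G y) ->
  is_derive a 1 (fun x => \int[mu]_(y in D) f x y) (\int[mu]_(y in D) df a y).
Proof.
move=> mD fi fd G0 Gi dfG.
have aI : `]a - 1, a + 1[%classic a.
  by rewrite /= in_itv/= ltrBlDr ltrDl ltr01.
have dfE x y : D y -> partial1of2 f x y = df x y.
  by move=> Dy; rewrite partial1of2E; have [_ ->] := fd x y Dy.
have h1 x y : `]a - 1, a + 1[%classic x -> D y -> derivable (f^~ y) x 1.
  by move=> _ /fd -/(_ x)[].
have h2 x y : `]a - 1, a + 1[%classic x -> D y -> `|partial1of2 f x y| <= G y.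
  by move=> _ Dy; rewrite dfE// dfG.
split; first exact: (derivable_under_integral mD aI (fun x _ => fi x) h1 G0 Gi h2).
rewrite -derive1E.
rewrite (differentiation_under_integral mD aI (fun x _ => fi x) h1 G0 Gi h2).
by apply: eq_Rintegral => y /set_mem; exact: dfE.
Qed.

Notation mu := (@lebesgue_measure R).

(** Over [[-(n+1), n+1]] the integral is a difference of boundary values, at most [2 C / (n + 1)];
    dominated convergence passes to the whole line. It plays the role of integration by parts for
    Gaussian integrals. *)
Lemma integral_is_derive_line (f F : R -> R) (C : R) :
  (forall x : R, is_derive x 1 F (f x)) -> continuous f ->
  mu.-integrable setT (EFin \o f) ->
  (forall x, `|F x| <= C / (1 + x ^+ 2)) ->
  \int[mu]_x f x = 0.
Proof.
move=> dF cf fi FC; have C0 : 0 <= C.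
  by have := le_trans (normr_ge0 _) (FC 0); rewrite expr0n/= addr0 divr1.
pose I n : set R := [set` `[- n.+1%:R, n.+1%:R]].
have mI n : measurable (I n) by exact: measurable_itv.
have mf : measurable_fun setT (EFin \o f) := measurable_int _ fi.
have h1 : (\int[mu]_x (((EFin \o f) \_ (I n)) x) @[n --> \oo] -->
    \int[mu]_x (f x)%:E)%E.
  apply: (@dominated_cvg _ _ _ mu setT measurableT _ _ (abse \o (EFin \o f))) => //.
  - by move=> n; apply/(measurable_restrictT _ (mI n))/measurable_funTS.
  - move=> x _; apply: cvg_near_cst.
    have [m xm] : exists m, `|x| <= m%:R by exists (Num.truncn `|x|).+1; rewrite ltW// truncnS_gt.
    near=> n; rewrite patchE ifT//; apply/mem_set; rewrite /I/= in_itv/= -ler_norml.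
    rewrite (le_trans xm)// ler_nat; apply: leqW; near: n; exact: nbhs_infty_ge.
  - exact: integrable_abse.
  - move=> k x _; rewrite patchE; case: ifPn => // _ /=.
    by rewrite normr0 lee_fin.
have h2 n : (\int[mu]_x (((EFin \o f) \_ (I n)) x) = (F n.+1%:R - F (- n.+1%:R))%:E)%E.
  rewrite -integral_mkcond (integral_is_derive_cc _ (fun x _ => dF x))//.
  - by rewrite gtrN// ltr0n.
  - by move=> x _; exact: cf.
have h3 : F n.+1%:R - F (- n.+1%:R) @[n --> \oo] --> 0.
  apply/norm_cvg0P; apply: (@squeeze_cvgr _ _ _ _ (cst 0) (fun n => 2 * C * n.+1%:R^-1)).
  - apply: nearW => n; rewrite normr_ge0/=.
    apply: (le_trans (ler_normB _ _)); rewrite -mulrA mulr_natl mulr2n.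
    have hn (x : R) : x ^+ 2 = n.+1%:R ^+ 2 -> `|F x| <= C * n.+1%:R^-1.
      move=> xn; apply: (le_trans (FC x)); rewrite ler_wpM2l// lef_pV2 ?posrE.
      + by rewrite xn -natrX addrC natr1 ler_nat -mulnn; apply/leqW/leq_pmulr.
      + by rewrite ltr_pwDl// sqr_ge0.
      + by rewrite ltr0n.
    by rewrite lerD// hn// sqrrN.
  - exact: cvg_cst.
  - by rewrite -(mulr0 (2 * C)); apply: cvgM; [exact: cvg_cst|exact: cvg_harmonic].
have h4 : (\int[mu]_x (f x)%:E = 0%:E)%E.
  apply: (cvg_unique _ h1) => //; rewrite (funext h2).
  by apply: cvg_EFin h3; exact: nearW.
by rewrite /Rintegral h4.
Unshelve. all: by end_near. Qed.

End derivation_of_integrals.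

(** * The kernel as a superposition of heat kernels *)

Section gaussian_fourier_transform.
Context {R : realType}.
Notation mu := (@lebesgue_measure R).
Implicit Types (s x th z : R) (k : nat).

Lemma continuous_gauss s k : continuous (fun z : R => z ^+ k * expR (- (s * z ^+ 2))).
Proof.
move=> z; apply: cvgM; first exact: exprn_continuous.
apply: (@continuous_comp _ _ _ (fun z : R => - (s * z ^+ 2)) expR).
  by apply: cvgN; apply: cvgM; [exact: cvg_cst|exact: exprn_continuous].
exact: continuous_expR.
Qed.

Lemma integrable_gauss s k : 0 < s ->
  mu.-integrable setT (fun z => (z ^+ k * expR (- (s * z ^+ 2)))%:E).
Proof.
move=> s0.
(* Decay of order [k + 1] in [1 + z^2] absorbs [|z|^k <= (1 + z^2)^k] and leaves [1/(1 + z^2)],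
   which is the one-variable power kernel with [g = 1]. *)
have [C C0 hC] := powR_expRN_le s0 (ltr0Sn R k).
have [B B0 hB] := @integral_sqr_powR_le R 1 ltr01.
have h1 : (1 + 1) / 2 = 1 :> R by rewrite divff.
apply: (@le_integrable _ _ _ mu setT measurableT _
    (fun z => (C * ((0 - z) ^+ 2 + 1) `^ (- ((1 + 1) / 2)))%:E)).
- apply/measurable_EFinP; apply: continuous_measurable_fun.
  exact: continuous_gauss.
- move=> z _; rewrite lee_fin sub0r sqrrN h1.
  have z1 : 1 <= 1 + z ^+ 2 by rewrite lerDl sqr_ge0.
  have z0 := lt_le_trans ltr01 z1.
  rewrite [leRHS]ger0_norm ?mulr_ge0 ?powR_ge0 ?(ltW C0)//.
  rewrite normrM normrX (ger0_norm (expR_ge0 _)).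
  apply: (@le_trans _ _ ((1 + z ^+ 2) ^+ k * (C * (1 + z ^+ 2) `^ (- k.+1%:R)))).
    apply: ler_pM; rewrite ?exprn_ge0 ?expR_ge0// ?hC ?sqr_ge0//.
    apply: lerXn2r; rewrite ?nnegrE ?normr_ge0 ?(ltW z0)//.
    by rewrite -(real_normK (num_real z)); have := sqr_ge0 (`|z| - 1); nra.
  rewrite mulrCA ler_pM2l// powR_invn ?(ltW z0)// (addrC (z ^+ 2)) powR_inv1 ?(ltW z0)//.
  by rewrite (exprSr (1 + z ^+ 2)) invfM mulrA divff ?mul1r// expf_neq0// gt_eqF.
- apply/integrableP; split.
    apply/measurable_EFinP/measurable_funM => //.
    apply: measurable_fun_powRl; apply: measurable_funD => //.
    by apply: measurable_funX; exact: measurable_funB.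
  under eq_integral do rewrite gee0_abs ?lee_fin ?mulr_ge0 ?powR_ge0 ?(ltW C0)// EFinM.
  rewrite ge0_integralZl//; first last.
  + by rewrite lee_fin ltW.
  + by move=> z _; rewrite lee_fin powR_ge0.
  + apply/measurable_EFinP/measurable_fun_powRl; apply: measurable_funD => //.
    by apply: measurable_funX; exact: measurable_funB.
  apply: (@le_lt_trans _ _ (C%:E * (B * 1 `^ (- (1 / 2)))%:E)%E); last first.
    by rewrite -EFinM ltry.
  by rewrite lee_pmul2l ?hB.
Qed.

(** The free phase [th] closes the family under differentiation in [x]: a derivative raises [k] by
    one and adds [pi/2] to the phase, so sine transforms need no separate treatment. *)
Definition gauss_cos s k th x : R :=
  \int[mu]_z (cos (x * z + th) * (z ^+ k * expR (- (s * z ^+ 2)))).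

Lemma continuous_cos_affine x th : continuous (fun z : R => cos (x * z + th)).
Proof.
move=> z; apply: (@continuous_comp _ _ _ (fun z : R => x * z + th) cos).
  by apply: cvgD; [apply: cvgM; [exact: cvg_cst|]|exact: cvg_cst].
exact: continuous_cos.
Qed.

Lemma integrable_gauss_cos s k th x : 0 < s ->
  mu.-integrable setT
    (fun z => (cos (x * z + th) * (z ^+ k * expR (- (s * z ^+ 2))))%:E).
Proof.
move=> s0; apply: (le_integrable measurableT _ _ (integrable_gauss k s0)).
- apply/measurable_EFinP; apply: continuous_measurable_fun => z.
  by apply: cvgM; [exact: continuous_cos_affine|exact: continuous_gauss].
- by move=> z _; rewrite lee_fin normrM ler_piMl// cos_max.
Qed.

Lemma is_derive_gauss_cos s k th x : 0 < s ->
  is_derive x 1 (gauss_cos s k th) (gauss_cos s k.+1 (th + pi / 2) x).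
Proof.
move=> s0.
apply: (@is_derive_under_integral R _ _ mu setT
  (fun x z => cos (x * z + th) * (z ^+ k * expR (- (s * z ^+ 2))))
  (fun x z => cos (x * z + (th + pi / 2)) * (z ^+ k.+1 * expR (- (s * z ^+ 2))))
  (fun z => `|z ^+ k.+1 * expR (- (s * z ^+ 2))|)) => //.
- by move=> y; exact: integrable_gauss_cos.
- move=> y z _.
  have h1 : is_derive y 1 (fun y : R => y * z + th) z.
    have := is_deriveD (is_deriveM (is_derive_id y 1) (is_derive_cst z y 1))
      (is_derive_cst th y 1).
    by rewrite scaler0 add0r addr0 /GRing.scale/= mulr1.
  have h2 := @is_derive1_comp _ cos (fun y : R => y * z + th) y _ _
    (is_derive_cos _) h1.
  have := is_deriveM h2 (is_derive_cst (z ^+ k * expR (- (s * z ^+ 2))) y 1).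
  rewrite scaler0 add0r.
  rewrite (_ : _ *: _ = cos (y * z + (th + pi / 2)) * (z ^+ k.+1 * expR (- (s * z ^+ 2))))//.
  by rewrite /GRing.scale/= addrA cosDpihalf (exprS z k); ring.
- exact: (integrable_norm (integrable_gauss k.+1 s0)).
- by move=> y z _; rewrite normrM ler_piMl// cos_max.
Qed.

(** The derivative of [sin (x z + th) e^{-s z^2}] in [z] has integral zero, and [- sin] is the
    cosine shifted by [pi/2]. Since the left side is the derivative of [gauss_cos s 0 th], this is
    the differential equation [g' = -(x / 2s) g] that characterises a Gaussian. *)
Lemma gauss_cos_ode s th x : 0 < s ->
  gauss_cos s 1 (th + pi / 2) x = - (x / (2 * s)) * gauss_cos s 0 th x.
Proof.
move=> s0.
have [C C0 hC] := powR_expRN_le s0 ltr01.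
pose F z := sin (x * z + th) * expR (- (s * z ^+ 2)).
pose f z := x * (cos (x * z + th) * (z ^+ 0 * expR (- (s * z ^+ 2)))) +
  2 * s * (cos (x * z + (th + pi / 2)) * (z ^+ 1 * expR (- (s * z ^+ 2)))).
have i0 := integrable_gauss_cos 0 th x s0.
have i1 := integrable_gauss_cos 1 (th + pi / 2) x s0.
have i0' := integrableZl measurableT x i0.
have i1' := integrableZl measurableT (2 * s) i1.
have : \int[mu]_z f z = 0.
  apply: (@integral_is_derive_line _ _ F C).
  - move=> z.
    have h1 : is_derive z 1 (fun z : R => x * z + th) x.
      have := is_deriveD (is_deriveM (is_derive_cst x z 1) (is_derive_id z 1))
        (is_derive_cst th z 1).
      by rewrite scaler0 !addr0 /GRing.scale/= mulr1.
    have h2 := @is_derive1_comp _ sin (fun z : R => x * z + th) z _ _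
      (is_derive_sin _) h1.
    have h3 : is_derive z 1 (fun z : R => - (s * z ^+ 2)) (- (2 * s * z)).
      have := is_deriveN (is_deriveM (is_derive_cst s z 1)
         (is_deriveX 2 (is_derive_id z 1))).
      rewrite (_ : - (_ + _) = - (2 * s * z))//.
      by rewrite /GRing.scale/=; ring.
    have h4 := @is_derive1_comp _ expR (fun z : R => - (s * z ^+ 2)) z _ _
      (is_derive_expR _) h3.
    have := is_deriveM h2 h4.
    rewrite (_ : _ *: _ + _ *: _ = f z)//.
    by rewrite /f /GRing.scale/= addrA cosDpihalf expr0 expr1; ring.
  - move=> z; apply: cvgD; (apply: cvgM; first exact: cvg_cst);
      by apply: cvgM; [exact: continuous_cos_affine|exact: continuous_gauss].
  - exact: (integrableD measurableT i0' i1').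
  - move=> z; rewrite normrM (ger0_norm (expR_ge0 _)).
    apply: (@le_trans _ _ (1 * (C * (1 + z ^+ 2) `^ (-1)))).
      by apply: ler_pM; rewrite ?normr_ge0 ?expR_ge0 ?sin_max// hC// sqr_ge0.
    by rewrite mul1r powR_inv1// addr_ge0// sqr_ge0.
rewrite (RintegralD measurableT i0' i1').
rewrite !RintegralZl// -!/(gauss_cos _ _ _ _) => h.
apply: (@mulfI _ (2 * s)); first by rewrite mulf_neq0// gt_eqF.
rewrite mulNr mulrN mulrA mulrCA divff ?mulr1 ?mulf_neq0 ?gt_eqF//.
by apply/eqP; rewrite -addr_eq0 addrC h.
Qed.

Lemma integral_gauss s : 0 < s ->
  (\int[mu]_z (expR (- (s * z ^+ 2)))%:E = (Num.sqrt (pi / s))%:E)%E.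
Proof.
move=> s0; pose r := Num.sqrt s; have r0 : 0 < r by rewrite sqrtr_gt0.
have sr : s = r ^+ 2 by rewrite sqr_sqrtr// ltW.
have dF (x : R) : is_derive x 1 (fun x : R => r * x) r.
  have := is_deriveZ r (is_derive_id x (1 : R)).
  by rewrite /GRing.scale/= mulr1.
have F' : ((fun x : R => r * x)^`() = cst r)%classic.
  by apply/funext => x; rewrite derive1E; have [_ ->] := dF x.
have h : (\int[mu]_x (gauss_fun x)%:E =
    \int[mu]_x (expR (- (s * x ^+ 2)) * r)%:E)%E.
  rewrite (@increasing_ge0_integration_by_substitutionT _ (fun x => r * x)).
  - apply: eq_integral => x _; rewrite F'.
    by have -> : s * x ^+ 2 = (r * x) ^+ 2 by rewrite exprMn -sr.
  - by move=> x y xy; rewrite ltr_pM2l.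
  - by rewrite F'; exact: cst_continuous.
  - by rewrite F'; exact: is_cvg_cst.
  - by rewrite F'; exact: is_cvg_cst.
  - by [].
  - apply/cvgrNyPle => A; near=> z; rewrite mulrC -ler_pdivlMr//.
  - apply/cvgryPge => A; near=> z; rewrite mulrC -ler_pdivrMr//.
  - exact: continuous_gauss_fun.
  - exact: gauss_fun_ge0.
have mg : measurable_fun setT (fun z : R => (expR (- (s * z ^+ 2)))%:E).
  have := measurable_int _ (integrable_gauss 0 s0).
  by under eq_fun do rewrite expr0 mul1r.
move: h; rewrite integralT_gauss.
under eq_integral do rewrite EFinM.
rewrite ge0_integralZr; [|by []|exact: mg|by move=> z _; rewrite lee_fin expR_ge0
  |by rewrite lee_fin ltW].
rewrite sqrtrM ?pi_ge0// sqrtrV ?(ltW s0)// -/r.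
case: (integral _ _ _) => [v|/=|/=].
- by rewrite -EFinM => -[->]; rewrite mulfK// gt_eqF.
- by rewrite gt0_mulye ?lte_fin.
- by rewrite gt0_mulNye ?lte_fin.
Unshelve. all: by end_near. Qed.

Lemma gauss_cos0 s th : 0 < s ->
  gauss_cos s 0 th 0 = Num.sqrt (pi / s) * cos th.
Proof.
move=> s0; rewrite /gauss_cos.
under eq_Rintegral do rewrite mul0r add0r expr0 mul1r.
rewrite RintegralZl//; last first.
  by have := integrable_gauss 0 s0; under eq_fun do rewrite expr0 mul1r.
by rewrite mulrC /Rintegral integral_gauss.
Qed.

Lemma gauss_cosE0 s th x : 0 < s ->
  gauss_cos s 0 th x =
  Num.sqrt (pi / s) * expR (- (x ^+ 2 / (4 * s))) * cos th.
Proof.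
move=> s0.
(* Integrating factor of the equation: the product with [E] has zero derivative, hence keeps its
   value at 0. *)
pose E x := expR (x ^+ 2 / (4 * s)).
have dE (y : R) : is_derive y 1 E (y / (2 * s) * E y).
  have h3 : is_derive y 1 (fun z : R => z ^+ 2 / (4 * s)) (y / (2 * s)).
    have := is_deriveM (is_deriveX 2 (is_derive_id y 1)) (is_derive_cst (4 * s)^-1 y 1).
    rewrite (_ : _ + _ = y / (2 * s))//.
    by rewrite /GRing.scale/=; field; rewrite gt_eqF.
  have := @is_derive1_comp _ expR (fun z : R => z ^+ 2 / (4 * s)) y _ _
    (is_derive_expR _) h3.
  by rewrite [expR _ * _]mulrC; exact.
have cst (y : R) : is_derive y 1 (gauss_cos s 0 th * E) 0.
  have := is_deriveM (is_derive_gauss_cos 0 th y s0) (dE y).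
  rewrite (_ : _ *: _ + _ *: _ = 0)//.
  by rewrite gauss_cos_ode// /GRing.scale/=; ring.
have h : gauss_cos s 0 th x * E x = gauss_cos s 0 th 0 * E 0.
  exact: (is_derive_0_is_cst x 0 cst).
have E0 : E 0 = 1 by rewrite /E expr0n/= mul0r expR0.
rewrite E0 mulr1 gauss_cos0// in h.
by rewrite mulrAC -h -mulrA expRxMexpNx_1 mulr1.
Qed.

Lemma gauss_cosE1 s th x : 0 < s ->
  gauss_cos s 1 th x = x / (2 * s) *
  (Num.sqrt (pi / s) * expR (- (x ^+ 2 / (4 * s)))) * cos (th + pi / 2).
Proof.
move=> s0; rewrite -{1}(subrK (pi / 2) th) gauss_cos_ode// gauss_cosE0//.
by rewrite cosBpihalf cosDpihalf; ring.
Qed.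

(** The second moment is the [x]-derivative of the explicit first moment, taken with the phase moved
    back by [pi/2]. *)
Lemma gauss_cosE2 s th x : 0 < s ->
  gauss_cos s 2 th x = (1 / (2 * s) - x ^+ 2 / (4 * s ^+ 2)) *
  (Num.sqrt (pi / s) * expR (- (x ^+ 2 / (4 * s)))) * cos th.
Proof.
move=> s0; rewrite -{1}(subrK (pi / 2) th).
have [_ <-] := is_derive_gauss_cos 1 (th - pi / 2) x s0.
pose g (y : R) := y / (2 * s) * (Num.sqrt (pi / s) * expR (- (y ^+ 2 / (4 * s)))) * cos th.
have -> : gauss_cos s 1 (th - pi / 2) = g.
  by apply/funext => y; rewrite gauss_cosE1// subrK.
have h3 : is_derive x 1 (fun z : R => - (z ^+ 2 / (4 * s))) (- (x / (2 * s))).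
  have := is_deriveN (is_deriveM (is_deriveX 2 (is_derive_id x 1)) (is_derive_cst (4 * s)^-1 x 1)).
  rewrite (_ : - (_ + _) = - (x / (2 * s)))//.
  by rewrite /GRing.scale/=; field; rewrite gt_eqF.
have h4 := @is_derive1_comp _ expR (fun z : R => - (z ^+ 2 / (4 * s))) x _ _
  (is_derive_expR _) h3.
have h5 := is_deriveM (is_derive_cst (Num.sqrt (pi / s)) x 1) h4.
have h6 := is_deriveM (is_deriveM (is_derive_id x 1) (is_derive_cst (2 * s)^-1 x 1)) h5.
have h7 := is_deriveM h6 (is_derive_cst (cos th) x 1).
have [_ ->] : is_derive x 1 g _ := h7.
by rewrite /GRing.scale/= ?fctE/=; field; rewrite gt_eqF.
Qed.

End gaussian_fourier_transform.

(** * Cosine transforms of products and Gaussian moments in [n] variables *)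

Section fourier_tensor.
Context {R : realType}.
Notation mu := (@lebesgue_measure R).

Lemma measurable_tensor n (p : 'I_n -> R -> R) :
  (forall i, measurable_fun setT (p i)) ->
  measurable_fun setT (fun x : 'rV[R]_n => \prod_i p i (x ord0 i)).
Proof.
move=> mp; apply: measurable_prod => i _.
exact: (measurableT_comp (mp i) (measurable_rV_coord i)).
Qed.

Lemma integrable_tensor n (p : 'I_n -> R -> R) :
  (forall i, mu.-integrable setT (EFin \o p i)) ->
  (lebesgue_rV n).-integrable setT
    (fun x : 'rV[R]_n => (\prod_i p i (x ord0 i))%:E).
Proof.
move=> ip.
have mp i : measurable_fun setT (p i) by apply/measurable_EFinP; exact: measurable_int (ip i).
apply/integrableP; split; first by apply/measurable_EFinP; exact: measurable_tensor.
under eq_integral do rewrite /= normr_prod.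
rewrite (@ge0_integral_tensor _ n (fun i s => `|p i s|)); last 2 first.
- by move=> i; exact: measurableT_comp.
- by move=> i s; exact: normr_ge0.
have fi i : (\int[mu]_s (`|p i s|)%:E)%E \is a fin_num.
  by have /integrableP[_] := ip i; rewrite ge0_fin_numE//; apply: integral_ge0 => s _.
have := @prode_fin_num _ _ (index_enum 'I_n) xpredT _ (fun i _ => fi i).
by rewrite fin_numElt => /andP[].
Qed.

Lemma measurable_fun_cos_sum n (x : 'I_n -> R) (th : R) :
  measurable_fun setT
    (fun xi : 'rV[R]_n => cos (\sum_i x i * xi ord0 i + th)).
Proof.
apply: (measurableT_comp (f := @cos R)).
  by apply: continuous_measurable_fun; exact: continuous_cos.
apply: measurable_funD => //; apply: measurable_sum => i.
by apply: measurable_funM => //; exact: measurable_rV_coord.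
Qed.

Lemma integrable_cos_tensor n (p : 'I_n -> R -> R) (x : 'I_n -> R) (th : R) :
  (forall i, mu.-integrable setT (EFin \o p i)) ->
  (lebesgue_rV n).-integrable setT (fun xi : 'rV[R]_n =>
     (cos (\sum_i x i * xi ord0 i + th) * \prod_i p i (xi ord0 i))%:E).
Proof.
move=> ip; have ipp := integrable_tensor ip.
apply: (le_integrable measurableT _ _ ipp).
  apply/measurable_EFinP/measurable_funM; first exact: measurable_fun_cos_sum.
  by apply/measurable_EFinP; exact: measurable_int ipp.
by move=> xi _; rewrite lee_fin normrM ler_piMl// cos_max.
Qed.

(* A phase shift [phi i] per coordinate avoids complex exponentials: it is 0
   for even weights and pi/2 for odd ones. *)
Lemma integral_cos_tensor n (p : 'I_n -> R -> R) (x A phi : 'I_n -> R) :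
  (forall i, mu.-integrable setT (EFin \o p i)) ->
  (forall i th, \int[mu]_z (cos (x i * z + th) * p i z) = A i * cos (th + phi i)) ->
  forall th, \int[lebesgue_rV n]_xi
    (cos (\sum_i x i * xi ord0 i + th) * \prod_i p i (xi ord0 i)) =
    (\prod_i A i) * cos (th + \sum_i phi i).
Proof.
elim: n p x A phi => [|n ih] p x A phi ip hA th.
  rewrite /Rintegral; under eq_integral do rewrite !big_ord0 add0r mulr1.
  by rewrite integral_cst//= indicT mulr1 !big_ord0 mul1r addr0.
pose sh T (r : 'I_n.+1 -> T) (i : 'I_n) := r (lift ord0 i).
have ip' i : mu.-integrable setT (EFin \o sh _ p i) by exact: ip.
rewrite /Rintegral integral_rVS; last exact: integrable_cos_tensor.
transitivity (\int[mu]_s (\prod_i sh _ A i *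
    (cos (x ord0 * s + (th + \sum_i sh _ phi i)) * p ord0 s))); last first.
  rewrite RintegralZl//; last first.
    apply: (le_integrable measurableT _ _ (ip ord0)).
      apply/measurable_EFinP/measurable_funM.
        apply: continuous_measurable_fun; exact: continuous_cos_affine.
      by apply/measurable_EFinP; exact: measurable_int (ip ord0).
    by move=> z _; rewrite lee_fin normrM ler_piMl// cos_max.
  rewrite hA !big_ord_recl mulrA [_ * A ord0]mulrC; congr (_ * cos _).
  by rewrite -addrA; congr (_ + _); rewrite addrC.
congr fine; apply: eq_integral => s _.
(* With the first coordinate frozen at [s], the term [x ord0 * s] joins the phase of the remaining
   integral; this is why the induction hypothesis has to hold for every phase. *)
have -> : (\int[lebesgue_rV n]_v
    (cos (\sum_i x i * (rV_cons (s, v)) ord0 i + th) *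
     \prod_i p i ((rV_cons (s, v)) ord0 i))%:E =
   \int[lebesgue_rV n]_v ((p ord0 s)%:E *
     (cos (\sum_i sh _ x i * v ord0 i + (x ord0 * s + th)) *
      \prod_i sh _ p i (v ord0 i))%:E))%E.
  apply: eq_integral => v _; rewrite !big_ord_recl /= -EFinM; congr EFin.
  rewrite !mxE unlift_none mulrCA; congr (_ * (cos _ * _)).
    rewrite [RHS]addrCA -addrA; congr (_ + (_ + _)).
    by apply: eq_bigr => i _; rewrite mxE liftK.
  by apply: eq_bigr => i _; rewrite mxE liftK.
have ici := integrable_cos_tensor (sh _ x) (x ord0 * s + th) ip'.
rewrite integralZl//.
rewrite -(fineK (integrable_fin_num measurableT ici)) -EFinM.
rewrite -/(Rintegral _ _ _) (ih _ _ (sh _ A) (sh _ phi))//; last by move=> i; exact: hA.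
by rewrite mulrCA [p _ _ * _]mulrC addrA.
Qed.

End fourier_tensor.

Section gaussian_moments.
Context {R : realType} {n : nat}.
Notation mu := (@lebesgue_measure R).
Implicit Types (s : R) (x xi : 'rV[R]_n) (m : 'I_n -> nat).

Lemma prod_gauss_weights s m xi :
  \prod_i (xi ord0 i ^+ m i * expR (- (s * xi ord0 i ^+ 2))) =
  (\prod_i xi ord0 i ^+ m i) * expR (- (s * enorm xi ^+ 2)).
Proof.
rewrite big_split/=; congr (_ * _).
by rewrite -expR_sum sqr_enorm mulr_sumr -sumrN; congr expR.
Qed.

Lemma integrable_gauss_weights s m : 0 < s ->
  (lebesgue_rV n).-integrable setT (fun xi =>
    ((\prod_i xi ord0 i ^+ m i) * expR (- (s * enorm xi ^+ 2)))%:E).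
Proof.
move=> s0.
have := @integrable_tensor _ n (fun i z => z ^+ m i * expR (- (s * z ^+ 2)))
  (fun i => integrable_gauss (m i) s0).
by under eq_fun do rewrite prod_gauss_weights.
Qed.

Lemma integral_cos_gauss_weights s m x : 0 < s -> (forall i, m i <= 2)%N ->
  \int[lebesgue_rV n]_xi (cos (edot x xi) *
    ((\prod_i xi ord0 i ^+ m i) * expR (- (s * enorm xi ^+ 2)))) =
  (\prod_i (if m i == 0%N then 1 else if m i == 1%N then x ord0 i / (2 * s)
     else 1 / (2 * s) - x ord0 i ^+ 2 / (4 * s ^+ 2))) *
  (Num.sqrt (pi / s) ^+ n * expR (- (enorm x ^+ 2 / (4 * s)))) *
  cos (\sum_i if m i == 1%N then pi / 2 else 0).
Proof.
move=> s0 m2.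
pose a i := if m i == 0%N then 1 else if m i == 1%N then x ord0 i / (2 * s)
     else 1 / (2 * s) - x ord0 i ^+ 2 / (4 * s ^+ 2).
pose g i := Num.sqrt (pi / s) * expR (- (x ord0 i ^+ 2 / (4 * s))).
have h := @integral_cos_tensor R n (fun i z => z ^+ m i * expR (- (s * z ^+ 2)))
  (fun i => x ord0 i) (fun i => a i * g i) (fun i => if m i == 1%N then pi / 2 else 0)
  (fun i => integrable_gauss (m i) s0) _ 0.
transitivity (\int[lebesgue_rV n]_xi
  (cos (\sum_i x ord0 i * xi ord0 i + 0) *
   \prod_i (xi ord0 i ^+ m i * expR (- (s * xi ord0 i ^+ 2))))).
  by apply: eq_Rintegral => xi _; rewrite addr0 prod_gauss_weights.
rewrite h ?add0r.
  congr (_ * _); rewrite big_split/=; congr (_ * _).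
  rewrite /g big_split/= prodr_const card_ord -expR_sum; congr (_ * expR _).
  by rewrite sqr_enorm mulr_suml -sumrN; apply: eq_bigr => i _; rewrite expr2.
move=> i th; rewrite -/(gauss_cos s (m i) th (x ord0 i)) /a /g.
case: (m i) (m2 i) => [|[|[|//]]] _ /=.
- by rewrite gauss_cosE0// mul1r addr0.
- by rewrite gauss_cosE1.
- by rewrite gauss_cosE2// addr0.
Qed.

Lemma integral_cos_gauss s x : 0 < s ->
  \int[lebesgue_rV n]_xi (cos (edot x xi) * expR (- (s * enorm xi ^+ 2))) =
  Num.sqrt (pi / s) ^+ n * expR (- (enorm x ^+ 2 / (4 * s))).
Proof.
move=> s0; have := @integral_cos_gauss_weights s (fun=> 0%N) x s0 (fun=> isT).
rewrite !big1//= cos0 mulr1 mul1r => <-.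
by apply: eq_Rintegral => xi _; rewrite mul1r.
Qed.

(** Exponent of the [i]-th coordinate in the monomial [xi_j xi_k]; the sum treats [j = k], where the
    exponent is 2, together with [j != k]. *)
Definition pair_weight (j k i : 'I_n) : nat := (i == j) + (i == k).

Lemma prod_pair_weight (j k : 'I_n) xi :
  \prod_i xi ord0 i ^+ pair_weight j k i = xi ord0 j * xi ord0 k.
Proof.
rewrite /pair_weight; under eq_bigr do rewrite exprD.
rewrite big_split/= (bigD1 j)//= eqxx expr1 big1 ?mulr1; last first.
  by move=> i /negbTE ->; rewrite expr0.
rewrite (bigD1 k)//= eqxx expr1 big1 ?mulr1// => i /negbTE ->.
by rewrite expr0.
Qed.

Lemma integral_cos_gauss2 s x (j k : 'I_n) : 0 < s ->
  \int[lebesgue_rV n]_xi (cos (edot x xi) *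
     (xi ord0 j * xi ord0 k * expR (- (s * enorm xi ^+ 2)))) =
  ((j == k)%:R / (2 * s) - x ord0 j * x ord0 k / (4 * s ^+ 2)) *
  (Num.sqrt (pi / s) ^+ n * expR (- (enorm x ^+ 2 / (4 * s)))).
Proof.
move=> s0; have := @integral_cos_gauss_weights s (pair_weight j k) x s0.
under eq_Rintegral do rewrite prod_pair_weight.
move=> ->; last by move=> i; rewrite /pair_weight; do 2!case: (_ == _).
rewrite mulrAC; congr (_ * _).
have [<-|jk] := eqVneq j k.
  rewrite (bigD1 j)//= /pair_weight eqxx/= big1 ?mulr1; last first.
    by move=> i /negbTE ->.
  rewrite big1; last by move=> i _; case: (i == j).
  by rewrite cos0 mulr1 expr2.
(* For [j != k] there are two odd coordinates; their phases add up to [pi], and [cos pi = -1] is the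
   minus sign in front of [x_j x_k]. *)
rewrite (bigD1 j)//= (bigD1 k)/=; last by rewrite eq_sym.
rewrite [X in _ * cos X](bigD1 j)//= [X in _ * cos (_ + X)](bigD1 k)/=; last by rewrite eq_sym.
rewrite /pair_weight !eqxx (eq_sym k j) (negbTE jk)/=.
have h i : (i != j) && (i != k) -> ((i == j) + (i == k))%N = 0%N.
  by move=> /andP[/negbTE -> /negbTE ->].
rewrite big1; last by move=> i /h ->.
rewrite big1; last by move=> i /h ->.
rewrite addr0 -splitr cospi mulr1 mul0r sub0r.
by field; rewrite gt_eqF.
Qed.

End gaussian_moments.

(** * Closed formula for the kernel *)

Section kernel_formula.
Context {R : realType} {n : nat}.
Notation mu := (@lebesgue_measure R).
Implicit Types (s t : R) (x xi : 'rV[R]_n) (j k : 'I_n).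

Lemma integral_expRN_cy (a t : R) : 0 < a ->
  (\int[mu]_(s in `[t, +oo[) (expR (- (s * a)))%:E = (expR (- (t * a)) / a)%:E)%E.
Proof.
move=> a0.
have dE (s : R) : is_derive s 1 (fun s => expR (- (s * a))) (- a * expR (- (s * a))).
  have h1 : is_derive s 1 (fun s : R => - (s * a)) (- a).
    have := is_deriveN (is_deriveM (is_derive_id s 1) (is_derive_cst a s 1)).
    by rewrite scaler0 add0r /GRing.scale/= mulr1.
  have := @is_derive1_comp _ expR (fun s : R => - (s * a)) s _ _ (is_derive_expR _) h1.
  by rewrite [expR _ * _]mulrC; exact.
have dF (s : R) : t <= s ->
    is_derive s 1 (fun s => - a^-1 * expR (- (s * a))) (expR (- (s * a))).
  move=> _; have := is_deriveZ (- a^-1) (dE s).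
  by rewrite /GRing.scale/= mulrA mulrNN mulVf ?gt_eqF// mul1r; exact.
rewrite (integral_is_derive_cy _ dF _ (l := 0)).
- by rewrite sub0r mulNr opprK mulrC.
- by move=> s _; exact: expR_ge0.
- by move=> s _; exact: is_derive_continuous (dE s).
- rewrite -(mulr0 (- a^-1)); apply: cvgM; first exact: cvg_cst.
  apply: (cvg_comp (fun s => s * a) (fun y => expR (- y)) _ (@cvgr_expR R)).
  apply/cvgryPge => A; near=> s; by rewrite -ler_pdivrMr//.
Unshelve. all: by end_near. Qed.

Lemma coord_mul_le_enorm x j k : `|x ord0 j * x ord0 k| <= enorm x ^+ 2.
Proof. by rewrite normrM expr2 ler_pM ?normr_ge0// coord_le_enorm. Qed.

Let F x j k (z : 'rV[R]_n * R) : R :=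
  cos (edot x z.1) * (z.1 ord0 j * z.1 ord0 k * expR (- (z.2 * enorm z.1 ^+ 2))).

Let mF x j k : measurable_fun setT (F x j k).
Proof.
apply: measurable_funM.
  apply: (measurableT_comp (f := @cos R)).
    by apply: continuous_measurable_fun; exact: continuous_cos.
  by apply: measurable_fun_edot.
apply: measurable_funM.
  by apply: measurable_funM; exact: measurable_fun_rV_coord.
apply: (measurableT_comp (f := @expR R)).
  by apply: continuous_measurable_fun; exact: continuous_expR.
apply: measurableT_comp => //; apply: measurable_funM => //.
by apply: measurable_funX; exact: measurable_fun_enorm.
Qed.

Let I t : set R := [set` `[t, +oo[].

Let F1 x j k t z : R := F x j k z * \1_(I t) z.2.

Let mF1 x j k t : measurable_fun setT (F1 x j k t).
Proof.
apply: measurable_funM => //.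
have mI : measurable_fun setT (\1_(I t) : R -> R).
  by apply: measurable_indic; exact: measurable_itv.
exact: (measurableT_comp mI measurable_snd).
Qed.

(** One computation serves both uses in Fubini's theorem: [h] the absolute value gives absolute
    convergence, [h] the identity gives the value. At [xi = 0] both sides vanish because of the
    factor [xi_j xi_k]. *)
Let integral_s x j k t xi (h : R -> R) : 0 < t ->
  h = id \/ h = Num.norm ->
  (\int[mu]_s (h (F1 x j k t (xi, s)))%:E =
   (h (cos (edot x xi) * (xi ord0 j * xi ord0 k *
     (expR (- (t * enorm xi ^+ 2)) / enorm xi ^+ 2))))%:E)%E.
Proof.
move=> t0 hh; have hM a b : 0 <= b -> h (a * b) = h a * b.
  by case: hh => -> // b0; rewrite normrM (ger0_norm b0).
have h0 : h 0 = 0 by case: hh => -> //; rewrite normr0.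
pose c := cos (edot x xi) * (xi ord0 j * xi ord0 k).
have -> : (\int[mu]_s (h (F1 x j k t (xi, s)))%:E =
    \int[mu]_(s in I t) ((h c)%:E * (expR (- (s * enorm xi ^+ 2)))%:E))%E.
  rewrite [RHS]integral_mkcond; apply: eq_integral => s _.
  rewrite patchE /F1 /F/= indicE; case: ifPn => sI.
    by rewrite mulr1 mulrA hM ?expR_ge0// EFinM.
  by rewrite mulr0 h0.
have [xi0|xi0] := eqVneq xi 0.
  have c0 : c = 0 by rewrite /c xi0 !mxE mul0r mulr0.
  rewrite c0 h0; under eq_integral do rewrite mul0e.
  by rewrite integral0 xi0 !mxE !mul0r mulr0 h0.
have e0 : 0 < enorm xi ^+ 2 by rewrite exprn_gt0// enorm_gt0.
have iE := integral_expRN_cy t e0.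
have integ : mu.-integrable (I t) (fun s => (expR (- (s * enorm xi ^+ 2)))%:E).
  apply/integrableP; split.
    apply/measurable_EFinP/measurable_funTS; apply: continuous_measurable_fun => s.
    apply: (@continuous_comp _ _ _ (fun s : R => - (s * _)) expR).
      by apply: cvgN; apply: cvgM => //; exact: cvg_cst.
    exact: continuous_expR.
  under eq_integral do rewrite gee0_abs ?lee_fin ?expR_ge0//.
  by rewrite iE ltry.
rewrite integralZl//; last exact: measurable_itv.
rewrite iE -EFinM -hM; last by rewrite divr_ge0 ?expR_ge0 ?sqr_ge0.
by congr EFin; congr h; rewrite /c !mulrA.
Qed.

(** Fubini for [F1]: its time integral restores the division by [|xi|^2], its frequency integral is
    a Gaussian second moment. Absolute convergence holds because [|xi_j xi_k| <= |xi|^2] cancels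
    that division and leaves [e^{-t|xi|^2}]. *)
Lemma integral_cos_riesz x j k t : 0 < t ->
  let r xi := cos (edot x xi) * (xi ord0 j * xi ord0 k *
     (expR (- (t * enorm xi ^+ 2)) / enorm xi ^+ 2)) in
  let g s := ((j == k)%:R / (2 * s) - x ord0 j * x ord0 k / (4 * s ^+ 2)) *
     (Num.sqrt (pi / s) ^+ n * expR (- (enorm x ^+ 2 / (4 * s)))) in
  [/\ (lebesgue_rV n).-integrable setT (EFin \o r),
      mu.-integrable `[t, +oo[ (EFin \o g) &
      \int[lebesgue_rV n]_xi r xi = \int[mu]_(s in `[t, +oo[) g s].
Proof.
move=> t0 r g.
have ig : (lebesgue_rV n).-integrable setT
    (fun xi => (expR (- (t * enorm xi ^+ 2)))%:E).
  have := @integrable_gauss_weights R n t (fun=> 0%N) t0.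
  by under eq_fun do rewrite big1 ?mul1r//.
have iF1 : (lebesgue_rV n \x mu)%E.-integrable setT (EFin \o F1 x j k t).
  apply/integrable12ltyP; first by apply/measurable_EFinP; exact: mF1.
  rewrite (eq_integral (fun xi => (`|cos (edot x xi) * (xi ord0 j * xi ord0 k *
     (expR (- (t * enorm xi ^+ 2)) / enorm xi ^+ 2))|)%:E)); last first.
    by move=> xi _; rewrite -(@integral_s _ _ _ _ _ Num.norm)//; right.
  have /integrableP[_] := ig; apply: le_lt_trans; apply: ge0_le_integral_pw => //.
  move=> xi _; rewrite lee_fin !normrM.
  have [->|xi0] := eqVneq xi 0.
    by rewrite !mxE normr0 !mul0r mulr0.
  have e0 : 0 < enorm xi ^+ 2 by rewrite exprn_gt0// enorm_gt0.
  rewrite -[leRHS]mul1r; apply: ler_pM; rewrite ?mulr_ge0 ?normr_ge0 ?cos_max//.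
  rewrite mulrA normfV (gtr0_norm e0) (ger0_norm (expR_ge0 _)) ler_pdivrMr//.
  by rewrite mulrC ler_wpM2l// -normrM coord_mul_le_enorm.
have E12 := integral12_prod_meas1 iF1.
have E21 := integral21_prod_meas1 iF1.
have iF := integrable_fubini_F iF1.
have FE : fubini_F mu (EFin \o F1 x j k t) = (fun xi =>
    (cos (edot x xi) * (xi ord0 j * xi ord0 k *
     (expR (- (t * enorm xi ^+ 2)) / enorm xi ^+ 2)))%:E).
  apply/funext => xi; rewrite /fubini_F/=.
  by rewrite (@integral_s _ _ _ _ _ id)//; left.
have GE : fubini_G (lebesgue_rV n) (EFin \o F1 x j k t) = (EFin \o g) \_ (I t).
  apply/funext => s; rewrite patchE /fubini_G/= /F1.
  case: ifPn => sI; last first.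
    under eq_integral do rewrite indicE (negbTE sI) mulr0.
    by rewrite integral0.
  have s0 : 0 < s.
    by move: sI; rewrite inE /I/= in_itv/= andbT; exact: lt_le_trans.
  under eq_integral do rewrite indicE sI mulr1 /F/=.
  rewrite /g -integral_cos_gauss2// fineK//; apply: integrable_fin_num => //.
  have := @integrable_gauss_weights R n s (pair_weight j k) s0.
  apply: le_integrable => //.
    apply/measurable_EFinP.
    exact: (measurableT_comp (mF x j k) (measurable_pair2 s)).
  by move=> xi _; rewrite lee_fin prod_pair_weight normrM ler_piMl// cos_max.
have iG : mu.-integrable setT (fubini_G (lebesgue_rV n) (EFin \o F1 x j k t)).
  apply/integrableP; split; first exact: (measurable_fubini_G iF1).
  have mE : measurable_fun setT (EFin \o F1 x j k t) := measurable_int _ iF1.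
  have h := (integrable21ltyP (lebesgue_rV n) (@lebesgue_measure R) mE).1 iF1.
  apply: (le_lt_trans _ h).
  apply: ge0_le_integral_pw => // s _; apply: le_abse_integral => //.
  exact: (measurableT_comp mE (measurable_pair2 s)).
rewrite FE in iF E12; rewrite GE in iG E21; split=> //.
  have mIt : measurable (I t) by exact: measurable_itv.
  by apply: (iffRL (@integrable_mkcond _ (measurableTypeR R) R mu (I t) (EFin \o g) mIt)); exact: iG.
congr fine; apply: (etrans E12); rewrite -E21 [RHS]integral_mkcond.
by apply: eq_integral => s _; exact: (congr1 (fun h => h s) GE).
Qed.

(** The second derivative [d_j d_k G_s] of the heat kernel written out. Differentiating twice
    multiplies the transform by [- xi_j xi_k], whence the sign opposite to that of the Gaussian
    moment. *)
Definition heat_hess s j k x : R :=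
  (x ord0 j * x ord0 k / (4 * s ^+ 2) - (j == k)%:R / (2 * s)) * heat_kernel s x.

Lemma heat_kernelE s x : 0 < s ->
  heat_kernel s x = (2 * pi) ^- n *
    (Num.sqrt (pi / s) ^+ n * expR (- (enorm x ^+ 2 / (4 * s)))).
Proof.
move=> s0; rewrite /heat_kernel mulrA; congr (_ * _).
have p0 : 0 < pi :> R := pi_gt0 R.
rewrite -exprVn -exprMn -powR_mulrn ?mulr_ge0 ?invr_ge0 ?sqrtr_ge0 ?(ltW p0)//.
have -> : - (n%:R / 2) = - 2^-1 * n%:R :> R by rewrite mulNr mulrC.
rewrite powRrM powRN powR12_sqrt ?mulr_ge0 ?(ltW p0) ?(ltW s0)//; congr (_ `^ _).
apply: (@mulIf _ (Num.sqrt (4 * pi * s))); first by rewrite gt_eqF// sqrtr_gt0 !mulr_gt0.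
rewrite mulVf ?gt_eqF ?sqrtr_gt0 ?mulr_gt0//.
rewrite -[RHS]mulrA -sqrtrM ?divr_ge0 ?(ltW p0) ?(ltW s0)//.
have -> : pi / s * (4 * pi * s) = (2 * pi) ^+ 2 by field; rewrite gt_eqF.
by rewrite sqrtr_sqr ger0_norm ?mulr_ge0 ?(ltW p0)// mulVf// mulf_neq0// gt_eqF.
by rewrite mulr_ge0// ltW.
Qed.

Lemma stokes_kernelE t j k x : 0 < t ->
  stokes_kernel t j k x = (j == k)%:R * heat_kernel t x +
    \int[mu]_(s in `[t, +oo[) heat_hess s j k x.
Proof.
move=> t0; have [ir ig2 Er] := integral_cos_riesz x j k t0.
have ig : (lebesgue_rV n).-integrable setT
    (fun xi => (cos (edot x xi) * expR (- (t * enorm xi ^+ 2)))%:E).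
  have := @integrable_gauss_weights R n t (fun=> 0%N) t0.
  under eq_fun do rewrite big1 ?mul1r//.
  apply: le_integrable => //.
    apply/measurable_EFinP/measurable_funM.
      apply: (measurableT_comp (f := @cos R)).
        by apply: continuous_measurable_fun; exact: continuous_cos.
      exact: measurable_fun_edot.
    apply: (measurableT_comp (f := @expR R)).
      by apply: continuous_measurable_fun; exact: continuous_expR.
    apply: measurableT_comp => //; apply: measurable_funM => //.
    by apply: measurable_funX; exact: measurable_fun_enorm.
  by move=> xi _; rewrite lee_fin normrM ler_piMl// cos_max.
rewrite /stokes_kernel.
have -> : \int[lebesgue_rV n]_xi (cos (edot x xi) * stokes_symbol t j k xi) =
  \int[lebesgue_rV n]_xi ((j == k)%:R * (cos (edot x xi) * expR (- (t * enorm xi ^+ 2)))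
   - (cos (edot x xi) * (xi ord0 j * xi ord0 k *
     (expR (- (t * enorm xi ^+ 2)) / enorm xi ^+ 2)))).
  apply: eq_Rintegral => xi _; rewrite /stokes_symbol mulNr.
  set e := expR _; ring.
rewrite RintegralB//; last by exact: (integrableZl measurableT ((j == k)%:R) ig).
rewrite RintegralZl// integral_cos_gauss// Er mulrBr mulrCA -heat_kernelE//.
congr (_ + _).
rewrite -mulNr -RintegralZl//; apply: eq_Rintegral => s.
rewrite inE/= in_itv/= andbT => ts; have s0 := lt_le_trans t0 ts.
by rewrite /heat_hess heat_kernelE//; ring.
Qed.

End kernel_formula.

(** * Pointwise bounds on the kernel *)

Section heat_bounds.
Context {R : realType} {n : nat}.
Hypothesis n0 : (0 < n)%N.
Notation mu := (@lebesgue_measure R).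
Implicit Types (s t b : R) (x v : 'rV[R]_n) (j k : 'I_n).

Let nR : 0 < n%:R :> R. Proof. by rewrite ltr0n. Qed.

Let mI (i : interval R) : measurable ([set` i] : set (measurableTypeR R)).
Proof. exact: measurable_itv. Qed.

Lemma parabolic_gt0 s x : 0 < s -> 0 < enorm x ^+ 2 + s.
Proof. by move=> s0; rewrite ltr_wpDl// sqr_ge0. Qed.

Lemma heat_kernel_ge0 s x : 0 <= heat_kernel s x.
Proof. by rewrite mulr_ge0 ?powR_ge0 ?expR_ge0. Qed.

(** Writing [W = s (1 + w)] with [w = |x|^2 / s], the Gaussian [e^{-w/4}] is below a multiple of
    [(1 + w)^{-q}], and this factor turns [s^{-q}] into [W^{-q}]. *)
Lemma heat_kernel_powR_le b : 0 <= b -> exists2 C : R, 0 < C &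
  forall s x, 0 < s ->
  s `^ (- b) * heat_kernel s x <= C * (enorm x ^+ 2 + s) `^ (- (b + n%:R / 2)).
Proof.
move=> b0; set q := b + n%:R / 2.
have q0 : 0 < q by rewrite ltr_wpDl// divr_gt0.
have [C C0 hC] := @powR_expRN_le R 4^-1 q ltac:(by rewrite invr_gt0) q0.
have p4 : 0 < 4 * pi :> R by rewrite mulr_gt0 ?pi_gt0.
exists ((4 * pi) `^ (- (n%:R / 2)) * C); first by rewrite mulr_gt0 ?powR_gt0.
move=> s x s0; have w0 := parabolic_gt0 x s0.
have sw : 0 <= enorm x ^+ 2 / s by rewrite divr_ge0 ?sqr_ge0 ?(ltW s0).
have -> : s `^ (- b) * heat_kernel s x = (4 * pi) `^ (- (n%:R / 2)) *
    (s `^ (- q) * expR (- (4^-1 * (enorm x ^+ 2 / s)))).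
  rewrite /heat_kernel powRM ?(ltW p4) ?(ltW s0)// mulrA mulrCA -mulrA; congr (_ * _).
  rewrite -powRD; last by rewrite (gt_eqF s0) implybT.
  congr (_ `^ _ * expR _); first by rewrite /q opprD.
  by field; rewrite gt_eqF.
rewrite -mulrA ler_pM2l ?powR_gt0//.
apply: (@le_trans _ _ (s `^ (- q) * (C * (1 + enorm x ^+ 2 / s) `^ (- q)))).
  by rewrite ler_pM2l ?powR_gt0// hC.
rewrite mulrCA ler_pM2l// -powRM ?(ltW s0) ?addr_ge0//.
by rewrite mulrDr mulr1 mulrC divfK ?gt_eqF// addrC.
Qed.

Lemma enorm_le_parabolic s x : 0 < s -> enorm x <= (enorm x ^+ 2 + s) `^ 2^-1.
Proof.
move=> s0; rewrite powR12_sqrt ?(ltW (parabolic_gt0 x s0))//.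
by rewrite -{1}(ger0_norm (enorm_ge0 x)) -sqrtr_sqr ler_wsqrtr// lerDl ltW.
Qed.

(* Each factor [|x|] of a Gaussian derivative is worth [W^{1/2}] and each
   [1/s] is worth [W^{-1}], with [W = |x|^2 + s]. *)
Lemma heat_monomial_le (a b : nat) : exists2 C : R, 0 < C &
  forall s x, 0 < s ->
  enorm x ^+ a * s ^- b * heat_kernel s x <=
  C * (enorm x ^+ 2 + s) `^ (- ((n%:R + 2 * b%:R - a%:R) / 2)).
Proof.
have [C C0 hC] := @heat_kernel_powR_le b%:R (ler0n _ _).
exists C => // s x s0; have w0 := parabolic_gt0 x s0.
apply: (@le_trans _ _ (((enorm x ^+ 2 + s) `^ 2^-1) ^+ a *
   (C * (enorm x ^+ 2 + s) `^ (- (b%:R + n%:R / 2))))).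
  rewrite -mulrA; apply: ler_pM.
  - by rewrite exprn_ge0// enorm_ge0.
  - by rewrite mulr_ge0 ?heat_kernel_ge0// invr_ge0 exprn_ge0// ltW.
  - by apply: lerXn2r; rewrite ?nnegrE ?powR_ge0 ?enorm_ge0// enorm_le_parabolic.
  - by rewrite -powR_invn ?(ltW s0)// hC.
rewrite mulrCA ler_pM2l// -powR_mulrn ?powR_ge0// -powRrM -powRD.
  by rewrite (_ : 2^-1 * a%:R + _ = - ((n%:R + 2 * b%:R - a%:R) / 2))//; field.
by rewrite (gt_eqF w0) implybT.
Qed.

Lemma heat_hess_le : exists2 C : R, 0 < C & forall s j k x, 0 < s ->
  `|heat_hess s j k x| <= C * (enorm x ^+ 2 + s) `^ (- (n%:R / 2) - 1).
Proof.
(* The two monomials of the Hessian, [|x|^2 s^{-2}] and [s^{-1}], have the same parabolic weight. *)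
have [C1 C10 h1] := heat_monomial_le 2 2.
have [C2 C20 h2] := heat_monomial_le 0 1.
exists (C1 + C2); first exact: addr_gt0.
move=> s j k x s0; have w0 := parabolic_gt0 x s0.
have := h1 s x s0; have := h2 s x s0; rewrite expr0 expr1 mul1r.
have -> : - ((n%:R + 2 * 1%:R - 0%:R) / 2) = - (n%:R / 2) - 1 :> R by field.
have -> : - ((n%:R + 2 * 2%:R - 2%:R) / 2) = - (n%:R / 2) - 1 :> R by field.
set W := _ `^ _ => H2 H1; rewrite /heat_hess normrM (ger0_norm (heat_kernel_ge0 _ _)).
rewrite [leRHS]mulrDl; apply: (le_trans _ (lerD H1 H2)).
rewrite -mulrDl ler_wpM2r ?heat_kernel_ge0//.
apply: (le_trans (ler_normB _ _)); apply: lerD.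
  rewrite normrM ler_pM ?normr_ge0 ?coord_mul_le_enorm//.
  rewrite gtr0_norm ?invr_gt0 ?mulr_gt0 ?exprn_gt0//.
  by rewrite lef_pV2 ?posrE ?mulr_gt0 ?exprn_gt0// ler_peMl ?exprn_ge0 ?(ltW s0)// ler1n.
rewrite normrM ger0_norm ?ler0n// gtr0_norm ?invr_gt0 ?mulr_gt0//.
rewrite -[leRHS]mul1r ler_pM ?ler0n ?invr_ge0 ?mulr_ge0 ?(ltW s0)//.
  by case: (j == k).
by rewrite lef_pV2 ?posrE ?mulr_gt0// ler_peMl ?(ltW s0)// ler1n.
Qed.

Lemma measurable_heat_kernel_time t x : 0 < t ->
  measurable_fun `[t, +oo[ (fun s : R => heat_kernel s x).
Proof.
move=> t0; apply: (eq_measurable_fun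
    (fun s => (4 * pi * s) `^ (- (n%:R / 2)) * expR (- (enorm x ^+ 2 / 4 * s `^ (-1))))).
  move=> s; rewrite inE/= in_itv/= andbT => ts; have s0 := lt_le_trans t0 ts.
  by rewrite /heat_kernel powR_inv1 ?(ltW s0)// invfM mulrA.
apply/measurable_funTS/measurable_funM.
  by apply: measurable_fun_powRl; exact: measurable_funM.
apply: (measurableT_comp (f := @expR R)).
  by apply: continuous_measurable_fun; exact: continuous_expR.
apply: measurableT_comp => //; apply: measurable_funM => //.
Qed.

Lemma measurable_heat_hess_time t j k x : 0 < t ->
  measurable_fun `[t, +oo[ (fun s : R => heat_hess s j k x).
Proof.
move=> t0; apply: (eq_measurable_fun
    (fun s => (x ord0 j * x ord0 k / 4 * s `^ (- 2%:R) - (j == k)%:R / 2 * s `^ (-1)) *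
       heat_kernel s x)).
  move=> s; rewrite inE/= in_itv/= andbT => ts; have s0 := lt_le_trans t0 ts.
  by rewrite /heat_hess powR_inv1 ?(ltW s0)// powR_invn ?(ltW s0)// !invfM !mulrA.
apply: measurable_funM; last exact: measurable_heat_kernel_time.
apply/measurable_funTS/measurable_funB; apply: measurable_funM => //;
  exact: measurable_powR.
Qed.

Lemma integrable_parabolic (t r q : R) : 0 < q -> 0 <= r -> 0 < t ->
  mu.-integrable `[t, +oo[ (fun s => ((r + s) `^ (- q - 1))%:E).
Proof.
move=> q0 r0 t0; apply/integrableP; split.
  apply/measurable_EFinP/measurable_funTS/measurable_fun_powRl.
  exact: measurable_funD.
under eq_integral do rewrite gee0_abs ?lee_fin ?powR_ge0//.
by rewrite integral_powR_shift ?ltry// ltr_wpDl.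
Qed.

Lemma integrable_heat_hess t j k x : 0 < t ->
  mu.-integrable `[t, +oo[ (fun s => (heat_hess s j k x)%:E).
Proof.
move=> t0; have [C C0 hC] := heat_hess_le.
have n2 : 0 < n%:R / 2 :> R by rewrite divr_gt0.
have := integrableZl (mI _) C (integrable_parabolic n2 (sqr_ge0 (enorm x)) t0).
apply: le_integrable; first exact: mI.
  by apply/measurable_EFinP; exact: measurable_heat_hess_time.
move=> s; rewrite /= in_itv/= andbT => ts; have s0 := lt_le_trans t0 ts.
by rewrite lee_fin (le_trans (hC _ _ _ _ s0))// ler_norm.
Qed.

(** Two derivatives cost one power of [W], which the integral over times beyond [t] gives back; the
    superposition is therefore bounded by the same power of [W] as the heat kernel at time [t]. *)
Lemma stokes_kernel_le : exists2 C : R, 0 < C & forall t j k x, 0 < t ->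
  `|stokes_kernel t j k x| <= C * (enorm x ^+ 2 + t) `^ (- (n%:R / 2)).
Proof.
have [C1 C10 h1] := heat_monomial_le 0 0.
have [C2 C20 h2] := heat_hess_le.
have n2 : 0 < n%:R / 2 :> R by rewrite divr_gt0.
exists (C1 + C2 * (n%:R / 2)^-1); first by rewrite addr_gt0// mulr_gt0// invr_gt0.
move=> t j k x t0; rewrite stokes_kernelE//.
apply: (le_trans (ler_normD _ _)); rewrite mulrDl; apply: lerD.
  have := h1 t x t0; rewrite !expr0 invr1 !mul1r mulr0 addr0 subr0; apply: le_trans.
  rewrite normrM ger0_norm ?ler0n// ger0_norm ?heat_kernel_ge0//.
  by rewrite ler_piMl ?heat_kernel_ge0//; case: (j == k).
have iP := integrable_parabolic n2 (sqr_ge0 (enorm x)) t0.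
apply: (@le_trans _ _ (\int[mu]_(s in `[t, +oo[)
    (C2 * (enorm x ^+ 2 + s) `^ (- (n%:R / 2) - 1)))).
  apply: normr_Rintegral_le_ae; first exact: mI.
    exact: (integrableZl (mI _) C2 iP).
  by apply: aeW => s /=; rewrite in_itv/= andbT => ts; exact/h2/(lt_le_trans t0 ts).
rewrite (RintegralZl _ (mI _) iP).
rewrite /Rintegral integral_powR_shift//=; first by rewrite mulrA.
exact: parabolic_gt0.
Qed.

(** The tails beyond [t2] cancel. What is left is a Hessian integral over an interval of length at
    most [t2], and two heat kernels, each at most [C1 s |x|^{-n-2}] with [s <= t2]; all of it is
    measured in [|x|] alone. *)
Lemma stokes_kernel_time_le : exists2 C : R, 0 < C & forall t1 t2 j k x,
  0 < t1 -> t1 <= t2 -> x != 0 ->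
  `|stokes_kernel t1 j k x - stokes_kernel t2 j k x| <=
    C * t2 * (enorm x ^+ 2) `^ (- (n%:R / 2) - 1).
Proof.
have [C1 C10 h1] := heat_monomial_le 0 1.
have [C2 C20 h2] := heat_hess_le.
exists (C1 * 2 + C2); first by rewrite addr_gt0// mulr_gt0.
move=> t1 t2 j k x t10 t12 x0; have t20 := lt_le_trans t10 t12.
have xx : 0 < enorm x ^+ 2 by rewrite exprn_gt0// enorm_gt0.
set q := - (n%:R / 2) - 1.
have qE : q = - (n%:R / 2 + 1) by rewrite /q opprD.
have WX s : 0 < s -> (enorm x ^+ 2 + s) `^ q <= (enorm x ^+ 2) `^ q.
  move=> s0; rewrite qE; apply: le_powRN; [|by []|by rewrite lerDl ltW].
  by rewrite addr_ge0// ltW// divr_gt0.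
have hG s : 0 < s -> s <= t2 -> heat_kernel s x <= C1 * t2 * (enorm x ^+ 2) `^ q.
  move=> s0 st; have := h1 s x s0; rewrite expr0 expr1 mul1r.
  have -> : - ((n%:R + 2 * 1%:R - 0%:R) / 2) = q :> R by rewrite /q; field.
  rewrite mulrC ler_pdivrMr// => h; apply: (le_trans h).
  rewrite mulrAC ler_pM ?mulr_ge0 ?powR_ge0 ?(ltW C10) ?(ltW s0)//.
    by rewrite ler_pM ?(ltW C10) ?(ltW s0).
  exact: WX.
rewrite !stokes_kernelE// opprD addrACA.
apply: (le_trans (ler_normD _ _)); rewrite 2!mulrDl; apply: lerD.
  rewrite -mulrBr normrM ger0_norm ?ler0n//.
  apply: (@le_trans _ _ (`|heat_kernel t1 x - heat_kernel t2 x|)).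
    by rewrite ler_piMl//; case: (j == k).
  rewrite (le_trans (ler_normB _ _))// !(ger0_norm (heat_kernel_ge0 _ _)).
  rewrite [leRHS](_ : _ = C1 * t2 * (enorm x ^+ 2) `^ q + C1 * t2 * (enorm x ^+ 2) `^ q).
    by apply: lerD; apply: hG.
  by ring.
have ih := integrable_heat_hess j k x t10.
have -> : \int[mu]_(s in `[t1, +oo[) heat_hess s j k x =
   \int[mu]_(s in `[t1, t2[) heat_hess s j k x + \int[mu]_(s in `[t2, +oo[) heat_hess s j k x.
  have iE : [set` `[t1, +oo[] = [set` `[t1, t2[] `|` [set` `[t2, +oo[] :> set R.
    by rewrite -itv_bndbnd_setU ?bnd_simp.
  rewrite iE in ih *; rewrite Rintegral_setU//=.
  apply/disj_setPS => y [/=]; rewrite !in_itv/= => /andP[_ yt] /andP[].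
  by rewrite leNgt yt.
rewrite addrK.
apply: (@le_trans _ _ (\int[mu]_(s in `[t1, t2[) (C2 * (enorm x ^+ 2) `^ q))).
  apply: normr_Rintegral_le_ae; first exact: mI.
    apply/integrableP; split; first exact: measurable_cst.
    rewrite /= integral_cst//= lebesgue_measure_itv/=.
    by case: ifPn => _; rewrite ?mule0 -?EFinM ltry.
  apply: aeW => s /=; rewrite in_itv/= => /andP[ts _]; have s0 := lt_le_trans t10 ts.
  by rewrite (le_trans (h2 _ _ _ _ s0))// ler_pM2l// WX.
rewrite Rintegral_cst; last exact: mI.
rewrite /= lebesgue_measure_itv/= lte_fin.
rewrite [leRHS]mulrAC ler_wpM2l ?mulr_ge0 ?powR_ge0 ?(ltW C20)//.
by case: ifPn => _ /=; rewrite ?(ltW t20)// gerBl ltW.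
Qed.

End heat_bounds.

(** * Spatial derivatives of the kernel *)

Section kernel_derivatives.
Context {R : realType} {n : nat}.
Hypothesis n0 : (0 < n)%N.
Notation mu := (@lebesgue_measure R).
Implicit Types (s t l : R) (x v : 'rV[R]_n) (j k : 'I_n).

(** Derivative of the heat kernel along [v]. Working along lines keeps to one-variable calculus: a
    basis vector [v] gives the partial derivatives, [v = - y] the mean value theorem. *)
Definition heat_dir v s x : R := - (edot x v / (2 * s)) * heat_kernel s x.

Definition hess_dir v s j k x : R :=
  (v ord0 j * x ord0 k + x ord0 j * v ord0 k) / (4 * s ^+ 2) * heat_kernel s x +
  (x ord0 j * x ord0 k / (4 * s ^+ 2) - (j == k)%:R / (2 * s)) * heat_dir v s x.

Definition stokes_dir v t j k x : R :=
  (j == k)%:R * heat_dir v t x + \int[mu]_(s in `[t, +oo[) hess_dir v s j k x.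

Lemma is_derive_affine (a b l : R) : is_derive l 1 (fun l => a + l * b) b.
Proof.
have := is_deriveD (is_derive_cst a l 1)
  (is_deriveM (is_derive_id l (1 : R)) (is_derive_cst b l 1)).
by rewrite scaler0 !add0r /GRing.scale/= mulr1.
Qed.

Lemma is_derive_coord x v j l :
  is_derive l 1 (fun l => (x + l *: v) ord0 j) (v ord0 j).
Proof.
rewrite (_ : (fun _ => _) = fun l => x ord0 j + l * v ord0 j).
  exact: is_derive_affine.
by apply/funext => h; rewrite !mxE.
Qed.

Lemma is_derive_heat_kernel s x v l : 0 < s ->
  is_derive l 1 (fun l => heat_kernel s (x + l *: v)) (heat_dir v s (x + l *: v)).
Proof.
move=> s0.
pose q l := - ((enorm x ^+ 2 + l * (2 * edot x v + l * edot v v)) / (4 * s)).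
have qE l' : - (enorm (x + l' *: v) ^+ 2 / (4 * s)) = q l'.
  rewrite /q !sqr_enorm !(edotDl, edotDr, edotZl, edotZr) (edotC v x).
  by congr (- (_ / _)); ring.
have h1 := is_derive_affine (2 * edot x v) (edot v v) l.
have h2 := is_deriveD (is_derive_cst (enorm x ^+ 2) l 1)
  (is_deriveM (is_derive_id l (1 : R)) h1).
have h3 : is_derive l 1 q _ := is_deriveN (is_deriveM h2 (is_derive_cst (4 * s)^-1 l 1)).
have h4 := @is_derive1_comp _ expR q l _ _ (is_derive_expR _) h3.
have h5 := is_deriveM (is_derive_cst ((4 * pi * s) `^ (- (n%:R / 2))) l 1) h4.
rewrite (_ : (fun _ => _) = cst ((4 * pi * s) `^ (- (n%:R / 2))) * (expR \o q)); last first.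
  by apply/funext => l'; rewrite /heat_kernel qE.
move: h5; set D := (X in is_derive l 1 _ X -> _).
rewrite (_ : D = heat_dir v s (x + l *: v))// /D /heat_dir /heat_kernel qE.
rewrite edotDl edotZl /GRing.scale/= ?fctE/=; field; rewrite gt_eqF//.
Qed.

Lemma is_derive_heat_hess s x v j k l : 0 < s ->
  is_derive l 1 (fun l => heat_hess s j k (x + l *: v)) (hess_dir v s j k (x + l *: v)).
Proof.
move=> s0.
have h1 := is_deriveM (is_derive_coord x v j l) (is_derive_coord x v k l).
have h2 := is_deriveM h1 (is_derive_cst (4 * s ^+ 2)^-1 l 1).
have h3 := is_deriveB h2 (is_derive_cst ((j == k)%:R / (2 * s)) l 1).
have h4 := is_deriveM h3 (is_derive_heat_kernel x v l s0).
move: h4; set D := (X in is_derive l 1 _ X -> _).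
rewrite (_ : D = hess_dir v s j k (x + l *: v))// /D /hess_dir.
by rewrite /GRing.scale/= ?fctE/=; ring.
Qed.

Lemma heat_dir_le : exists2 C : R, 0 < C & forall v s x, 0 < s ->
  `|heat_dir v s x| <= C * enorm v * (enorm x ^+ 2 + s) `^ (- ((n%:R + 1) / 2)).
Proof.
have [C C0 h] := @heat_monomial_le R n n0 1 1.
exists C => // v s x s0; have := h s x s0; rewrite !expr1.
have -> : - ((n%:R + 2 * 1%:R - 1%:R) / 2) = - ((n%:R + 1) / 2) :> R by field.
move=> H; rewrite /heat_dir normrM (ger0_norm (heat_kernel_ge0 _ _)) normrN normrM.
rewrite [leRHS]mulrAC; apply: (@le_trans _ _ (enorm x / s * heat_kernel s x * enorm v)); last first.
  by rewrite ler_wpM2r ?enorm_ge0.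
rewrite [leRHS]mulrAC ler_wpM2r ?heat_kernel_ge0// [leRHS]mulrAC; apply: ler_pM => //.
  by have := edot_le x v.
by rewrite gtr0_norm ?invr_gt0 ?mulr_gt0// lef_pV2 ?posrE ?mulr_gt0// ler_peMl ?(ltW s0)// ler1n.
Qed.

Lemma hess_dir_le : exists2 C : R, 0 < C & forall v s j k x, 0 < s ->
  `|hess_dir v s j k x| <=
    C * enorm v * (enorm x ^+ 2 + s) `^ (- ((n%:R + 1) / 2) - 1).
Proof.
have [C1 C10 h1] := @heat_monomial_le R n n0 1 2.
have [C2 C20 h2] := @heat_monomial_le R n n0 3 3.
(* [C1] occurs twice because the product-rule term and the [delta_{jk}] term both have size
   [|x| s^{-2}]; [C2] belongs to the cubic term [|x|^3 s^{-3}]. *)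
exists (C1 + C1 + C2); first by rewrite !addr_gt0.
move=> v s j k x s0; have := h1 s x s0; have := h2 s x s0; rewrite !expr1.
have -> : - ((n%:R + 2 * 3%:R - 3%:R) / 2) = - ((n%:R + 1) / 2) - 1 :> R by field.
have -> : - ((n%:R + 2 * 2%:R - 1%:R) / 2) = - ((n%:R + 1) / 2) - 1 :> R by field.
set W := _ `^ _; set G := heat_kernel s x => H2 H1.
have G0 : 0 <= G by exact: heat_kernel_ge0.
have v0 := enorm_ge0 v; have x0 := enorm_ge0 x.
have si : 0 < s^-1 by rewrite invr_gt0.
have xv := edot_le x v.
have xj := coord_le_enorm x j; have xk := coord_le_enorm x k.
have vj := coord_le_enorm v j; have vk := coord_le_enorm v k.
have gd : heat_dir v s x = - (edot x v / (2 * s)) * G by [].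
have hd : hess_dir v s j k x =
  (v ord0 j * x ord0 k + x ord0 j * v ord0 k) / (4 * s ^+ 2) * G +
  (x ord0 j * x ord0 k / (4 * s ^+ 2) - (j == k)%:R / (2 * s)) * heat_dir v s x by [].
clearbody G.
have T1 : `|(v ord0 j * x ord0 k + x ord0 j * v ord0 k) / (4 * s ^+ 2) * G| <=
    enorm v * (enorm x / s ^+ 2 * G).
  rewrite [leRHS](_ : _ = (enorm v * enorm x) * (s ^+ 2)^-1 * G); last by ring.
  rewrite normrM (ger0_norm G0) ler_wpM2r// normrM.
  rewrite [X in _ * X]gtr0_norm ?invr_gt0 ?mulr_gt0 ?exprn_gt0// invfM mulrA.
  rewrite ler_wpM2r ?invr_ge0 ?exprn_ge0 ?(ltW s0)//.
  rewrite ler_pdivrMr// (le_trans (ler_normD _ _))// !normrM.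
  apply: (@le_trans _ _ (enorm v * enorm x + enorm x * enorm v)).
    by apply: lerD; apply: ler_pM.
  have := mulr_ge0 v0 x0; lra.
have T2 : `|(x ord0 j * x ord0 k / (4 * s ^+ 2)) * heat_dir v s x| <=
    enorm v * (enorm x ^+ 3 / s ^+ 3 * G).
  rewrite gd [X in `|X|](_ : _ = - ((x ord0 j * x ord0 k * edot x v) * (8 * s ^+ 3)^-1 * G)); last first.
    by field; rewrite gt_eqF.
  rewrite [leRHS](_ : _ = (enorm x ^+ 2 * (enorm x * enorm v)) * (s ^+ 3)^-1 * G); last by ring.
  rewrite normrN normrM (ger0_norm G0) ler_wpM2r//.
  rewrite normrM [X in _ * X]gtr0_norm ?invr_gt0 ?mulr_gt0 ?exprn_gt0//.
  apply: ler_pM; rewrite ?normr_ge0 ?invr_ge0 ?mulr_ge0 ?exprn_ge0 ?(ltW s0)//.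
    by rewrite normrM ler_pM ?normr_ge0 ?coord_mul_le_enorm.
  by rewrite lef_pV2 ?posrE ?mulr_gt0 ?exprn_gt0// ler_peMl ?exprn_ge0 ?(ltW s0)// ler1n.
have T3 : `|((j == k)%:R / (2 * s)) * heat_dir v s x| <=
    enorm v * (enorm x / s ^+ 2 * G).
  rewrite gd [X in `|X|](_ : _ = - (((j == k)%:R * edot x v) * (4 * s ^+ 2)^-1 * G)); last first.
    by field; rewrite gt_eqF.
  rewrite [leRHS](_ : _ = (1 * (enorm x * enorm v)) * (s ^+ 2)^-1 * G); last by ring.
  rewrite normrN normrM (ger0_norm G0) ler_wpM2r//.
  rewrite normrM [X in _ * X]gtr0_norm ?invr_gt0 ?mulr_gt0 ?exprn_gt0//.
  apply: ler_pM; rewrite ?normr_ge0 ?invr_ge0 ?mulr_ge0 ?exprn_ge0 ?(ltW s0)//.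
    rewrite normrM ler_pM ?normr_ge0//.
    by case: (j == k); rewrite ?normr1 ?normr0.
  by rewrite lef_pV2 ?posrE ?mulr_gt0 ?exprn_gt0// ler_peMl ?exprn_ge0 ?(ltW s0)// ler1n.
rewrite hd (mulrBl (heat_dir v s x)) addrA.
apply: (le_trans (ler_normB _ _)); apply: (le_trans (lerD (ler_normD _ _) (lexx _))).
apply: (le_trans (lerD (lerD T1 T2) T3)).
have := ler_wpM2l v0 H1; have := ler_wpM2l v0 H2; lra.
Qed.

Let q : R := (n%:R + 1) / 2.
Let q0 : 0 < q. Proof. by rewrite divr_gt0// ltr_wpDl. Qed.
Let mI (i : interval R) : measurable ([set` i] : set (measurableTypeR R)).
Proof. exact: measurable_itv. Qed.

Lemma is_derive_stokes_kernel t x v j k l : 0 < t ->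
  is_derive l 1 (fun l => stokes_kernel t j k (x + l *: v))
    (stokes_dir v t j k (x + l *: v)).
Proof.
move=> t0; have [C C0 hC] := hess_dir_le.
rewrite (_ : (fun _ => _) = (fun l => (j == k)%:R * heat_kernel t (x + l *: v)) \+
    (fun l => \int[mu]_(s in `[t, +oo[) heat_hess s j k (x + l *: v))); last first.
  by apply/funext => l'; rewrite stokes_kernelE.
apply: is_deriveD; first exact: is_deriveZ (is_derive_heat_kernel x v l t0).
(* Dropping the spatial part of [W] gives a majorant depending on time only, uniform along the line,
   as differentiation under the integral requires; [t > 0] makes it integrable. *)
have iP := integrable_parabolic q0 (lexx 0) t0.
apply: (@is_derive_under_integral R _ _ mu [set` `[t, +oo[]
  (fun l s => heat_hess s j k (x + l *: v))
  (fun l s => hess_dir v s j k (x + l *: v))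
  (fun s => C * enorm v * (0 + s) `^ (- q - 1))).
- exact: mI.
- by move=> l'; exact: integrable_heat_hess.
- move=> l' s; rewrite /= in_itv/= andbT => ts.
  exact/is_derive_heat_hess/(lt_le_trans t0 ts).
- by move=> s; rewrite !mulr_ge0 ?powR_ge0 ?enorm_ge0 ?(ltW C0).
- exact: (integrableZl (mI _) (C * enorm v) iP).
- move=> l' s; rewrite /= in_itv/= andbT => ts; have s0 := lt_le_trans t0 ts.
  apply: (le_trans (hC _ _ _ _ _ s0)).
  rewrite ler_wpM2l ?mulr_ge0 ?enorm_ge0 ?(ltW C0)//.
  have -> : - ((n%:R + 1) / 2) - 1 = - (q + 1) by rewrite opprD.
  by apply: le_powRN; rewrite ?addr_ge0 ?(ltW q0) ?add0r// lerDr sqr_ge0.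
Qed.

Lemma stokes_dir_le : exists2 C : R, 0 < C & forall v t j k x, 0 < t ->
  `|stokes_dir v t j k x| <=
    C * enorm v * (enorm x ^+ 2 + t) `^ (- ((n%:R + 1) / 2)).
Proof.
have [C1 C10 h1] := heat_dir_le; have [C2 C20 h2] := hess_dir_le.
exists (C1 + C2 * q^-1); first by rewrite addr_gt0// mulr_gt0// invr_gt0.
move=> v t j k x t0; rewrite /stokes_dir.
apply: (le_trans (ler_normD _ _)); rewrite 2!mulrDl; apply: lerD.
  apply: (le_trans _ (h1 v t x t0)); rewrite normrM.
  by rewrite ler_piMl//; case: (j == k); rewrite ?normr1 ?normr0.
have iP := integrable_parabolic q0 (sqr_ge0 (enorm x)) t0.
apply: (@le_trans _ _ (\int[mu]_(s in `[t, +oo[)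
    (C2 * enorm v * (enorm x ^+ 2 + s) `^ (- q - 1)))).
  apply: normr_Rintegral_le_ae; first exact: mI.
    exact: (integrableZl (mI _) (C2 * enorm v) iP).
  by apply: aeW => s /=; rewrite in_itv/= andbT => ts; exact/h2/(lt_le_trans t0 ts).
rewrite (RintegralZl _ (mI _) iP).
rewrite /Rintegral integral_powR_shift//=; last exact: parabolic_gt0.
by rewrite mulrA (mulrAC C2).
Qed.

Lemma derive_line (f : 'rV[R]_n -> R) x v (D : R) :
  is_derive (0 : R) 1 (fun l => f (x + l *: v)) D -> 'D_v f x = D.
Proof.
move=> [_ <-]; rewrite /derive.
have -> : (fun h : R => h^-1 *: ((f \o shift x) (h *: v) - f x)) =
    (fun h : R => h^-1 *: (((fun l => f (x + l *: v)) \o shift 0) (h *: 1) -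
      f (x + 0 *: v))).
  apply/funext => h /=; rewrite addr0 scale0r addr0 [h *: v + x]addrC.
  by rewrite /GRing.scale/= mulr1.
by [].
Qed.

Lemma partial_stokes_kernel_le : exists2 C : R, 0 < C & forall t h j k x, 0 < t ->
  `|partial h (stokes_kernel t j k) x| <=
    C * (enorm x ^+ 2 + t) `^ (- ((n%:R + 1) / 2)).
Proof.
have [C C0 hC] := stokes_dir_le.
exists C => // t h j k x t0; rewrite /partial.
rewrite (derive_line (is_derive_stokes_kernel x _ j k 0 t0)) scale0r addr0.
have := hC (delta_mx ord0 h) t j k x t0.
rewrite (_ : enorm (delta_mx ord0 h) = 1) ?mulr1//.
rewrite /enorm /edot (bigD1 h)//= big1 ?addr0; last first.
  by move=> i /negbTE ih; rewrite !mxE ih andbF mul0r.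
by rewrite !mxE !eqxx mulr1 sqrtr1.
Qed.

(** Mean value theorem on the segment from [x] to [x - y], all of whose points have norm at least
    [|x|/2]; the factor [4^q] is the price of that half. *)
Lemma stokes_kernel_space_le : exists2 C : R, 0 < C & forall t j k x (y : 'rV[R]_n),
  0 < t -> x != 0 -> 2 * enorm y <= enorm x ->
  `|stokes_kernel t j k (x - y) - stokes_kernel t j k x| <=
    C * enorm y * (enorm x ^+ 2) `^ (- ((n%:R + 1) / 2)).
Proof.
have [C C0 hC] := stokes_dir_le.
exists (C * 4 `^ q); first by rewrite mulr_gt0// powR_gt0.
move=> t j k x y t0 x0 yx; have xx : 0 < enorm x ^+ 2 by rewrite exprn_gt0// enorm_gt0.
pose g l := stokes_kernel t j k (x + l *: (- y)).
have dg (l : R) : is_derive l 1 g (stokes_dir (- y) t j k (x + l *: (- y))).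
  exact: is_derive_stokes_kernel.
have [|c c01 hc] := @MVT R g (fun l => stokes_dir (- y) t j k (x + l *: (- y))) 0 1 ltr01.
- by apply: derivable_within_continuous => l _; have [] := dg l.
have := hc; rewrite /g scale1r scale0r addr0 subr0 mulr1 => ->.
apply: (le_trans (hC _ _ _ _ _ t0)); rewrite enormN.
rewrite [leRHS](_ : _ = C * enorm y * (4 `^ q * (enorm x ^+ 2) `^ (- q))); last by ring.
rewrite ler_wpM2l ?mulr_ge0 ?enorm_ge0 ?(ltW C0)//.
have hx : enorm x ^+ 2 / 4 <= enorm (x + c *: - y) ^+ 2 + t.
  have : enorm x <= enorm (x + c *: - y) + enorm y.
    apply: (le_trans (enorm_le_add x (c *: y))); rewrite scalerN lerD2l enormZ.
    move: c01; rewrite in_itv/= => /andP[c0 c1].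
    by rewrite ger0_norm ?(ltW c0)// ler_piMl ?enorm_ge0 ?(ltW c1).
  have := enorm_ge0 (x + c *: - y); set u := enorm (x + _) => u0 xu.
  have hu : enorm x / 2 <= u by lra.
  have : (enorm x / 2) ^+ 2 <= u ^+ 2.
    by apply: lerXn2r; rewrite ?nnegrE ?divr_ge0 ?enorm_ge0.
  lra.
apply: (@le_trans _ _ ((enorm x ^+ 2 / 4) `^ (- q))).
  by apply: le_powRN; rewrite ?(ltW q0)// divr_gt0.
rewrite powRM ?(ltW xx) ?invr_ge0// mulrC ler_wpM2r ?powR_ge0//.
by rewrite -powR_inv1// -powRrM mulN1r opprK.
Qed.

End kernel_derivatives.

Section Rintegral_sum.
Context d (T : measurableType d) (R : realType) (mu : {measure set T -> \bar R}).

Lemma integrable_Rsum (D : set T) (I : Type) (s : seq I) (f : I -> T -> R) :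
  measurable D -> (forall i, mu.-integrable D (EFin \o f i)) ->
  mu.-integrable D (fun x => (\sum_(i <- s) f i x)%:E).
Proof.
move=> mD fi; have := integrable_sum mD s (fun i (_ : true) => fi i).
by apply: eq_integrable => // x _; rewrite sumEFin.
Qed.

Lemma Rintegral_sum (D : set T) (I : Type) (s : seq I) (f : I -> T -> R) :
  measurable D -> (forall i, mu.-integrable D (EFin \o f i)) ->
  \int[mu]_(x in D) (\sum_(i <- s) f i x) = \sum_(i <- s) \int[mu]_(x in D) f i x.
Proof.
move=> mD fi; elim: s => [|i s ih].
  by under eq_Rintegral do rewrite big_nil; rewrite /Rintegral integral0 big_nil.
rewrite big_cons -ih -RintegralD//; last exact: integrable_Rsum.
by apply: eq_Rintegral => x _; rewrite big_cons.
Qed.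

End Rintegral_sum.

(** * Sign of the kernel in a cone *)

Section kernel_sign.
Context {R : realType} {n : nat}.
Hypothesis n0 : (0 < n)%N.
Notation mu := (@lebesgue_measure R).
Implicit Types (s t : R) (x m : 'rV[R]_n).

Let mI (i : interval R) : measurable ([set` i] : set (measurableTypeR R)).
Proof. exact: measurable_itv. Qed.

Lemma sum_heat_hess s x m :
  \sum_j \sum_k m ord0 j * m ord0 k * heat_hess s j k x =
  (edot x m ^+ 2 / (4 * s ^+ 2) - edot m m / (2 * s)) * heat_kernel s x.
Proof.
rewrite /heat_hess.
have -> : edot x m ^+ 2 = \sum_j \sum_k m ord0 j * m ord0 k * (x ord0 j * x ord0 k).
  rewrite expr2 {1}/edot mulr_suml; apply: eq_bigr => j _.
  by rewrite /edot mulr_sumr; apply: eq_bigr => k _; ring.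
have -> : edot m m = \sum_j \sum_k m ord0 j * m ord0 k * (j == k)%:R.
  apply: eq_bigr => j _; rewrite (bigD1 j)//= eqxx mulr1 big1 ?addr0// => k.
  by rewrite eq_sym => /negbTE ->; rewrite mulr0.
rewrite !mulr_suml -sumrB mulr_suml; apply: eq_bigr => j _.
rewrite !mulr_suml -sumrB mulr_suml; apply: eq_bigr => k _.
by ring.
Qed.

(* Near the hyperplane orthogonal to m, the term -|m|^2/(2s) G_s dominates the
   quadratic form of the kernel in the direction m. *)
Lemma stokes_kernel_cone : exists c M k : R, [/\ 0 < c, 0 < M, 0 < k &
  forall t x m, 0 < t -> x != 0 -> M * t <= enorm x ^+ 2 ->
    edot x m ^+ 2 <= k * (enorm x ^+ 2 * edot m m) ->
  \sum_i \sum_j m ord0 i * m ord0 j * stokes_kernel t i j x <=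
    - c * edot m m * (enorm x ^+ 2) `^ (- (n%:R / 2))].
Proof.
have nR : 0 < n%:R / 2 :> R by rewrite divr_gt0// ltr0n.
have [C1 C10 h1] := @heat_monomial_le R n n0 0 1.
have [C2 C20 h2] := @heat_monomial_le R n n0 0 2.
have p0 : 0 < 8 * pi :> R by rewrite mulr_gt0// pi_gt0.
(* Lower bound for the integral of [G_s / (2s)] over [s] in [[r, 2r]], with [r = |x|^2], in units of
   [r^{-n/2}]. There [1/(2s) >= 1/(4r)], [(4 pi s)^{-n/2} >= (8 pi r)^{-n/2}] and
   [e^{-r/4s} >= e^{-1/4}], and the interval has length [r]. *)
pose c0 : R := 4^-1 * ((8 * pi) `^ (- (n%:R / 2)) * expR (- 4^-1)).
have c00 : 0 < c0 by rewrite !mulr_gt0 ?invr_gt0 ?powR_gt0 ?expR_gt0.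
pose q : R := n%:R / 2 + 1; have q0 : 0 < q by rewrite addr_gt0.
(* A budget for the main term [c0]: the choice of [M] limits the heat kernel at time [t] to [c0/4],
   the opening of the cone limits the positive part [(x . m)^2 / (4 s^2)] to [c0/4], and [c0/2]
   survives. The summand 1 in [M] ensures [t <= r], so [[r, 2r]] lies in the range of
   integration. *)
exists (c0 / 2), (1 + 4 * C1 / c0), (c0 * q / C2); split.
- by rewrite divr_gt0.
- by rewrite addr_gt0// divr_gt0// mulr_gt0.
- by rewrite divr_gt0// mulr_gt0.
move=> t x m t0 x0 Mt cone.
set r := enorm x ^+ 2 in Mt cone *; set A := edot m m in cone *.
have r0 : 0 < r by rewrite exprn_gt0// enorm_gt0.
have rE : r = enorm x ^+ 2 by [].
clearbody r.
have A0 : 0 <= A by exact: edot_ge0.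
have MtE : t + 4 * C1 / c0 * t <= r by move: Mt; rewrite mulrDl mul1r.
have C1t : 0 <= 4 * C1 / c0 * t by rewrite !mulr_ge0 ?invr_ge0 ?(ltW C10) ?(ltW c00) ?(ltW t0).
have tr : t <= r by lra.
have rq : r `^ (- q) = r `^ (- (n%:R / 2)) / r.
  rewrite /q opprD powRD; last by rewrite (gt_eqF r0) implybT.
  by rewrite powR_inv1 ?(ltW r0).
set P := r `^ (- (n%:R / 2)); have P0 : 0 < P by exact: powR_gt0.
have WX s (e : R) : 0 < s -> 0 <= e -> (r + s) `^ (- e) <= r `^ (- e).
  by move=> s0 e0; apply: le_powRN => //; rewrite lerDl ltW.
have Gt : heat_kernel t x <= c0 / 4 * P.
  have := h1 t x t0; rewrite expr0 expr1 mul1r.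
  have -> : - ((n%:R + 2 * 1%:R - 0%:R) / 2) = - q :> R by rewrite /q; field.
  rewrite mulrC ler_pdivrMr// -rE => h; apply: (le_trans h).
  apply: (@le_trans _ _ (C1 * (P / r) * t)).
    rewrite ler_wpM2r ?(ltW t0)// ler_wpM2l ?(ltW C10)// -rq.
    by apply: WX => //; exact: ltW.
  rewrite (_ : C1 * (P / r) * t = (C1 * t / r) * P); last by ring.
  rewrite ler_wpM2r ?(ltW P0)// ler_pdivrMr//.
  have -> : C1 * t = c0 / 4 * (4 * C1 / c0 * t) by field; rewrite gt_eqF.
  by rewrite ler_wpM2l ?divr_ge0 ?(ltW c00)//; lra.
pose b : R := c0 * P / r.
have b0 : 0 <= b by rewrite /b mulr_ge0 ?invr_ge0 ?(ltW r0)// ltW// mulr_gt0.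
have bE : b = c0 * P / r by [].
clearbody b.
pose J : set R := [set` `[r, (2 * r)%R]].
have Gs s : J s -> b <= (2 * s)^-1 * heat_kernel s x.
  rewrite /J/= in_itv/= => /andP[rs s2r]; have s0 := lt_le_trans r0 rs.
  have -> : b = (4 * r)^-1 * ((8 * pi * r) `^ (- (n%:R / 2)) * expR (- 4^-1)).
    by rewrite powRM ?(ltW p0) ?(ltW r0)// bE /c0 -/P; field; rewrite gt_eqF.
  apply: ler_pM; first by rewrite invr_ge0 pmulr_rge0// ltW.
  - by rewrite mulr_ge0 ?powR_ge0 ?expR_ge0.
  - by rewrite lef_pV2 ?posrE ?pmulr_rgt0//; lra.
  rewrite /heat_kernel -rE; apply: ler_pM; rewrite ?powR_ge0 ?expR_ge0//.
    apply: le_powRN; rewrite ?(ltW nR) ?mulr_gt0 ?pi_gt0//.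
    rewrite (_ : 8 * pi * r = 4 * pi * (2 * r)); last by ring.
    by rewrite ler_wpM2l// mulr_ge0// pi_ge0.
  rewrite ler_expR lerN2 ler_pdivrMr ?mulr_gt0// mulrA mulVf// mul1r//.
(* [U] bounds the nonnegative quadratic term at every time by the cone condition; [V] retains the
   negative term only on [J], where it is at least [A b]. *)
pose U s : R := c0 * q / C2 * (r * A) / 4 * C2 * (r + s) `^ (- q - 1).
pose V s : R := A * b * \1_J s.
pose h s := \sum_i \sum_j m ord0 i * m ord0 j * heat_hess s i j x.
have hUV s : t <= s -> h s <= U s - V s.
  move=> ts; have s0 := lt_le_trans t0 ts.
  rewrite /h sum_heat_hess -/A mulrBl; apply: lerB.
    have := h2 s x s0; rewrite expr0 mul1r.
    have -> : - ((n%:R + 2 * 2%:R - 0%:R) / 2) = - q - 1 :> R by rewrite /q; field.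
    rewrite -rE => hs; rewrite /U -[leRHS]mulrA.
    apply: (@le_trans _ _ (c0 * q / C2 * (r * A) / 4 * (s ^- 2 * heat_kernel s x))).
      rewrite [leLHS](_ : _ = edot x m ^+ 2 / 4 * (s ^- 2 * heat_kernel s x)); last first.
        by field; rewrite gt_eqF.
      have sG : 0 <= s ^- 2 * heat_kernel s x.
        by rewrite mulr_ge0 ?heat_kernel_ge0// invr_ge0 exprn_ge0// ltW.
      by rewrite ler_wpM2r// ler_wpM2r.
    rewrite ler_wpM2l// mulr_ge0 ?invr_ge0// mulr_ge0//; last first.
      by rewrite mulr_ge0// ltW.
    by rewrite divr_ge0 ?(ltW C20)// mulr_ge0 ?(ltW c00) ?(ltW q0).
  rewrite /V -!mulrA ler_wpM2l// indicE; have [sJ|sJ] := boolP (s \in J).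
    by rewrite mulr1; apply: Gs; exact: set_mem.
  by rewrite mulr0 mulr_ge0 ?heat_kernel_ge0// invr_ge0 mulr_ge0// ltW.
have iU : mu.-integrable `[t, +oo[ (EFin \o U).
  exact: (integrableZl (mI _) _ (integrable_parabolic q0 (ltW r0) t0)).
have mJ : measurable (J : set (measurableTypeR R)) by exact: mI.
have JV : (mu J = r%:E)%E.
  rewrite /J lebesgue_measure_itv/= lte_fin ltr_pMl// ltr1n -EFinD.
  by congr EFin; ring.
have JI : J `&` [set` `[t, +oo[] = J.
  apply/setIidPl => s; rewrite /J/= !in_itv/= andbT => /andP[rs _].
  exact: le_trans rs.
have iJ : mu.-integrable `[t, +oo[ (EFin \o (\1_J : R -> R)).
  apply/integrableP; split; first by apply/measurable_EFinP/measurable_funTS/measurable_indic.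
  under eq_integral do rewrite /= ger0_norm ?indicE ?ler0n//.
  under eq_integral do rewrite -indicE.
  by rewrite integral_indic// JI /= JV ltry.
have iV : mu.-integrable `[t, +oo[ (EFin \o V).
  exact: (integrableZl (mI _) (A * b) iJ).
have ih i j : mu.-integrable `[t, +oo[
    (EFin \o (fun s => m ord0 i * m ord0 j * heat_hess s i j x)).
  exact: (integrableZl (mI _) (m ord0 i * m ord0 j) (integrable_heat_hess n0 i j x t0)).
have ihi i : mu.-integrable `[t, +oo[
    (EFin \o (fun s => \sum_j m ord0 i * m ord0 j * heat_hess s i j x)).
  by apply: integrable_Rsum => //; exact: mI.
have ihh : mu.-integrable `[t, +oo[ (EFin \o h) by apply: integrable_Rsum => //; exact: mI.
have intU : \int[mu]_(s in `[t, +oo[) U s <= c0 / 4 * A * P.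
  rewrite RintegralZl//; last exact: (integrable_parabolic q0 (ltW r0) t0).
  rewrite /Rintegral integral_powR_shift ?addr_gt0//=.
  apply: (@le_trans _ _ (c0 * q / C2 * (r * A) / 4 * C2 * (q^-1 * (P / r)))).
    apply: ler_wpM2l.
      apply: mulr_ge0 (ltW C20); apply: divr_ge0 => //.
      apply: mulr_ge0 (mulr_ge0 (ltW r0) A0).
      exact: divr_ge0 (ltW (mulr_gt0 c00 q0)) (ltW C20).
    by rewrite ler_wpM2l ?invr_ge0 ?(ltW q0)// -rq WX// ltW.
  by rewrite le_eqVlt; apply/orP; left; apply/eqP; field; rewrite !gt_eqF.
have intV : \int[mu]_(s in `[t, +oo[) V s = A * c0 * P.
  rewrite RintegralZl// /Rintegral integral_indic// JI /= JV/= bE; field.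
  by rewrite gt_eqF.
have -> : \sum_i \sum_j m ord0 i * m ord0 j * stokes_kernel t i j x =
    A * heat_kernel t x + \int[mu]_(s in `[t, +oo[) h s.
  rewrite Rintegral_sum//; under [X in _ + X]eq_bigr do rewrite Rintegral_sum//.
  rewrite /A {1}/edot mulr_suml -big_split; apply: eq_bigr => i _ /=.
  under eq_bigr do rewrite stokes_kernelE// mulrDr.
  rewrite big_split/=; congr (_ + _); last first.
    by apply: eq_bigr => j _; rewrite RintegralZl//; exact: integrable_heat_hess.
  rewrite (bigD1 i)//= eqxx mul1r big1 ?addr0// => j.
  by rewrite eq_sym => /negbTE ->; rewrite mul0r mulr0.
have : \int[mu]_(s in `[t, +oo[) h s <= c0 / 4 * A * P - A * c0 * P.
  apply: (@le_trans _ _ (\int[mu]_(s in `[t, +oo[) (U s - V s))).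
    apply: le_Rintegral => //.
      exact: (integrableB (mI _) iU iV).
    by move=> s; rewrite /= in_itv/= andbT; exact: hUV.
  by rewrite RintegralB// intV lerD2r.
have := ler_wpM2l A0 Gt; move: (\int[mu]_(s in _) _) (A * heat_kernel t x) => w u.
by clearbody A P c0; clear -A P c0; lra.
Qed.

End kernel_sign.

(** * Far-field asymptotics of the solution *)

Section kernel_mass.
Context {R : realType} {n : nat}.
Hypothesis n0 : (0 < n)%N.
Notation mu := (@lebesgue_measure R).

Let mI (i : interval R) : measurable ([set` i] : set (measurableTypeR R)).
Proof. exact: measurable_itv. Qed.

Lemma measurable_power_kernel (q a : R) (x : 'rV[R]_n) :
  measurable_fun setT (fun y : 'rV[R]_n => (enorm (x - y) ^+ 2 + a) `^ q).
Proof.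
apply: measurable_fun_powRl; apply: measurable_funD => //.
by apply: measurable_funX; apply: measurable_fun_enorm; exact: measurable_fun_rVB.
Qed.

Lemma Rintegral_power_kernel (b : R) : 0 < b -> exists2 C : R, 0 < C &
  forall (a : R) (x : 'rV[R]_n), 0 < a ->
  (lebesgue_rV n).-integrable setT
    (fun y => ((enorm (x - y) ^+ 2 + a) `^ (- ((n%:R + b) / 2)))%:E) /\
  \int[lebesgue_rV n]_y ((enorm (x - y) ^+ 2 + a) `^ (- ((n%:R + b) / 2))) <=
    C * a `^ (- (b / 2)).
Proof.
move=> b0; have [C C0 hC] := @integral_enorm_powR_le R n b n0 b0.
exists C => // a x a0; have h := hC a x a0.
have i : (lebesgue_rV n).-integrable setT
    (fun y => ((enorm (x - y) ^+ 2 + a) `^ (- ((n%:R + b) / 2)))%:E).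
  apply/integrableP; split; first by apply/measurable_EFinP; exact: measurable_power_kernel.
  under eq_integral do rewrite gee0_abs ?lee_fin ?powR_ge0//.
  by rewrite (le_lt_trans h) ?ltry.
by split=> //; rewrite -lee_fin fineK//; exact: integrable_fin_num.
Qed.

Lemma Rintegral_inv_sqrt_shift (t : R) : 0 < t ->
  mu.-integrable `]0, t[ (fun s => ((1 + s) `^ (- 2^-1))%:E) /\
  \int[mu]_(s in `]0, t[) ((1 + s) `^ (- 2^-1)) <= 2 * (1 + t) `^ 2^-1.
Proof.
move=> t0; have h := integral_inv_sqrt_shift_le t0.
have i : mu.-integrable `]0, t[ (fun s => ((1 + s) `^ (- 2^-1))%:E).
  apply/integrableP; split.
    apply/measurable_EFinP/measurable_funTS/measurable_fun_powRl.
    exact: measurable_funD.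
  under eq_integral do rewrite gee0_abs ?lee_fin ?powR_ge0//.
  by rewrite (le_lt_trans h) ?ltry.
by split=> //; rewrite -lee_fin fineK//; apply: integrable_fin_num => //; exact: mI.
Qed.

Lemma Rintegral_inv_sqrt_sub (t : R) : 0 < t ->
  mu.-integrable `]0, t[ (fun s => ((t - s) `^ (- 2^-1))%:E) /\
  \int[mu]_(s in `]0, t[) ((t - s) `^ (- 2^-1)) <= 2 * t `^ 2^-1.
Proof.
move=> t0; have h := integral_inv_sqrt_sub_le t0.
have i : mu.-integrable `]0, t[ (fun s => ((t - s) `^ (- 2^-1))%:E).
  apply/integrableP; split.
    apply/measurable_EFinP/measurable_funTS/measurable_fun_powRl.
    exact: measurable_funB.
  under eq_integral do rewrite gee0_abs ?lee_fin ?powR_ge0//.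
  by rewrite (le_lt_trans h) ?ltry.
by split=> //; rewrite -lee_fin fineK//; apply: integrable_fin_num => //; exact: mI.
Qed.

End kernel_mass.

(** Serves the splittings at [|y| = |x|/2]: at each point one of two nonnegative majorants applies
    and the other is added for free, so the domain of integration is never cut. *)
Lemma normr_Rintegral_le_add d (T : measurableType d) (R : realType)
    (mu : {measure set T -> \bar R}) (D : set T) (f g h : T -> R) (a b : R) :
  measurable D ->
  mu.-integrable D (EFin \o g) -> mu.-integrable D (EFin \o h) ->
  {ae mu, forall x, D x -> `|f x| <= a * g x + b * h x} ->
  `|\int[mu]_(x in D) f x| <=
    a * \int[mu]_(x in D) g x + b * \int[mu]_(x in D) h x.
Proof.
move=> mD ig ih fgh.
have ig' : mu.-integrable D (EFin \o (fun x => a * g x)) := integrableZl mD a ig.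
have ih' : mu.-integrable D (EFin \o (fun x => b * h x)) := integrableZl mD b ih.
rewrite -(RintegralZl _ mD ig) -(RintegralZl _ mD ih) -(RintegralD mD ig' ih').
by apply: normr_Rintegral_le_ae => //; exact: (integrableD mD ig' ih').
Qed.

(** * The heat term in the far field *)

Section far_field.
Context {R : realType} {n : nat}.
Hypothesis n0 : (0 < n)%N.
Notation mu := (@lebesgue_measure R).
Implicit Types (x y : 'rV[R]_n) (a : 'rV[R]_n -> 'rV[R]_n).

Lemma far_enorm x y : 2 * enorm y <= enorm x -> enorm x ^+ 2 / 4 <= enorm (x - y) ^+ 2.
Proof.
move=> yx; have h1 := enorm_le_add x y.
have h2 : enorm x / 2 <= enorm (x - y) by lra.
have : (enorm x / 2) ^+ 2 <= enorm (x - y) ^+ 2.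
  by apply: lerXn2r; rewrite ?nnegrE ?divr_ge0 ?enorm_ge0.
by rewrite expr_div_n (_ : 2 ^+ 2 = 4 :> R)//; ring.
Qed.

Lemma powR_quarter (r q : R) : 0 <= r -> (r / 4) `^ (- q) = 4 `^ q * r `^ (- q).
Proof.
move=> r0; rewrite powRM ?invr_ge0// mulrC; congr (_ * _).
by rewrite -powR_inv1// -powRrM mulN1r opprK.
Qed.

Lemma far_field_oP a : far_field_o a -> forall e : R, 0 < e -> exists r : R,
  {ae lebesgue_rV n, forall y, r <= enorm y -> enorm y ^+ n * enorm (a y) <= e}.
Proof.
move=> ha e e0.
have : \forall r \near +oo, (ess_sup (lebesgue_rV n)
    (fun x => (\1_[set y | r <= enorm y] x * enorm x ^+ n * enorm (a x))%:E) < e%:E)%E.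
  apply: (ha [set z | (z < e%:E)%E]); apply: open_nbhs_nbhs; split => /=.
    exact: open_ereal_lt_ereal.
  by rewrite lte_fin.
move=> [A [_ hA]]; exists (A + 1).
have /ltW/ess_supP := hA (A + 1) ltac:(by rewrite ltrDl).
apply: filterS => y; rewrite lee_fin => + ry.
by rewrite indicE mem_set ?mul1r.
Qed.

Lemma heat_op_far a (K : R) : lmeasurable (lebesgue_rV n) setT a ->
  ('N[lebesgue_rV n]_1 [(fun x => (enorm (a x))%:E)] < K%:E)%E ->
  far_field_o a -> forall e : R, 0 < e -> exists M r : R, [/\ 0 < M, 0 < r &
  forall t x j, 0 < t -> r <= enorm x ^+ 2 -> M * t <= enorm x ^+ 2 ->
    `|heat_op t a x ord0 j| <= e * (enorm x ^+ 2) `^ (- (n%:R / 2))].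
Proof.
move=> [a' ma' aa'] aK ao e e0.
have [C1 C10 h1] := @heat_monomial_le R n n0 0 1.
have [C2 C20 h2] := @Rintegral_power_kernel R n n0 1 ltr01.
(* The bound [G_t <= C3 t^{1/2} W^{-(n+1)/2}] has a majorant of finite mass; its mass [C2 t^{-1/2}]
   cancels the factor [t^{1/2}]. *)
have [C3 C30 h3] := @heat_kernel_powR_le R n n0 2^-1 ltac:(by rewrite invr_ge0).
(* Tuned so that the part with [|y| > |x|/2] contributes at most [e/2] times [|x|^{-n}]; [4^{n/2}]
   accounts for passing from [|y|] to [|x|/2]. *)
pose e1 : R := e / (2 * 4 `^ (n%:R / 2) * C3 * C2).
have e10 : 0 < e1 by rewrite divr_gt0// !mulr_gt0// powR_gt0.
have e1E : e1 = e / (2 * 4 `^ (n%:R / 2) * C3 * C2) by [].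
clearbody e1.
have [r1 hr1] := far_field_oP ao e10.
have ia : (lebesgue_rV n).-integrable setT (fun y => (enorm (a' y))%:E).
  apply/integrableP; split; first by apply/measurable_EFinP; exact: measurable_fun_enorm.
  move: aK; rewrite Lnorm1 => aK; rewrite (_ : integral _ _ _ = \int[lebesgue_rV n]_x `|(enorm (a x))%:E|)%E.
    by rewrite (lt_trans aK) ?ltry.
  apply: eq_integral_ae; apply: filterS aa' => y /(_ Logic.I) ->.
  by [].
set L := \int[lebesgue_rV n]_y enorm (a' y).
have L0 : 0 <= L by apply: Rintegral_ge0 => y _; exact: enorm_ge0.
pose q : R := n%:R / 2 + 1.
(* Makes the part with [|y| <= |x|/2], namely [C1 4^q L t / |x|^2] times [|x|^{-n}], at most [e/2]
   of [|x|^{-n}]; the final 1 keeps [M] positive. *)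
pose M := 2 * (C1 * 4 `^ q * L) / e + 1.
have CL0 : 0 <= C1 * 4 `^ q * L by rewrite !mulr_ge0 ?powR_ge0// ltW.
have M0 : 0 < M by rewrite /M ltr_wpDl// divr_ge0 ?(ltW e0)// mulr_ge0.
(* The threshold forces [|x| >= 2 r1], so [|y| > |x|/2] lies where the smallness of the datum is
   available; adding 1 keeps [|x|] nonzero. *)
exists M, ((2 * r1) ^+ 2 + 1); split=> //; first by rewrite ltr_wpDl ?sqr_ge0.
move=> t x j t0 rx Mt.
set r := enorm x ^+ 2 in rx Mt *.
have r0 : 0 < r by apply: lt_le_trans rx; rewrite ltr_wpDl ?sqr_ge0.
have rq : r `^ (- q) = r `^ (- (n%:R / 2)) / r.
  rewrite /q opprD powRD; last by rewrite (gt_eqF r0) implybT.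
  by rewrite powR_inv1 ?(ltW r0).
set P := r `^ (- (n%:R / 2)) in rq *; have P0 : 0 < P by exact: powR_gt0.
have x2r : 2 * r1 <= enorm x.
  rewrite leNgt; apply/negP => xr; have := enorm_ge0 x => x0.
  have : r < (2 * r1) ^+ 2 by apply: ltrXn2r; rewrite ?nnegrE//; lra.
  by move: rx; lra.
have [iP hP] := h2 t x t0.
rewrite mxE /convolution.
apply: (@le_trans _ _ (C1 * t * (4 `^ q * r `^ (- q)) * L +
    e1 * (4 `^ (n%:R / 2) * P) * C3 * t `^ 2^-1 *
     \int[lebesgue_rV n]_y ((enorm (x - y) ^+ 2 + t) `^ (- ((n%:R + 1) / 2))))).
  apply: normr_Rintegral_le_add => //.
  apply: filterS2 hr1 aa' => y hy /(_ Logic.I) ay _.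
  rewrite normrM ger0_norm ?heat_kernel_ge0//.
  have aj := coord_le_enorm (a y) j.
  have [yx|yx] := leP (2 * enorm y) (enorm x).
    apply: ler_wpDr.
      by rewrite !mulr_ge0 ?powR_ge0 ?(ltW e10) ?(ltW C30) ?(ltW P0).
    rewrite -ay; apply: ler_pM => //; first exact: heat_kernel_ge0.
    have := h1 t (x - y) t0; rewrite expr0 expr1 mul1r mulrC ler_pdivrMr//.
    have -> : - ((n%:R + 2 * 1%:R - 0%:R) / 2) = - q :> R by rewrite /q; field.
    move=> h; apply: (le_trans h); rewrite -mulrA [t * _]mulrC mulrA ler_wpM2r ?(ltW t0)//.
    rewrite ler_wpM2l ?(ltW C10)// -powR_quarter ?(ltW r0)//.
    apply: le_powRN; [by rewrite addr_ge0// divr_ge0|by rewrite divr_gt0|].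
    by apply: (le_trans (far_enorm yx)); rewrite lerDl ltW.
  apply: ler_wpDl.
    by rewrite !mulr_ge0 ?powR_ge0 ?(ltW C10) ?(ltW t0) ?enorm_ge0.
  have y0 : 0 < enorm y by have := enorm_ge0 x; lra.
  have ry : r1 <= enorm y by lra.
  have ya : enorm (a y) <= e1 * (4 `^ (n%:R / 2) * P).
    have := hy ry; rewrite mulrC -ler_pdivlMr ?exprn_gt0// => h.
    apply: (le_trans h); rewrite ler_wpM2l ?(ltW e10)//.
    rewrite -powR_invn ?(ltW y0)// (_ : - n%:R = 2%:R * - (n%:R / 2)); last by field.
    rewrite powRrM powR_mulrn ?(ltW y0)// -powR_quarter ?(ltW r0)//.
    apply: le_powRN; [by rewrite divr_ge0|by rewrite divr_gt0|].
    have h2y : enorm x / 2 <= enorm y by lra.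
    have : (enorm x / 2) ^+ 2 <= enorm y ^+ 2.
      by apply: lerXn2r; rewrite ?nnegrE ?divr_ge0 ?enorm_ge0.
    by rewrite expr_div_n (_ : 2 ^+ 2 = 4 :> R)//; ring.
  rewrite [leLHS]mulrC.
  rewrite [leRHS](_ : _ = (e1 * (4 `^ (n%:R / 2) * P)) *
    (C3 * t `^ 2^-1 * (enorm (x - y) ^+ 2 + t) `^ (- ((n%:R + 1) / 2)))); last by ring.
  apply: ler_pM; rewrite ?normr_ge0 ?heat_kernel_ge0//.
    exact: le_trans aj ya.
  have := h3 t (x - y) t0.
  rewrite powRN mulrC ler_pdivrMr ?powR_gt0// mulrAC.
  by rewrite (_ : 2^-1 + n%:R / 2 = (n%:R + 1) / 2)//; field.
have -> : e * P = e / 2 * P + e / 2 * P by field.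
apply: lerD.
  rewrite rq (_ : _ * _ * _ = (C1 * 4 `^ q * L) * (t / r) * P); last by ring.
  rewrite ler_wpM2r ?(ltW P0)// mulrA ler_pdivrMr//.
  apply: (@le_trans _ _ (e / 2 * (M * t))); last by rewrite ler_wpM2l ?divr_ge0 ?(ltW e0).
  rewrite mulrA ler_wpM2r ?(ltW t0)// /M mulrDr.
  rewrite (_ : e / 2 * (2 * _ / e) = C1 * 4 `^ q * L); last by field; rewrite gt_eqF.
  by rewrite lerDl mulr_ge0 ?divr_ge0 ?(ltW e0).
apply: (@le_trans _ _ (e1 * (4 `^ (n%:R / 2) * P) * C3 * t `^ 2^-1 * (C2 * t `^ (- (1 / 2))))).
  by rewrite ler_wpM2l ?mulr_ge0 ?powR_ge0 ?(ltW e10) ?(ltW C30) ?(ltW P0).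
have tt : t `^ 2^-1 * t `^ (- (1 / 2)) = 1.
  by rewrite mul1r powRN mulfV// gt_eqF ?powR_gt0.
have f0 : 4 `^ (n%:R / 2) != 0 :> R by rewrite gt_eqF ?powR_gt0.
rewrite (_ : _ * _ = e1 * (4 `^ (n%:R / 2) * P) * C3 * C2 * (t `^ 2^-1 * t `^ (- (1 / 2)))); last by ring.
rewrite tt mulr1 e1E le_eqVlt; apply/orP; left; apply/eqP; field.
by rewrite f0 !gt_eqF.
Qed.

End far_field.

(** * The nonlinear term in the far field *)

Section nonlinear_term.
Context {R : realType} {n : nat}.
Hypothesis n0 : (0 < n)%N.
Notation mu := (@lebesgue_measure R).
Implicit Types (x y : 'rV[R]_n) (u : 'rV[R]_n -> R -> 'rV[R]_n).

Let mI (i : interval R) : measurable ([set` i] : set (measurableTypeR R)).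
Proof. exact: measurable_itv. Qed.

(** Splitting at [|y| = |x|/2]: in the inner region the kernel derivative is [O(|x|^{-n-1})] and the
    space integral of [|u(s)|^2] is [O((1+s)^{-1/2})]; in the outer one [|u|^2] is [O(|x|^{-2n})]
    and the kernel derivative has mass [O((t-s)^{-1/2})]. Either time integral is
    [O((1+t)^{1/2})]. *)
Lemma duhamel_stokes_div_far u (C0 : R) : 0 <= C0 ->
  (forall x t, 0 < t ->
     enorm (u x t) <= C0 * (enorm x ^+ 2 + (1 + t)) `^ (- (n%:R / 2))) ->
  exists2 C : R, 0 <= C & forall t x j, 1 <= t -> t <= enorm x ^+ 2 ->
    `|duhamel stokes_div_op u x t ord0 j| <=
    C * ((1 + t) `^ 2^-1 * (enorm x ^+ 2) `^ (- 2^-1)) *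
      (enorm x ^+ 2) `^ (- (n%:R / 2)).
Proof.
move=> C00 hu; have nR : 0 < n%:R :> R by rewrite ltr0n.
have n1 : 1 <= n%:R :> R by rewrite ler1n.
have [C4 C40 h4] := @partial_stokes_kernel_le R n n0.
have [C1 C10 h1] := @Rintegral_power_kernel R n n0 1 ltr01.
have [Cn Cn0 hn] := @Rintegral_power_kernel R n n0 n%:R nR.
pose q : R := (n%:R + 1) / 2.
exists (n%:R * n%:R * (C4 * C0 ^+ 2 * (2 * (4 `^ q * Cn + 4 `^ n%:R * C1)))).
  by rewrite !mulr_ge0 ?addr_ge0 ?mulr_ge0 ?powR_ge0 ?(ltW C40) ?(ltW Cn0) ?(ltW C10).
move=> t x j t1 tx; have t0 : 0 < t by exact: lt_le_trans t1.
set r := enorm x ^+ 2 in tx *; have r1 : 1 <= r by exact: le_trans tx.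
have r0 : 0 < r by exact: lt_le_trans r1.
have rE : r = enorm x ^+ 2 by [].
clearbody r.
set P := r `^ (- (n%:R / 2)); have P0 : 0 <= P by exact: powR_ge0.
have rq : r `^ (- q) = P * r `^ (- 2^-1).
  rewrite /P -powRD; last by rewrite (gt_eqF r0) implybT.
  by congr (_ `^ _); rewrite /q; field.
(* Quadratic decay [|x|^{-2n}] is at least as good as [|x|^{-n-1}], since [n >= 1] and
   [|x| >= 1]. *)
have rn : r `^ (- n%:R) <= P * r `^ (- 2^-1).
  rewrite /P -powRD; last by rewrite (gt_eqF r0) implybT.
  by apply: ler_powR => //; lra.
pose A : R := C4 * C0 ^+ 2 * (4 `^ q * r `^ (- q)).
pose B : R := C4 * C0 ^+ 2 * (4 `^ n%:R * r `^ (- n%:R)).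
have K0 : 0 <= C4 * C0 ^+ 2 by rewrite mulr_ge0 ?sqr_ge0// ltW.
have A0 : 0 <= A by rewrite mulr_ge0// mulr_ge0 ?powR_ge0.
have B0 : 0 <= B by rewrite mulr_ge0// mulr_ge0 ?powR_ge0.
have AE : A = C4 * C0 ^+ 2 * (4 `^ q * r `^ (- q)) by [].
have BE : B = C4 * C0 ^+ 2 * (4 `^ n%:R * r `^ (- n%:R)) by [].
clearbody A B.
have inner s h k : 0 < s -> s < t ->
    `|convolution (partial h (stokes_kernel (t - s) j k))
       (fun y => u y s ord0 h * u y s ord0 k) x| <=
    A * Cn * (1 + s) `^ (- 2^-1) + B * C1 * (t - s) `^ (- 2^-1).
  move=> s0 st; have ts : 0 < t - s by rewrite subr_gt0.
  have s1 : 0 < 1 + s by rewrite addr_gt0.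
  have [iP hP] := h1 (t - s) x ts.
  have [iN hN] := hn (1 + s) 0 s1.
  rewrite /convolution.
  apply: (@le_trans _ _ (A * \int[lebesgue_rV n]_y
      ((enorm (0 - y) ^+ 2 + (1 + s)) `^ (- ((n%:R + n%:R) / 2))) +
     B * \int[lebesgue_rV n]_y
      ((enorm (x - y) ^+ 2 + (t - s)) `^ (- ((n%:R + 1) / 2))))).
    apply: normr_Rintegral_le_add => //; apply: aeW => y _.
    rewrite sub0r enormN normrM.
    set Y := enorm y ^+ 2 + (1 + s).
    have Y0 : 0 < Y by rewrite /Y ltr_wpDl// sqr_ge0.
    have uu : `|u y s ord0 h * u y s ord0 k| <= C0 ^+ 2 * Y `^ (- ((n%:R + n%:R) / 2)).
      apply: (@le_trans _ _ (enorm (u y s) ^+ 2)); first exact: coord_mul_le_enorm.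
      apply: (@le_trans _ _ ((C0 * Y `^ (- (n%:R / 2))) ^+ 2)).
        by apply: lerXn2r; rewrite ?nnegrE ?mulr_ge0 ?powR_ge0 ?enorm_ge0// hu.
      rewrite exprMn -(powR_mulrn 2 (powR_ge0 Y _)) -powRrM.
      by rewrite (_ : - (n%:R / 2) * 2%:R = - ((n%:R + n%:R) / 2))//; field.
    have dK := h4 (t - s) h j k (x - y) ts.
    have [yx|yx] := leP (2 * enorm y) (enorm x).
      apply: ler_wpDr; first by rewrite mulr_ge0// powR_ge0.
      rewrite AE [leRHS](_ : _ = (C4 * (4 `^ q * r `^ (- q))) *
        (C0 ^+ 2 * Y `^ (- ((n%:R + n%:R) / 2)))); last by ring.
      apply: ler_pM => //; apply: (le_trans dK).
      rewrite ler_wpM2l ?(ltW C40)// -powR_quarter ?(ltW r0)//.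
      apply: le_powRN; [by rewrite divr_ge0// addr_ge0|by rewrite divr_gt0|].
      by rewrite rE; apply: (le_trans (far_enorm yx)); rewrite lerDl ltW.
    apply: ler_wpDl; first by rewrite mulr_ge0// powR_ge0.
    rewrite BE [leRHS](_ : _ = (C4 * (enorm (x - y) ^+ 2 + (t - s)) `^ (- ((n%:R + 1) / 2))) *
      (C0 ^+ 2 * (4 `^ n%:R * r `^ (- n%:R)))); last by ring.
    apply: ler_pM => //; apply: (le_trans uu).
    rewrite ler_wpM2l ?sqr_ge0// -powR_quarter ?(ltW r0)//.
    rewrite (_ : (n%:R + n%:R) / 2 = n%:R); last by field.
    apply: le_powRN; [exact: ltW|by rewrite divr_gt0|].
    have h2y : enorm x / 2 <= enorm y by lra.
    have : (enorm x / 2) ^+ 2 <= enorm y ^+ 2.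
      by apply: lerXn2r; rewrite ?nnegrE ?divr_ge0 ?enorm_ge0.
    rewrite expr_div_n -rE /Y (_ : 2 ^+ 2 = 4 :> R); last by ring.
    by move=> h'; apply: (le_trans h'); rewrite lerDl ltW.
  rewrite -!mulrA; apply: lerD; rewrite ler_wpM2l//.
    apply: (le_trans hN); rewrite ler_wpM2l ?(ltW Cn0)//.
    apply: ler_powR; first by rewrite lerDl ltW.
    by rewrite lerN2; lra.
  by move: hP; rewrite mul1r.
have [iS hS] := Rintegral_inv_sqrt_shift t0.
have [iT hT] := Rintegral_inv_sqrt_sub t0.
rewrite mxE.
apply: (@le_trans _ _ ((n%:R * n%:R * (A * Cn)) * \int[mu]_(s in `]0, t[) ((1 + s) `^ (- 2^-1)) +
   (n%:R * n%:R * (B * C1)) * \int[mu]_(s in `]0, t[) ((t - s) `^ (- 2^-1)))).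
  apply: normr_Rintegral_le_add; [exact: mI|exact: iS|exact: iT|].
  apply: aeW => s; rewrite /= in_itv/= => /andP[s0 st].
  rewrite mxE.
  apply: (@le_trans _ _ (\sum_(h < n) \sum_(k < n)
     (A * Cn * (1 + s) `^ (- 2^-1) + B * C1 * (t - s) `^ (- 2^-1)))).
    apply: (le_trans (ler_norm_sum _ _ _)); apply: ler_sum => h _.
    apply: (le_trans (ler_norm_sum _ _ _)); apply: ler_sum => k _.
    exact: inner.
  rewrite !sumr_const !card_ord -mulrnA -[leLHS]mulr_natl natrM.
  by rewrite le_eqVlt; apply/orP; left; apply/eqP; ring.
have nn0 : 0 <= n%:R * n%:R :> R by rewrite mulr_ge0.
apply: (@le_trans _ _ (n%:R * n%:R * (A * Cn * (2 * (1 + t) `^ 2^-1) + B * C1 * (2 * (1 + t) `^ 2^-1)))).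
  rewrite mulrDr; apply: lerD; rewrite -mulrA ler_wpM2l// ler_wpM2l ?mulr_ge0 ?(ltW Cn0) ?(ltW C10)//.
  apply: (le_trans hT); rewrite ler_wpM2l//.
  by apply: ge0_ler_powR; rewrite ?nnegrE ?(ltW t0) ?addr_ge0 ?lerDr ?(ltW t0)// lerDr.
rewrite [leRHS](_ : _ = n%:R * n%:R * ((C4 * C0 ^+ 2 * (4 `^ q * (P * r `^ (- 2^-1)))) * Cn *
   (2 * (1 + t) `^ 2^-1) + (C4 * C0 ^+ 2 * (4 `^ n%:R * (P * r `^ (- 2^-1)))) * C1 *
   (2 * (1 + t) `^ 2^-1))); last by ring.
rewrite ler_wpM2l// AE BE rq lerD2l.
rewrite ler_wpM2r ?mulr_ge0 ?powR_ge0// ler_wpM2r ?(ltW C10)//.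
by rewrite ler_wpM2l// ler_wpM2l ?powR_ge0.
Qed.

End nonlinear_term.

(** * The force term in the far field *)

Section slices.
Context d1 d2 (T1 : measurableType d1) (T2 : measurableType d2) (R : realType).
Variables (m1 : {sigma_finite_measure set T1 -> \bar R})
  (m2 : {sigma_finite_measure set T2 -> \bar R}).

(** The measure of an exceptional set is the integral of the measures of its slices, so almost every
    slice is null. This transfers the joint bounds on the force to fixed times, where the space
    integrals are taken. *)
Lemma ae_prod_slice (Q : T1 * T2 -> Prop) :
  {ae (m1 \x m2)%E, forall z, Q z} ->
  {ae m2, forall s, {ae m1, forall y, Q (y, s)}}.
Proof.
move=> [N [mN N0 QN]].
have N2 : (\int[m2]_s m1 (ysection N s) = 0)%E.
  have := @product_measure_unique _ _ _ _ R m1 m2 (m1 \x^ m2)%E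
    (fun A B => @product_measure2E _ _ _ _ _ m1 m2 A B) N mN.
  by rewrite N0 => /esym.
have mS : measurable_fun setT (fun s => m1 (ysection N s)).
  exact: measurable_fun_ysection.
have [_ /(_ _)] := ae_eq_integral_abs m2 measurableT mS.
have : (\int[m2]_s `|m1 (ysection N s)| = 0)%E.
  by under eq_integral do rewrite gee0_abs//.
move=> /(ae_eq_integral_abs m2 measurableT mS) => + _.
apply: filterS => s /(_ Logic.I) /= Ns.
exists (ysection N s); split => //; first exact: measurable_ysection.
by move=> y /= nQ; rewrite /ysection/= inE; apply: QN.
Qed.

End slices.

Section time_limit.
Context {R : realType}.
Notation mu := (@lebesgue_measure R).

Lemma cvg_Rintegral_oo (f : R -> R) : mu.-integrable setT (EFin \o f) ->
  \int[mu]_(s in `]0, t[) f s @[t --> +oo] --> \int[mu]_(s in `[0, +oo[) f s.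
Proof.
move=> fi.
have mI (i : interval R) : measurable ([set` i] : set (measurableTypeR R)).
  exact: measurable_itv.
have mf : measurable_fun setT (EFin \o f) := measurable_int _ fi.
have fS (D : set (measurableTypeR R)) : measurable D -> mu.-integrable D (EFin \o f).
  by move=> mD; apply: integrableS fi.
rewrite -Rintegral_itv_obnd_cbnd; last exact: fS.
(* Convergence at infinity is tested along sequences, for which dominated convergence is
   available. *)
apply/cvg_pinftyP => u uy; apply: fine_cvg.
rewrite fineK; last by apply: integrable_fin_num => //; exact: fS.
rewrite integral_mkcond; under eq_fun do rewrite integral_mkcond.
apply: (@dominated_cvg _ _ _ mu setT measurableT _ _ (abse \o (EFin \o f))) => //.
- by move=> k; apply/(measurable_restrictT _ (mI _)); exact: measurable_funTS.
- move=> x _; apply: cvg_near_cst; near=> k.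
  rewrite !patchE /=; have [x0|x0] := ltP 0 x; last first.
    by rewrite !memNset//= in_itv/= ltNge x0.
  rewrite !mem_set//= in_itv/= x0//=.
  by near: k; move/cvgryPgt : uy; apply.
- exact: integrable_abse.
- move=> k x _; rewrite patchE; case: ifPn => // _ /=.
  by rewrite normr0 lee_fin.
Unshelve. all: by end_near. Qed.

End time_limit.

Section kernel_difference.
Context {R : realType} {n : nat}.
Hypothesis n0 : (0 < n)%N.
Implicit Types (x y : 'rV[R]_n).

(** Here [g] stands for the size of the force at [y]. If [|y| <= |x|/2], the time and space
    increments of the kernel give the first two terms. If both [|y|] and [|x - y|] are comparable to
    or exceed [|x|], each kernel value is [O(|x|^{-n})], and [1 <= 2|y|/|x|] converts this to the
    second term. Near [y = x] the kernel may be large: there the decay of [g] pays for the half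
    power that turns [W^{-n/2}] into the integrable [W^{-(n+1)/2}]. *)
Lemma stokes_kernel_diff_le : exists2 C : R, 0 < C &
  forall t tau x y j k (e g : R), 0 < tau -> tau <= t -> x != 0 ->
  t <= enorm x ^+ 2 -> 0 <= e -> 0 <= g -> g <= e * (1 + enorm y) ^- (n + 2) ->
  `|stokes_kernel tau j k (x - y) - stokes_kernel t j k x| * g <=
    C * (t * (enorm x ^+ 2) `^ (- (n%:R / 2) - 1)) * g +
    C * (enorm x ^+ 2) `^ (- ((n%:R + 1) / 2)) * (enorm y * g) +
    C * e * (enorm x ^+ 2) `^ (- ((n%:R + 1) / 2)) *
      (enorm (x - y) ^+ 2 + tau) `^ (- ((n%:R + 1) / 2)).
Proof.
have nR : 0 < n%:R :> R by rewrite ltr0n.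
have [C5 C50 h5] := @stokes_kernel_space_le R n n0.
have [C6 C60 h6] := @stokes_kernel_time_le R n n0.
have [C7 C70 h7] := @stokes_kernel_le R n n0.
pose F : R := 4 `^ (n%:R / 2); have F0 : 0 < F by exact: powR_gt0.
pose S : R := 2 `^ 2^-1 * 4 `^ ((n%:R + 2) / 2).
have S0 : 0 < S by rewrite mulr_gt0 ?powR_gt0.
have [FE SE] : F = 4 `^ (n%:R / 2) /\ S = 2 `^ 2^-1 * 4 `^ ((n%:R + 2) / 2) by [].
clearbody F S.
exists (C6 + (C5 + 2 * C7 + 2 * C7 * F) + C7 * S).
  by rewrite !addr_gt0 ?mulr_gt0.
move=> t tau x y j k e g tau0 taut x0 tx e0 g0 ge.
have t0 := lt_le_trans tau0 taut.
have ex0 : 0 < enorm x by rewrite enorm_gt0.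
have rE : enorm x = (enorm x ^+ 2) `^ 2^-1.
  by rewrite powR12_sqrt ?sqr_ge0// sqrtr_sqr ger0_norm ?enorm_ge0.
set r := enorm x ^+ 2 in tx rE *; have r0 : 0 < r by rewrite exprn_gt0.
have rEE : r = enorm x ^+ 2 by [].
clearbody r.
set Q := r `^ (- ((n%:R + 1) / 2)); have Q0 : 0 < Q by exact: powR_gt0.
have QE : r `^ (- (n%:R / 2)) = Q * enorm x.
  rewrite rE /Q -powRD; last by rewrite (gt_eqF r0) implybT.
  by congr (_ `^ _); field.
set T := t * _; have T0 : 0 <= T by rewrite mulr_ge0 ?powR_ge0 ?(ltW t0).
set W := enorm (x - y) ^+ 2 + tau; have W0 : 0 < W by rewrite /W ltr_wpDl ?sqr_ge0.
set V := W `^ (- ((n%:R + 1) / 2)); have V0 : 0 <= V by exact: powR_ge0.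
have y0 := enorm_ge0 y.
have C23 : 0 <= 2 * C7 + 2 * C7 * F by rewrite addr_ge0 ?mulr_ge0 ?(ltW C70) ?(ltW F0).
have C7S : 0 <= C7 * S by rewrite mulr_ge0 ?(ltW C70) ?(ltW S0).
have Tg : 0 <= T * g by rewrite mulr_ge0.
have Qyg : 0 <= Q * (enorm y * g) by rewrite mulr_ge0 ?(ltW Q0)// mulr_ge0.
have eQV : 0 <= e * Q * V by rewrite mulr_ge0// mulr_ge0// ltW.
have [yx|yx] := leP (2 * enorm y) (enorm x).
  have H5 := h5 tau j k x y tau0 x0 yx; have H6 := h6 tau t j k x tau0 taut x0.
  rewrite -rEE -/Q in H5; rewrite -rEE -mulrA -/T in H6.
  have H : `|stokes_kernel tau j k (x - y) - stokes_kernel t j k x| <=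
      C5 * enorm y * Q + C6 * T.
    by rewrite -(subrKA (stokes_kernel tau j k x)) (le_trans (ler_normD _ _))// lerD.
  apply: (le_trans (ler_wpM2r g0 H)).
  have p1 := mulr_ge0 (addr_ge0 (addr_ge0 (ltW C50) C23) C7S) Tg.
  have p2 := mulr_ge0 (addr_ge0 (addr_ge0 (ltW C60) C23) C7S) Qyg.
  have p3 := mulr_ge0 (addr_ge0 (addr_ge0 (addr_ge0 (ltW C50) C23) C7S) (ltW C60)) eQV.
  clear -p1 p2 p3; nra.
have kx : `|stokes_kernel t j k x| * g <= 2 * C7 * (Q * (enorm y * g)).
  rewrite [leRHS](_ : _ = C7 * (Q * (2 * enorm y)) * g); last by ring.
  rewrite ler_wpM2r//; apply: (le_trans (h7 t j k x t0)); rewrite ler_wpM2l ?(ltW C70)//.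
  rewrite -rEE; apply: (@le_trans _ _ (r `^ (- (n%:R / 2)))).
    by apply: le_powRN; rewrite ?divr_ge0// lerDl ltW.
  by rewrite QE ler_wpM2l ?(ltW Q0)// ltW.
have kxy : `|stokes_kernel tau j k (x - y)| * g <=
    2 * C7 * F * (Q * (enorm y * g)) + C7 * S * (e * Q * V).
  have H7 := h7 tau j k (x - y) tau0; rewrite -/W in H7.
  have [xy|xy] := leP (enorm x) (2 * enorm (x - y)).
    apply: ler_wpDr; first by rewrite mulr_ge0.
    rewrite [leRHS](_ : _ = C7 * (F * (Q * (2 * enorm y))) * g); last by ring.
    rewrite ler_wpM2r//; apply: (le_trans H7); rewrite ler_wpM2l ?(ltW C70)//.
    apply: (@le_trans _ _ ((r / 4) `^ (- (n%:R / 2)))).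
      apply: le_powRN; rewrite ?divr_ge0 ?divr_gt0//.
      have : (enorm x / 2) ^+ 2 <= enorm (x - y) ^+ 2.
        by apply: lerXn2r; rewrite ?nnegrE ?divr_ge0 ?enorm_ge0//; lra.
      rewrite expr_div_n -rEE /W (_ : 2 ^+ 2 = 4 :> R); last by ring.
      by move=> h; apply: (le_trans h); rewrite lerDl ltW.
    rewrite powR_quarter ?(ltW r0)// -FE ler_wpM2l ?(ltW F0)// QE.
    by rewrite ler_wpM2l ?(ltW Q0)// ltW.
  apply: ler_wpDl.
    by apply: mulr_ge0 Qyg; rewrite !mulr_ge0 ?(ltW C70) ?(ltW F0).
  have Wr : W <= 2 * r.
    have : enorm (x - y) ^+ 2 <= (enorm x / 2) ^+ 2.
      by apply: lerXn2r; rewrite ?nnegrE ?divr_ge0 ?enorm_ge0//; lra.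
    rewrite expr_div_n -rEE /W (_ : 2 ^+ 2 = 4 :> R); last by ring.
    by lra.
  have WV : W `^ (- (n%:R / 2)) <= V * (2 `^ 2^-1 * enorm x).
    rewrite (_ : W `^ (- (n%:R / 2)) = V * W `^ 2^-1); last first.
      rewrite /V -powRD; last by rewrite (gt_eqF W0) implybT.
      by congr (_ `^ _); field.
    rewrite ler_wpM2l// rE -powRM ?(ltW r0)//.
    by apply: ge0_ler_powR; rewrite ?nnegrE ?(ltW W0) ?mulr_ge0 ?(ltW r0).
  have gr : g <= e * (4 `^ ((n%:R + 2) / 2) * r `^ (- ((n%:R + 2) / 2))).
    apply: (le_trans ge); rewrite ler_wpM2l// -powR_quarter ?(ltW r0)//.
    have yp : 0 < enorm y by lra.
    apply: (@le_trans _ _ ((enorm y ^+ 2) `^ (- ((n%:R + 2) / 2)))).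
      rewrite -(powR_mulrn 2 y0) -powRrM.
      rewrite (_ : 2%:R * - ((n%:R + 2) / 2) = - (n + 2)%:R); last by rewrite natrD; field.
      rewrite powR_invn// lef_pV2 ?posrE ?exprn_gt0 ?addr_gt0//.
      by apply: lerXn2r; rewrite ?nnegrE ?addr_ge0// lerDr.
    apply: le_powRN; rewrite ?divr_ge0 ?addr_ge0 ?divr_gt0//.
    have : (enorm x / 2) ^+ 2 <= enorm y ^+ 2.
      by apply: lerXn2r; rewrite ?nnegrE ?divr_ge0 ?enorm_ge0//; lra.
    by rewrite expr_div_n -rEE (_ : 2 ^+ 2 = 4 :> R)//; ring.
  apply: (@le_trans _ _ (C7 * (V * (2 `^ 2^-1 * enorm x)) *
      (e * (4 `^ ((n%:R + 2) / 2) * r `^ (- ((n%:R + 2) / 2)))))).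
    apply: ler_pM => //; apply: (le_trans H7).
    by rewrite ler_wpM2l ?(ltW C70).
  have -> : Q = enorm x * r `^ (- ((n%:R + 2) / 2)).
    rewrite rE -powRD; last by rewrite (gt_eqF r0) implybT.
    by rewrite /Q; congr (_ `^ _); field.
  by rewrite SE le_eqVlt; apply/orP; left; apply/eqP; ring.
apply: (le_trans (ler_wpM2r g0 (ler_normB _ _))); rewrite mulrDl.
apply: (le_trans (lerD kxy kx)).
have p1 := mulr_ge0 (addr_ge0 (addr_ge0 (addr_ge0 (ltW C50) C23) C7S) (ltW C60)) Tg.
have p2 := mulr_ge0 (addr_ge0 (addr_ge0 (ltW C60) (ltW C50)) C7S) Qyg.
have p3 := mulr_ge0 (addr_ge0 (addr_ge0 (ltW C50) C23) (ltW C60)) eQV.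
clear -p1 p2 p3; nra.
Qed.

End kernel_difference.

Section slice_integral.
Context d1 d2 (T1 : measurableType d1) (T2 : measurableType d2) (R : realType).
Variables (m1 : {sigma_finite_measure set T1 -> \bar R})
  (m2 : {sigma_finite_measure set T2 -> \bar R}).

Lemma integrable_slice_Rintegral (g : T1 * T2 -> R) :
  (m1 \x m2)%E.-integrable setT (EFin \o g) ->
  m2.-integrable setT (fun s => (\int[m1]_y g (y, s))%:E).
Proof.
move=> gi; have mg : measurable_fun setT (EFin \o g) := measurable_int _ gi.
pose A s := (\int[m1]_y `|(g (y, s))%:E|)%E.
have A0 s : (0 <= A s)%E by exact: integral_ge0.
have mA : measurable_fun setT A.
  apply: (@measurable_fun_fubini_tonelli_G _ _ _ _ R m1 (abse \o (EFin \o g))).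
    exact: (measurableT_comp (@abse_measurable R setT) mg).
  by move=> z; exact: abse_ge0.
have Ai : m2.-integrable setT A.
  apply/integrableP; split=> //.
  rewrite (eq_integral A) => [|s _]; last by rewrite gee0_abs.
  exact: ((integrable21ltyP m1 m2 mg).1 gi).
apply: (le_integrable measurableT _ _ Ai).
  apply/measurable_EFinP.
  exact: (measurableT_comp (@fine_measurable R setT measurableT)
    (measurable_fubini_G gi)).
move=> s _; rewrite [leRHS]gee0_abs// /Rintegral /A.
apply: (@le_trans _ _ `|\int[m1]_y (g (y, s))%:E|%E).
  (* [fine] sends an infinite slice integral to 0, so the bound by the integral of the absolute
     value persists. *)
  by case: (integral _ _ _) => [r| |]//=; rewrite normr0 leey.
apply: le_abse_integral => //; exact: (measurableT_comp mg (pair2_measurable s)).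
Qed.

End slice_integral.

Section force_slice.
Context {R : realType} {n : nat}.
Hypothesis n0 : (0 < n)%N.
Implicit Types (x y : 'rV[R]_n) (v w : 'rV[R]_n -> 'rV[R]_n).

(** The pointwise comparison integrated over [y]. [v] is the slice that appears in the equation, [w]
    a Borel function equal to it almost everywhere, and all integrability is established on [w]; [N]
    bounds its first moment. *)
Lemma stokes_op_far : exists2 C : R, 0 < C &
  forall t tau x j v w (e N : R), 0 < tau -> tau <= t -> x != 0 ->
  t <= enorm x ^+ 2 -> 0 <= e ->
  measurable_fun setT w -> {ae lebesgue_rV n, forall y, v y = w y} ->
  {ae lebesgue_rV n, forall y, enorm (w y) <= e * (1 + enorm y) ^- (n + 2)} ->
  (lebesgue_rV n).-integrable setT (fun y => (enorm (w y))%:E) ->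
  (\int[lebesgue_rV n]_y (enorm y * enorm (w y))%:E <= N%:E)%E ->
  `|stokes_op tau v x ord0 j -
      \sum_k stokes_kernel t j k x * \int[lebesgue_rV n]_y w y ord0 k| <=
    C * (t * (enorm x ^+ 2) `^ (- (n%:R / 2) - 1)) *
      \int[lebesgue_rV n]_y enorm (w y) +
    C * (enorm x ^+ 2) `^ (- ((n%:R + 1) / 2)) * N +
    C * e * (enorm x ^+ 2) `^ (- ((n%:R + 1) / 2)) * tau `^ (- 2^-1).
Proof.
have nR : 0 < n%:R :> R by rewrite ltr0n.
have [C C0 hC] := @stokes_kernel_diff_le R n n0.
have [C1 C10 h1] := @Rintegral_power_kernel R n n0 1 ltr01.
exists (n%:R * (C + C * C1)); first by rewrite mulr_gt0// addr_gt0// mulr_gt0.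
move=> t tau x j v w e N tau0 taut x0 tx e0 mw vw wb iw wN.
have [iP hP] := h1 tau x tau0.
have iyw : (lebesgue_rV n).-integrable setT (fun y => (enorm y * enorm (w y))%:E).
  apply/integrableP; split.
    apply/measurable_EFinP; apply: measurable_funM; apply: measurable_fun_enorm => //.
  under eq_integral do rewrite gee0_abs ?lee_fin ?mulr_ge0 ?enorm_ge0//.
  by rewrite (le_lt_trans wN) ?ltry.
have NE : \int[lebesgue_rV n]_y (enorm y * enorm (w y)) <= N.
  by rewrite -lee_fin fineK//; apply: integrable_fin_num.
set Q := _ `^ (- ((n%:R + 1) / 2)); have Q0 : 0 <= Q by exact: powR_ge0.
set T := t * _; have T0 : 0 <= T by rewrite mulr_ge0 ?powR_ge0// (le_trans (ltW tau0)).
have one k : `|convolution (stokes_kernel tau j k) (fun y => v y ord0 k) x -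
    stokes_kernel t j k x * \int[lebesgue_rV n]_y w y ord0 k| <=
    C * T * \int[lebesgue_rV n]_y enorm (w y) +
    C * Q * \int[lebesgue_rV n]_y (enorm y * enorm (w y)) +
    C * e * Q * \int[lebesgue_rV n]_y
      ((enorm (x - y) ^+ 2 + tau) `^ (- ((n%:R + 1) / 2))).
  have iwk : (lebesgue_rV n).-integrable setT (fun y => (w y ord0 k)%:E).
    apply: (le_integrable measurableT _ _ iw).
      by apply/measurable_EFinP; exact: measurable_fun_rV_coord.
    by move=> y _ /=; rewrite lee_fin (ger0_norm (enorm_ge0 _)) coord_le_enorm.
  have i1 : (lebesgue_rV n).-integrable setT (fun y => (C * T * enorm (w y))%:E).
    exact: (integrableZl measurableT (C * T) iw).
  have i2 : (lebesgue_rV n).-integrable setT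
      (fun y => (C * Q * (enorm y * enorm (w y)))%:E).
    exact: (integrableZl measurableT (C * Q) iyw).
  have i3 : (lebesgue_rV n).-integrable setT (fun y => (C * e * Q *
      (enorm (x - y) ^+ 2 + tau) `^ (- ((n%:R + 1) / 2)))%:E).
    exact: (integrableZl measurableT (C * e * Q) iP).
  have i12 := integrableD measurableT i1 i2.
  have i123 := integrableD measurableT i12 i3.
  rewrite -(RintegralZl _ measurableT iwk) -(RintegralZl _ measurableT iw).
  rewrite -(RintegralZl _ measurableT iyw) -(RintegralZl _ measurableT iP).
  rewrite -(RintegralD measurableT i1 i2) -(RintegralD measurableT i12 i3).
  apply: Rintegral_near_ae => //.
    exact: (integrableZl measurableT (stokes_kernel t j k x) iwk).
  near=> y => _.
  have -> : v y = w y by near: y.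
  have wy : enorm (w y) <= e * (1 + enorm y) ^- (n + 2) by near: y.
  rewrite -mulrBl normrM.
  apply: le_trans (hC t tau x y j k e _ tau0 taut x0 tx e0 (enorm_ge0 _) wy).
  apply: ler_wpM2l; first exact: normr_ge0.
  exact: coord_le_enorm.
rewrite mxE -sumrB.
apply: (le_trans (ler_norm_sum _ _ _)).
set I := \int[lebesgue_rV n]_y enorm (w y) in one *.
have I0 : 0 <= I by apply: Rintegral_ge0 => y _; exact: enorm_ge0.
apply: (@le_trans _ _ (\sum_(k < n) (C * T * I + C * Q * N + C * e * Q * (C1 * tau `^ (- 2^-1))))).
  apply: ler_sum => k _; apply: (le_trans (one k)).
  have CQ : 0 <= C * Q by rewrite mulr_ge0// ltW.
  have CeQ : 0 <= C * e * Q by rewrite !mulr_ge0// ltW.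
  apply: lerD; first by rewrite lerD2l ler_wpM2l.
  by rewrite ler_wpM2l//; move: hP; rewrite mul1r.
rewrite sumr_const card_ord -[leLHS]mulr_natl.
have N0 : 0 <= N.
  by apply: le_trans NE; apply: Rintegral_ge0 => y _; rewrite mulr_ge0 ?enorm_ge0.
set V := tau `^ _; have V0 : 0 <= V by exact: powR_ge0.
clearbody V I Q T; clear -C0 C10 T0 Q0 I0 V0 N0 e0 nR.
have p1 : 0 <= n%:R * (C * C1) * (T * I) by rewrite !mulr_ge0 ?(ltW nR) ?(ltW C0) ?(ltW C10).
have p2 : 0 <= n%:R * (C * C1) * (Q * N) by rewrite !mulr_ge0 ?(ltW nR) ?(ltW C0) ?(ltW C10).
have p3 : 0 <= n%:R * C * (e * Q * V) by rewrite !mulr_ge0 ?(ltW nR) ?(ltW C0).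
by rewrite -subr_ge0 (_ : _ - _ = n%:R * (C * C1) * (T * I) + n%:R * (C * C1) * (Q * N)
  + n%:R * C * (e * Q * V)) ?addr_ge0//; ring.
Unshelve. all: by end_near. Qed.

End force_slice.

Section force_far.
Context {R : realType} {n : nat}.
Hypothesis n0 : (0 < n)%N.
Notation mu := (@lebesgue_measure R).
Implicit Types (x y : 'rV[R]_n) (f : 'rV[R]_n -> R -> 'rV[R]_n).

Let mI (i : interval R) : measurable ([set` i] : set (measurableTypeR R)).
Proof. exact: measurable_itv. Qed.

(** For [t >= 1] one has [(1 + t)/r <= 2/M], and [M = 1 + 2 (C/e)^2] is chosen so that
    [2 C^2 <= e^2 M]. *)
Lemma parabolic_ratio_small (C e : R) : 0 <= C -> 0 < e ->
  exists2 M : R, 1 <= M & forall t r : R, 1 <= t -> M * t <= r ->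
    C * ((1 + t) `^ 2^-1 * r `^ (- 2^-1)) <= e.
Proof.
move=> C0 e0; exists (1 + 2 * (C / e) ^+ 2).
  by rewrite lerDl mulr_ge0// sqr_ge0.
set M := 1 + _ => t r t1 Mr.
have M0 : 0 < M by rewrite /M ltr_pwDl// mulr_ge0// sqr_ge0.
have t0 : 0 < t by exact: lt_le_trans t1.
have r0 : 0 < r by rewrite (lt_le_trans _ Mr)// mulr_gt0.
have h : (1 + t) `^ 2^-1 * r `^ (- 2^-1) = Num.sqrt ((1 + t) / r).
  have t1' : 0 <= 1 + t by rewrite addr_ge0// ltW.
  by rewrite powRN (powR12_sqrt t1') (powR12_sqrt (ltW r0)) sqrtrM// sqrtrV// ltW.
rewrite h.
have tr : (1 + t) / r <= 2 / M.
  rewrite ler_pdivrMr// mulrAC ler_pdivlMr//.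
  have p : 0 <= (t - 1) * M by rewrite mulr_ge0 ?subr_ge0// ltW.
  by nra.
apply: (@le_trans _ _ (C * Num.sqrt (2 / M))).
  by rewrite ler_wpM2l// ler_wsqrtr.
rewrite -(ger0_norm C0) -sqrtr_sqr -sqrtrM ?sqr_ge0//.
rewrite -[leRHS](ger0_norm (ltW e0)) -sqrtr_sqr ler_wsqrtr// mulrA ler_pdivrMr//.
have -> : e ^+ 2 * M = C ^+ 2 * 2 + e ^+ 2 by rewrite /M; field; rewrite gt_eqF.
by rewrite lerDl sqr_ge0.
Qed.

(** Two errors of size [eta/2]: freezing the kernel at [(x, t)] costs a multiple of
    [(t/|x|^2)^{1/2}], made small by [M]; replacing the mass of the force on []0, t[] by its total
    costs a tail of a convergent integral, made small by [T]. *)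
Lemma duhamel_stokes_far f (e Cf : R) : 0 <= e -> 0 <= Cf ->
  lmeasurable (lebesgue_rV n \x mu)%E ([set: 'rV[R]_n] `*` `[0, +oo[)
    (fun z => f z.1 z.2) ->
  {ae (lebesgue_rV n \x mu)%E, forall z, 0 <= z.2 ->
    enorm (f z.1 z.2) <= e * (1 + enorm z.1) ^- (n + 2)} ->
  (\int[lebesgue_rV n \x mu]_(z in [set: 'rV[R]_n] `*` `[0%R, +oo[)
    (enorm (f z.1 z.2))%:E < +oo)%E ->
  (forall t, 0 <= t -> (\int[lebesgue_rV n]_x (enorm x * enorm (f x t))%:E
    <= (Cf * (1 + t) `^ (- 2^-1))%:E)%E) ->
  forall eta : R, 0 < eta -> exists2 M : R, 1 <= M &
    exists2 T : R, 1 <= T & forall t x j, T <= t -> M * t <= enorm x ^+ 2 ->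
    `|duhamel stokes_op f x t ord0 j -
      \sum_k stokes_kernel t j k x *
        \int[mu]_(s in `[0, +oo[) \int[lebesgue_rV n]_y f y s ord0 k| <=
    eta * (enorm x ^+ 2) `^ (- (n%:R / 2)).
Proof.
move=> e0 Cf0 [g mg fg] fb fL1 fx eta eta0.
have nR : 0 < n%:R :> R by rewrite ltr0n.
have aeF := @ae_filter_ringOfSetsType _ _ R (lebesgue_rV n \x mu)%E.
(* Extending by zero to negative times gives a Borel function on the whole product, so that slicing
   and Fubini apply without a domain. *)
pose G (z : 'rV[R]_n * measurableTypeR R) : 'rV[R]_n :=
  if z.2 \in `[0, +oo[ then g z else 0.
have GE z : 0 <= z.2 -> G z = g z by move=> z0; rewrite /G in_itv/= z0.
have mG : measurable_fun setT G.
  pose D := [set: 'rV[R]_n] `*` [set` `[(0 : R), +oo[].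
  have DE : setT `&` (fun z : 'rV[R]_n * measurableTypeR R => z.2 \in `[0, +oo[)
      @^-1` [set true] = D.
    by rewrite setTI; apply/seteqP; split=> z /=; [move=> ?; split|case].
  apply: measurable_fun_if => //.
    apply: (@measurable_fun_bool _ _ _ _ true) => //; rewrite DE.
    by apply: measurableX => //; exact: mI.
have fG : {ae (lebesgue_rV n \x mu)%E, forall z, 0 <= z.2 ->
    f z.1 z.2 = G z /\ enorm (G z) <= e * (1 + enorm z.1) ^- (n + 2)}.
  apply: filterS2 fg fb => z fz fbz z0.
  have E : f z.1 z.2 = G z by rewrite GE// fz//; split=> //=; rewrite in_itv/= z0.
  by split=> //; rewrite -E; exact: fbz.
have iG : (lebesgue_rV n \x mu)%E.-integrable setT (fun z => (enorm (G z))%:E).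
  apply/integrableP; split; first by apply/measurable_EFinP; exact: measurable_fun_enorm.
  under eq_integral do rewrite gee0_abs ?lee_fin ?enorm_ge0//.
  apply: le_lt_trans fL1; rewrite [leRHS]integral_mkcond le_eqVlt; apply/orP; left.
  apply/eqP/eq_integral_ae; apply: filterS fG => z fG _; rewrite patchE.
  have [z0|z0] := leP 0 z.2.
    by rewrite mem_set ?(fG z0).1//; split=> //=; rewrite in_itv/= z0.
  rewrite memNset/=; last by move=> [_]; rewrite /= in_itv/= leNgt z0.
  by rewrite /G in_itv/= leNgt z0/= /enorm /edot big1 ?sqrtr0// => i _; rewrite mxE mul0r.
have iGk k : (lebesgue_rV n \x mu)%E.-integrable setT (EFin \o (fun z => G z ord0 k)).
  apply: (le_integrable measurableT _ _ iG).
    by apply/measurable_EFinP; exact: measurable_fun_rV_coord.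
  by move=> z _ /=; rewrite lee_fin (ger0_norm (enorm_ge0 _)) coord_le_enorm.
pose phi k s := \int[lebesgue_rV n]_y G (y, s) ord0 k.
pose nu s := \int[lebesgue_rV n]_y enorm (G (y, s)).
have iphi k : mu.-integrable setT (EFin \o phi k) := integrable_slice_Rintegral (iGk k).
have inu : mu.-integrable setT (EFin \o nu) := integrable_slice_Rintegral iG.
have sl := ae_prod_slice fG.
have mE k : \int[mu]_(s in `[0, +oo[) \int[lebesgue_rV n]_y f y s ord0 k =
    \int[mu]_(s in `[0, +oo[) phi k s.
  congr fine; apply: eq_integral_ae; apply: filterS sl => s sl.
  rewrite /= in_itv/= andbT => s0; congr EFin; rewrite /phi; congr fine.
  by apply: eq_integral_ae; apply: filterS sl => y /(_ s0)/= [-> _].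
pose N := \int[mu]_s nu s.
have N0 : 0 <= N.
  by apply: Rintegral_ge0 => s _; apply: Rintegral_ge0 => y _; exact: enorm_ge0.
have [C C0 hC] := @stokes_op_far R n n0.
have [C7 C70 h7] := @stokes_kernel_le R n n0.
(* The total mass [N] comes from the time increment, [2 Cf] from the first moment integrated in
   time, and [2 e] from the region near [y = x]. *)
pose B := C * (N + 2 * Cf + 2 * e).
have B0 : 0 <= B by rewrite mulr_ge0 ?(ltW C0)// !addr_ge0// mulr_ge0.
have eta2 : 0 < eta / 2 by rewrite divr_gt0.
have [M M1 hM] := parabolic_ratio_small B0 eta2.
(* Each of the [n] components of the tail is multiplied by a kernel entry of size at most
   [C7 |x|^{-n}]; this threshold makes the sum at most [eta/2] times [|x|^{-n}]. *)
have [T T1 hT] : exists2 T, 1 <= T & forall t, T <= t -> forall k,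
    `|\int[mu]_(s in `]0, t[) phi k s - \int[mu]_(s in `[0, +oo[) phi k s| <=
    eta / (2 * n%:R * C7).
  have : \forall t \near +oo, forall k : 'I_n,
      `|\int[mu]_(s in `]0, t[) phi k s - \int[mu]_(s in `[0, +oo[) phi k s| <=
      eta / (2 * n%:R * C7).
    apply: filter_forall => k.
    have /cvgrPdist_le := cvg_Rintegral_oo (iphi k).
    move=> /(_ (eta / (2 * n%:R * C7))) h.
    by apply: filterS (h _) => [t|]; rewrite ?divr_gt0 ?mulr_gt0// distrC.
  move=> [T [_ hT]]; exists (Num.max 1 (T + 1)); first by rewrite le_max lexx.
  by move=> t; rewrite ge_max => /andP[_ tT]; apply: hT; lra.
exists M => //; exists T => // t x j Tt Mt.
have t1 : 1 <= t := le_trans T1 Tt.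
have t0 : 0 < t := lt_le_trans ltr01 t1.
have tr : t <= enorm x ^+ 2 by apply: le_trans Mt; rewrite ler_peMl// ltW.
have r0 : 0 < enorm x ^+ 2 := lt_le_trans t0 tr.
have x0 : x != 0.
  by apply/eqP => x0; move: r0; rewrite (eqP (_ : enorm x == 0)) ?enorm_eq0 ?x0// expr0n ltxx.
have far : `|duhamel stokes_op f x t ord0 j -
    \sum_k stokes_kernel t j k x * \int[mu]_(s in `]0, t[) phi k s| <=
    B * ((1 + t) `^ 2^-1 * (enorm x ^+ 2) `^ (- 2^-1)) *
      (enorm x ^+ 2) `^ (- (n%:R / 2)).
  have [iS hS] := Rintegral_inv_sqrt_shift t0.
  have [iT hTt] := Rintegral_inv_sqrt_sub t0.
  set r := enorm x ^+ 2 in tr r0 *.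
  pose U := C * (t * r `^ (- (n%:R / 2) - 1)).
  pose Q := r `^ (- ((n%:R + 1) / 2)).
  have iphi' k : mu.-integrable `]0, t[ (EFin \o phi k).
    by apply: (integrableS measurableT) (iphi k).
  have inu' : mu.-integrable `]0, t[ (EFin \o nu) by apply: (integrableS measurableT) inu.
  have i0 k : mu.-integrable `]0, t[ (EFin \o (fun s => stokes_kernel t j k x * phi k s)).
    exact: (integrableZl (mI _) _ (iphi' k)).
  have i1 : mu.-integrable `]0, t[ (EFin \o (fun s => U * nu s)).
    exact: (integrableZl (mI _) _ inu').
  have i2 : mu.-integrable `]0, t[ (EFin \o (fun s => C * Q * Cf * (1 + s) `^ (- 2^-1))).
    exact: (integrableZl (mI _) _ iS).
  have i3 : mu.-integrable `]0, t[ (EFin \o (fun s => C * e * Q * (t - s) `^ (- 2^-1))).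
    exact: (integrableZl (mI _) _ iT).
  have i12 := integrableD (mI _) i1 i2; have i123 := integrableD (mI _) i12 i3.
  apply: (@le_trans _ _ (\int[mu]_(s in `]0, t[) (U * nu s +
      C * Q * Cf * (1 + s) `^ (- 2^-1) + C * e * Q * (t - s) `^ (- 2^-1)))).
    rewrite mxE.
    rewrite [X in _ - X](_ : _ =
        \int[mu]_(s in `]0, t[) \sum_k stokes_kernel t j k x * phi k s); last first.
      rewrite (Rintegral_sum _ (mI _) i0); apply: eq_bigr => k _.
      by rewrite (RintegralZl _ (mI _) (iphi' k)).
    apply: Rintegral_near_ae; [exact: mI|exact: integrable_Rsum|exact: i123|].
    have ae2 := ae_integrable2 iG.
    apply: filterS2 sl ae2 => s sl sli; rewrite /= in_itv/= => /andP[s0 st].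
    have s0' := ltW s0.
    apply: (le_trans (hC t (t - s) x j (f^~ s) (fun y => G (y, s)) e
      (Cf * (1 + s) `^ (- 2^-1)) _ _ x0 tr e0 _ _ _ sli _)).
    - by rewrite subr_gt0.
    - by rewrite gerBl.
    - exact: (measurableT_comp mG (pair2_measurable s)).
    - by apply: filterS sl => y /(_ s0')/= [].
    - by apply: filterS sl => y /(_ s0')/= [].
    - rewrite -(@eq_integral_ae _ _ _ _ _ (fun y => (enorm y * enorm (f y s))%:E)); first exact: fx.
      by apply: filterS sl => y /(_ s0')/= [-> _].
    - by rewrite mulrA.
  rewrite (RintegralD (mI _) i12 i3) (RintegralD (mI _) i1 i2).
  rewrite (RintegralZl _ (mI _) inu') (RintegralZl _ (mI _) iS) (RintegralZl _ (mI _) iT).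
  have nuN : \int[mu]_(s in `]0, t[) nu s <= N.
    rewrite /N /Rintegral fine_le//; [exact: integrable_fin_num|exact: integrable_fin_num|].
    apply: ge0_subset_integral => //; first exact: (measurable_int _ inu).
    by move=> s _; rewrite lee_fin; apply: Rintegral_ge0 => y _; exact: enorm_ge0.
  have tt : t `^ 2^-1 <= (1 + t) `^ 2^-1.
    by apply: ge0_ler_powR; rewrite ?nnegrE ?addr_ge0 ?(ltW t0)// lerDr.
  have QE : Q = r `^ (- 2^-1) * r `^ (- (n%:R / 2)).
    rewrite -powRD; last by rewrite (gt_eqF r0) implybT.
    by congr (_ `^ _); field.
  (* As [t <= r], the ratio [t/r] is at most its square root, which brings the time increment to the
     rate of the other two errors. *)
  have UE : U <= C * ((1 + t) `^ 2^-1 * r `^ (- 2^-1) * r `^ (- (n%:R / 2))).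
    rewrite /U ler_wpM2l ?(ltW C0)// addrC powRD; last by rewrite (gt_eqF r0) implybT.
    rewrite mulrA ler_wpM2r ?powR_ge0//.
    rewrite (_ : - 1 = - 2^-1 + - 2^-1); last by field.
    rewrite powRD; last by rewrite (gt_eqF r0) implybT.
    rewrite mulrA ler_wpM2r ?powR_ge0//.
    have tE : t = t `^ 2^-1 * t `^ 2^-1.
      rewrite -powRD; last by rewrite (gt_eqF t0) implybT.
      by rewrite (_ : 2^-1 + 2^-1 = 1); [rewrite powRr1 ?(ltW t0)|field].
    rewrite {1}tE -mulrA; apply: le_trans tt; rewrite ler_piMr ?powR_ge0//.
    rewrite powRN ler_pdivrMr ?powR_gt0// mul1r.
    by apply: ge0_ler_powR; rewrite ?nnegrE ?(ltW t0) ?(ltW r0).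
  set I1 := \int[mu]_(s in _) nu s in nuN *.
  set I2 := \int[mu]_(s in _) _ in hS *.
  set I3 := \int[mu]_(s in _) _ in hTt *.
  have U0 : 0 <= U by rewrite !mulr_ge0 ?powR_ge0 ?(ltW C0) ?(ltW t0).
  rewrite QE.
  have P0 : 0 <= r `^ (- (n%:R / 2)) by exact: powR_ge0.
  have q0 : 0 <= r `^ (- 2^-1) by exact: powR_ge0.
  set P := r `^ (- (n%:R / 2)) in UE P0 *.
  set q := r `^ (- 2^-1) in UE q0 *.
  set w := (1 + t) `^ 2^-1 in UE hS tt *.
  have w0 : 0 <= w by exact: powR_ge0.
  have hT3 : I3 <= 2 * w by apply: (le_trans hTt); rewrite ler_wpM2l.
  rewrite [leRHS](_ : _ = C * (w * q * P) * N + C * (q * P) * Cf * (2 * w) +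
    C * e * (q * P) * (2 * w)); last by rewrite /B; ring.
  apply: lerD; last by rewrite ler_wpM2l// !mulr_ge0 ?(ltW C0).
  apply: lerD; last by rewrite ler_wpM2l// !mulr_ge0 ?(ltW C0).
  by apply: (le_trans (ler_wpM2l U0 nuN)); rewrite ler_wpM2r.
set P := _ `^ (- (n%:R / 2)) in far *; have P0 : 0 <= P by exact: powR_ge0.
have lim : `|\sum_k stokes_kernel t j k x * \int[mu]_(s in `]0, t[) phi k s -
    \sum_k stokes_kernel t j k x *
      \int[mu]_(s in `[0, +oo[) \int[lebesgue_rV n]_y f y s ord0 k| <= eta / 2 * P.
  rewrite -sumrB; apply: (le_trans (ler_norm_sum _ _ _)).
  apply: (@le_trans _ _ (\sum_(k < n) (C7 * P * (eta / (2 * n%:R * C7))))).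
    apply: ler_sum => k _; rewrite mE -mulrBr normrM; apply: ler_pM => //.
      apply: (le_trans (h7 t j k x t0)); rewrite ler_wpM2l ?(ltW C70)//.
      by apply: le_powRN; rewrite ?divr_ge0// lerDl ltW.
    exact: hT.
  rewrite sumr_const card_ord -[leLHS]mulr_natl le_eqVlt; apply/orP; left; apply/eqP.
  by field; rewrite ?gt_eqF.
apply: (le_trans (ler_distD _ _ _)).
apply: (le_trans (lerD far lim)).
rewrite -mulrDl ler_wpM2r//.
have := hM t _ t1 Mt; lra.
Unshelve. all: by end_near. Qed.

End force_far.

(** * Weighted norms *)

Section lower_bounds.
Context d (T : measurableType d) (R : realType).
Variable mu : {measure set T -> \bar R}.
Local Open Scope ereal_scope.

(** The finite sum is the integral of a simple function below [f], so [f], here a weighted power of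
    [|u|] at a fixed time, may be non-measurable. *)
Lemma integral_ge_disjoint (B : nat -> set T) (K : nat -> R) (f : T -> \bar R)
    (N : nat) : (forall i, measurable (B i)) -> (forall i, 0 <= K i)%R ->
  trivIset setT B -> (forall x, 0 <= f x) ->
  (forall i x, B i x -> (K i)%:E <= f x) ->
  \sum_(i < N) (K i)%:E * mu (B i) <= \int[mu]_x f x.
Proof.
move=> mB K0 tB f0 Kf.
have KB0 (i : 'I_N) x : 0 <= (K i * \1_(B i) x)%:E.
  by rewrite lee_fin mulr_ge0.
have mKB (i : 'I_N) : measurable_fun setT (fun x => (K i * \1_(B i) x)%:E).
  apply/measurable_EFinP; apply: measurable_funM; first exact: measurable_cst.
  exact: measurable_indic.
rewrite (_ : \sum_(i < N) _ = \int[mu]_x \sum_(i < N) (K i * \1_(B i) x)%:E); last first.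
  rewrite ge0_integral_sum//; apply: eq_bigr => i _.
  rewrite (@integralZl_indic _ _ _ mu setT measurableT (fun=> B i))//.
    by rewrite integral_indic// setIT.
  by rewrite ltNge K0.
apply: ge0_le_integral_pw => [x _|x _]; first exact: sume_ge0.
have [[i Bi]|nB] := pselect (exists i : 'I_N, B i x); last first.
  rewrite big1// => i _; rewrite indicE memNset ?mulr0// => Bi.
  by apply: nB; exists i.
rewrite (bigD1 i)//= big1 ?adde0 => [|j ji].
  by rewrite indicE mem_set ?mulr1//; exact: Kf.
rewrite indicE memNset ?mulr0// => Bj.
by move/eqP : ji; apply; apply/val_inj/(tB _ _ Logic.I Logic.I); exists x.
Qed.

Lemma Lnorm_pinfty_ge (B : set T) (K : R) (f : T -> R) : measurable B ->
  0 < mu B -> (forall x, B x -> K <= f x)%R -> K%:E <= 'N[mu]_+oo [EFin \o f].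
Proof.
move=> mB B0 Kf; rewrite unlock.
have T0 : 0 < mu setT by apply: (lt_le_trans B0); apply: le_measure; rewrite ?inE.
rewrite T0 leNgt; apply/negP => sK.
have := ess_sup_ge mu (abse \o (EFin \o f)).
move=> [N [mN N0 hN]].
suff : mu B <= 0 by rewrite leNgt B0.
rewrite -N0; apply: le_measure; rewrite ?inE// => x Bx; apply: hN => /= h.
have := le_lt_trans h sK; rewrite lte_fin ltNge.
by rewrite (le_trans (Kf _ Bx) (ler_norm _)).
Qed.

Lemma Lnorm_fin_ge (B : set T) (K p v : R) (f : T -> R) : measurable B ->
  (0 <= K)%R -> (0 < p)%R -> mu B = v%:E -> (forall x, B x -> K <= f x)%R ->
  (K * v `^ p^-1)%:E <= 'N[mu]_p%:E [EFin \o f].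
Proof.
move=> mB K0 p0 Bv Kf; rewrite unlock.
have v0 : (0 <= v)%R by rewrite -lee_fin -Bv.
have -> : (K * v `^ p^-1)%:E = (K `^ p * v)%:E `^ p^-1.
  rewrite poweR_EFin powRM ?powR_ge0// -powRrM mulfV ?gt_eqF// powRr1//.
apply: gt0_ler_poweR; rewrite ?invr_ge0 ?(ltW p0)//.
- by rewrite in_itv/= leey lee_fin mulr_ge0 ?powR_ge0.
- by rewrite in_itv/= leey integral_ge0// => x _; exact: poweR_ge0.
rewrite EFinM -Bv.
rewrite -[leLHS](@integral_cst _ _ _ mu B mB).
rewrite [leRHS]integral_mkcond/= [leLHS]integral_mkcond.
apply: ge0_le_integral_pw => [x _|x _].
  by rewrite patchE; case: ifP => // _; rewrite lee_fin powR_ge0.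
rewrite patch_setT patchE; case: ifP => [/set_mem Bx|_]; last by rewrite lee_fin powR_ge0.
rewrite /= lee_fin; apply: ge0_ler_powR; rewrite ?nnegrE ?(ltW p0)//.
by rewrite (le_trans (Kf _ Bx))// ler_norm.
Qed.

End lower_bounds.

(** * Boxes inside the cone *)

Section cone_boxes.
Context {R : realType} {n : nat}.
Implicit Types (x y m : 'rV[R]_n).

Lemma measurable_box (A : 'I_n -> set (measurableTypeR R)) :
  (forall i, measurable (A i)) ->
  measurable [set x : 'rV[R]_n | forall i, A i (x ord0 i)].
Proof.
move=> mA.
rewrite (_ : [set _ | _] = \bigcap_(i in setT) (rV_coord i @^-1` A i)).
  apply: fin_bigcap_measurable => // i _; rewrite -[X in measurable X]setTI.
  exact: measurable_rV_coord.
by apply/seteqP; split => x /= H i; [move=> _; exact: H|exact: (H i)].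
Qed.

Lemma edot_delta i y : edot (delta_mx ord0 i) y = y ord0 i.
Proof.
rewrite /edot (bigD1 i)//= big1 ?addr0 ?mxE ?eqxx ?mul1r// => j ji.
by rewrite mxE eqxx/= (negbTE ji) mul0r.
Qed.

(** Two coordinates suffice: a basis vector if the first entry of [m] vanishes, otherwise the first
    two entries of [m] turned by a right angle; then rescale. *)
Lemma orthogonal_vector m (s : R) : (1 < n)%N -> 0 < s ->
  exists2 e : 'rV[R]_n, edot e m = 0 & enorm e = s.
Proof.
move=> n1 s0.
suff [e em e0] : exists2 e : 'rV[R]_n, edot e m = 0 & e != 0.
  have ne : 0 < enorm e by rewrite enorm_gt0.
  exists ((s / enorm e) *: e); first by rewrite edotZl em mulr0.
  by rewrite enormZ ger0_norm ?divr_ge0 ?(ltW s0) ?(ltW ne)// divfK// gt_eqF.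
pose i0 := Ordinal (ltnW n1); pose i1 := Ordinal n1.
have [m0|m0] := eqVneq (m ord0 i0) 0.
  exists (delta_mx ord0 i0); first by rewrite edot_delta.
  by apply/eqP => /rowP /(_ i0) /eqP; rewrite !mxE !eqxx oner_eq0.
exists (m ord0 i1 *: delta_mx ord0 i0 + - m ord0 i0 *: delta_mx ord0 i1).
  by rewrite edotDl !edotZl !edot_delta; ring.
apply/eqP => /rowP /(_ i1) /eqP; rewrite !mxE !eqxx/= mulr0 add0r mulr1.
by rewrite oppr_eq0 (negbTE m0).
Qed.

(** Cube of half-side [L s / n] around [L e], with [|e| = 2] and [e] orthogonal to [m]. Its points
    are [L (e + z)] with [|z| <= s <= 1], hence of norm between [L] and [3 L], and only [z]
    contributes to the product with [m]. *)
Lemma cone_boxes m (k : R) : (1 < n)%N -> 0 < k ->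
  exists2 B : R -> set 'rV[R]_n, exists2 w : R, 0 < w &
    forall L, 0 < L -> lebesgue_rV n (B L) = ((w * L) ^+ n)%:E &
  forall L, 0 < L -> measurable (B L) /\ forall x, B L x ->
    L ^+ 2 <= enorm x ^+ 2 <= 9 * L ^+ 2 /\
    edot x m ^+ 2 <= k * (enorm x ^+ 2 * edot m m).
Proof.
move=> n1 k0; have nR : 0 < n%:R :> R by rewrite ltr0n ltnW.
have [e em e2] := @orthogonal_vector m 2 n1 (ltr0Sn _ 1).
(* [s <= 1] keeps the box in the shell, and [s^2 <= s <= k] keeps it in the cone. *)
pose s : R := Num.min 1 k; have s0 : 0 < s by rewrite lt_min ltr01.
have s1 : s <= 1 by rewrite ge_min lexx.
have sk : s <= k by rewrite ge_min lexx orbT.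
clearbody s.
pose I L i : interval R := `[L * (e ord0 i - s / n%:R), L * (e ord0 i + s / n%:R)].
have mI L i : measurable ([set` I L i] : set (measurableTypeR R)) by exact: measurable_itv.
have sn : 0 < s / n%:R by rewrite divr_gt0.
exists (fun L => [set x | forall i, [set` I L i] (x ord0 i)]).
  exists (2 * (s / n%:R)); first by rewrite mulr_gt0.
  move=> L L0; rewrite (@lebesgue_rV_box R n (fun i => [set` I L i]))//.
  rewrite (eq_bigr (fun=> (2 * (s / n%:R) * L)%:E)) => [|i _].
    by rewrite prodEFin prodr_const card_ord.
  rewrite lebesgue_measure_itv/= lte_fin.
  rewrite ltr_pM2l// ltrD2l gtrN// -EFinB; congr EFin; ring.
move=> L L0; split; first exact: (@measurable_box (fun i => [set` I L i]) (mI L)).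
move=> x Bx; pose z := L^-1 *: x - e.
have zi i : `|z ord0 i| <= s / n%:R.
  have := Bx i; rewrite /= /I in_itv/= => /andP[h1 h2].
  rewrite !mxE ler_distl [L^-1 * _]mulrC ler_pdivlMr// ler_pdivrMr//.
  by rewrite ![_ * L]mulrC h1 h2.
have zs : enorm z <= s.
  apply: (le_trans (enorm_le_sum z)).
  apply: (@le_trans _ _ (\sum_(i < n) s / n%:R)); first exact: ler_sum.
  by rewrite sumr_const card_ord -[leLHS]mulr_natl mulrC divfK// gt_eqF.
have xE : x = L *: (e + z) by rewrite addrC subrK scalerA mulfV ?scale1r// gt_eqF.
have nE : enorm x = L * enorm (e + z) by rewrite {1}xE enormZ gtr0_norm.
have h3 : enorm (e + z) <= 3 by rewrite (le_trans (enormD _ _))// e2; lra.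
have h1 : 1 <= enorm (e + z).
  have := enorm_le_add e (- z); rewrite opprK enormN e2; lra.
have L2 : 0 < L ^+ 2 by rewrite exprn_gt0.
have lo : L ^+ 2 <= enorm x ^+ 2.
  by rewrite nE exprMn ler_peMr ?(ltW L2)// exprn_ege1.
split.
  rewrite lo/= nE exprMn mulrC ler_wpM2r ?(ltW L2)//.
  rewrite (_ : 9 = 3 ^+ 2); last by ring.
  by apply: lerXn2r; rewrite ?nnegrE ?enorm_ge0.
rewrite {1}xE edotZl edotDl em add0r exprMn.
have zm : edot z m ^+ 2 <= s ^+ 2 * edot m m.
  apply: (le_trans (sqr_edot_le z m)); rewrite ler_wpM2r ?edot_ge0// -sqr_enorm.
  by apply: lerXn2r; rewrite ?nnegrE ?enorm_ge0 ?(ltW s0).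
apply: (@le_trans _ _ (L ^+ 2 * (k * edot m m))).
  rewrite ler_wpM2l ?(ltW L2)//; apply: (le_trans zm).
  rewrite ler_wpM2r ?edot_ge0//; apply: le_trans sk.
  by rewrite expr2 ler_piMl ?(ltW s0).
by rewrite mulrCA ler_wpM2l ?(ltW k0)// ler_wpM2r ?edot_ge0.
Qed.

(** The sign of [alpha - n] decides which side of the shell gives the smaller value of
    [|x|^{alpha - n}]; since [alpha >= 0], the factor [9^{-n/2}] covers both cases. *)
Lemma weight_ge (alpha c L N : R) x : 0 <= alpha -> 0 <= c -> 0 < L ->
  L ^+ 2 <= enorm x ^+ 2 <= 9 * L ^+ 2 ->
  c * (enorm x ^+ 2) `^ (- (n%:R / 2)) <= N ->
  c * 9 `^ (- (n%:R / 2)) * L `^ (alpha - n%:R) <= (1 + enorm x) `^ alpha * N.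
Proof.
move=> a0 c0 L0 /andP[lo hi] cN.
set r := enorm x ^+ 2 in lo hi cN *.
have L2 : 0 < L ^+ 2 by rewrite exprn_gt0.
have r0 : 0 < r by exact: lt_le_trans lo.
have xa : r `^ (alpha / 2) <= (1 + enorm x) `^ alpha.
  rewrite /r -(powR_mulrn 2 (enorm_ge0 x)) -powRrM (_ : 2%:R * _ = alpha); last by field.
  by apply: ge0_ler_powR; rewrite ?nnegrE ?addr_ge0 ?enorm_ge0// lerDr.
apply: (@le_trans _ _ (r `^ (alpha / 2) * (c * r `^ (- (n%:R / 2))))); last first.
  by apply: ler_pM; rewrite ?mulr_ge0 ?powR_ge0.
rewrite mulrCA -powRD; last by rewrite (gt_eqF r0) implybT.
rewrite -mulrA ler_wpM2l//.
have Lq q : L `^ q = (L ^+ 2) `^ (q / 2).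
  by rewrite -(powR_mulrn 2 (ltW L0)) -powRrM; congr (_ `^ _); field.
have [an|an] := leP n%:R alpha.
  apply: (@le_trans _ _ (L `^ (alpha - n%:R))).
    rewrite ler_piMl ?powR_ge0//.
    apply: (@le_trans _ _ (9 `^ 0)); last by rewrite powRr0.
    by apply: ler_powR; rewrite ?ler1n// oppr_le0 divr_ge0.
  rewrite Lq (_ : alpha / 2 - n%:R / 2 = (alpha - n%:R) / 2); last by field.
  by apply: ge0_ler_powR; rewrite ?nnegrE ?divr_ge0 ?subr_ge0 ?(ltW L2) ?(ltW r0).
rewrite (_ : alpha / 2 - n%:R / 2 = - ((n%:R - alpha) / 2)); last by field.
apply: (@le_trans _ _ ((9 * L ^+ 2) `^ (- ((n%:R - alpha) / 2)))); last first.
  by apply: le_powRN => //; rewrite divr_ge0 ?subr_ge0 ?(ltW an).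
rewrite powRM ?(ltW L2)// Lq (_ : (alpha - n%:R) / 2 = - ((n%:R - alpha) / 2)); last by field.
rewrite ler_wpM2r ?powR_ge0//; apply: ler_powR; first by rewrite ler1n.
by rewrite lerN2 ler_wpM2r// gerBl.
Qed.

End cone_boxes.

(** * Sharp rates and infinite norms *)

Section weighted_norms.
Context {R : realType} {n : nat}.
Hypothesis n1 : (1 < n)%N.
Implicit Types (x y m : 'rV[R]_n) (v : 'rV[R]_n -> 'rV[R]_n).
Implicit Types (u : 'rV[R]_n -> R -> 'rV[R]_n).

(** The larger of [(1 + |x|)^2] and [t] is at least half their sum. This merges the two decay
    regimes into one power, to which the integral bounds apply. *)
Lemma decay_min_le x (t : R) : 0 <= t ->
  Num.min ((1 + enorm x) ^- n) ((1 + t) `^ (- (n%:R / 2))) <=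
  2 `^ (n%:R / 2) * ((1 + enorm x) ^+ 2 + t) `^ (- (n%:R / 2)).
Proof.
move=> t0; set A := 1 + enorm x.
have A1 : 1 <= A by rewrite /A lerDl enorm_ge0.
have A0 : 0 < A by exact: lt_le_trans A1.
have A20 : 0 < A ^+ 2 by rewrite exprn_gt0.
have An : A ^- n = (A ^+ 2) `^ (- (n%:R / 2)).
  by rewrite -(powR_mulrn 2 (ltW A0)) -powRrM (_ : 2%:R * _ = - n%:R);
    [rewrite powR_invn// ltW|field].
have D w : 0 <= w -> 2 `^ (n%:R / 2) * w `^ (- (n%:R / 2)) = (w / 2) `^ (- (n%:R / 2)).
  move=> w0; rewrite powRM ?invr_ge0// -(powR_inv1 (ler0n _ 2)) -powRrM mulN1r opprK.
  by rewrite mulrC.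
have nn : 0 <= n%:R / 2 :> R by rewrite divr_ge0.
rewrite D ?addr_ge0 ?(ltW A20)// An ge_min.
have [At|tA] := leP (A ^+ 2) t; apply/orP; [right|left]; apply: le_powRN => //.
- by rewrite divr_gt0// ltr_pwDl.
- by rewrite ler_pdivrMr//; lra.
- by rewrite divr_gt0// ltr_pwDl.
- by rewrite ler_pdivrMr//; lra.
Qed.

(** With [W = (1 + |x|)^2 + t], the weight is at most [W^{alpha/2}], so the [p]-th power of the
    integrand is [O(W^{-(n+b)/2})] with [b = (n - alpha) p - n]. Positivity of [b] is exactly
    [alpha + n/p < n], and the space integral yields [t^{-b/2}]. *)
Lemma weighted_Lnorm_fin_le (C alpha p : R) : 0 <= alpha -> 1 < p -> 0 < C ->
  alpha + n%:R / p < n%:R ->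
  exists2 c : R, 0 < c & forall v (t : R), 0 < t ->
  (forall x, enorm (v x) <= C * ((1 + enorm x) ^+ 2 + t) `^ (- (n%:R / 2))) ->
  (weighted_Lnorm alpha p%:E v <=
    (c * t `^ (- (n%:R - alpha - n%:R / p) / 2))%:E)%E.
Proof.
move=> a0 p1 C0 ap; have p0 : 0 < p by exact: lt_trans p1.
have nR : 0 < n%:R :> R by rewrite ltr0n ltnW.
pose b := (n%:R - alpha) * p - n%:R.
have b0 : 0 < b.
  have : n%:R / p * p < (n%:R - alpha) * p by rewrite ltr_pM2r//; lra.
  by rewrite divfK ?gt_eqF// /b subr_gt0.
have [D D0 hD] := @integral_enorm_powR_le R n b (ltnW n1) b0.
exists (C * D `^ p^-1); first by rewrite mulr_gt0// powR_gt0.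
move=> v t t0 hv; rewrite /weighted_Lnorm unlock.
have -> : (C * D `^ p^-1 * t `^ (- (n%:R - alpha - n%:R / p) / 2))%:E =
    (((C `^ p)%:E * (D * t `^ (- (b / 2)))%:E) `^ p^-1)%E.
  rewrite -EFinM poweR_EFin; congr EFin.
  rewrite powRM ?powR_ge0 ?mulr_ge0 ?powR_ge0 ?(ltW D0)//.
  rewrite powRM ?powR_ge0 ?(ltW D0)// -!powRrM mulfV ?gt_eqF// powRr1 ?(ltW C0)// mulrA.
  by congr (_ * _ `^ _); rewrite /b; field; rewrite gt_eqF.
have mg : measurable_fun setT
    (fun y => ((enorm (0 - y) ^+ 2 + t) `^ (- ((n%:R + b) / 2)))%:E).
  by apply/measurable_EFinP; exact: measurable_power_kernel.
have CD0 : (0 <= (C `^ p)%:E * (D * t `^ (- (b / 2)))%:E)%E.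
  by rewrite -EFinM lee_fin !mulr_ge0 ?powR_ge0 ?(ltW D0).
apply: gt0_ler_poweR; rewrite ?invr_ge0 ?(ltW p0)//.
- by rewrite in_itv/= leey integral_ge0// => x _; exact: poweR_ge0.
- by rewrite in_itv/= leey CD0.
apply: (@le_trans _ _ (\int[lebesgue_rV n]_y ((C `^ p)%:E *
    ((enorm (0 - y) ^+ 2 + t) `^ (- ((n%:R + b) / 2)))%:E))%E); last first.
  rewrite ge0_integralZl_EFin ?powR_ge0//; last by move=> y _; rewrite lee_fin powR_ge0.
  by rewrite lee_wpmul2l ?lee_fin ?powR_ge0//; exact: hD.
apply: ge0_le_integral_pw => [x _|x _]; first exact: poweR_ge0.
rewrite /= -EFinM lee_fin ger0_norm ?mulr_ge0 ?powR_ge0 ?enorm_ge0//.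
rewrite sub0r enormN.
set A := 1 + enorm x; have A1 : 1 <= A by rewrite /A lerDl enorm_ge0.
have A0 : 0 < A by exact: lt_le_trans A1.
have W0 : 0 < A ^+ 2 + t by rewrite addr_gt0 ?exprn_gt0.
have xA : enorm x ^+ 2 <= A ^+ 2.
  by apply: lerXn2r; rewrite ?nnegrE ?enorm_ge0 ?(ltW A0)// /A lerDr.
apply: (@le_trans _ _ ((C * (A ^+ 2 + t) `^ (- ((n%:R - alpha) / 2))) `^ p)).
  apply: ge0_ler_powR; rewrite ?nnegrE ?(ltW p0) ?mulr_ge0 ?powR_ge0 ?enorm_ge0 ?(ltW C0)//.
  have -> : C * (A ^+ 2 + t) `^ (- ((n%:R - alpha) / 2)) =
      (A ^+ 2 + t) `^ (alpha / 2) * (C * (A ^+ 2 + t) `^ (- (n%:R / 2))).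
    rewrite mulrCA -powRD; last by rewrite (gt_eqF W0) implybT.
    by congr (_ * _ `^ _); field.
  apply: ler_pM; rewrite ?powR_ge0 ?enorm_ge0//.
  rewrite (_ : A `^ alpha = (A ^+ 2) `^ (alpha / 2)).
    by apply: ge0_ler_powR; rewrite ?nnegrE ?divr_ge0 ?exprn_ge0 ?(ltW A0) ?(ltW W0)// lerDl ltW.
  by rewrite -(powR_mulrn 2 (ltW A0)) -powRrM; congr (_ `^ _); field.
rewrite powRM ?powR_ge0 ?(ltW C0)// ler_wpM2l ?powR_ge0// -powRrM.
rewrite (_ : - ((n%:R - alpha) / 2) * p = - ((n%:R + b) / 2)); last by rewrite /b; field.
apply: le_powRN; first by rewrite divr_ge0// addr_ge0 ?(ltW b0).
  by rewrite ltr_wpDl// sqr_ge0.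
by rewrite lerD2r.
Qed.

Lemma weighted_Lnorm_pinfty_le v (C t : R) : 0 < t -> 0 <= C ->
  (forall x, enorm (v x) <= C * ((1 + enorm x) ^+ 2 + t) `^ (- (n%:R / 2))) ->
  (weighted_Lnorm n%:R +oo%E v <= C%:E)%E.
Proof.
move=> t0 C0 hv; rewrite /weighted_Lnorm unlock; case: ifP => _; last by rewrite lee_fin.
apply/ess_supP; apply: aeW => x /=.
rewrite lee_fin ger0_norm ?mulr_ge0 ?powR_ge0 ?enorm_ge0//.
set A := 1 + enorm x; have A1 : 1 <= A by rewrite /A lerDl enorm_ge0.
have A0 : 0 < A by exact: lt_le_trans A1.
have A20 : 0 < A ^+ 2 by rewrite exprn_gt0.
apply: (@le_trans _ _ (A `^ n%:R * (C * (A ^+ 2) `^ (- (n%:R / 2))))).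
  rewrite ler_wpM2l ?powR_ge0//; apply: (le_trans (hv x)); rewrite ler_wpM2l//.
  by apply: le_powRN; rewrite ?divr_ge0// lerDl ltW.
rewrite mulrCA -(powR_mulrn 2 (ltW A0)) -powRrM -powRD; last by rewrite (gt_eqF A0) implybT.
by rewrite (_ : _ + _ = 0); [rewrite powRr0 mulr1|field].
Qed.

Lemma weighted_Lnorm_profile u m (C c k M T : R) :
  0 < C -> 0 < c -> 0 < k -> 0 < M -> 0 < T ->
  (forall x t, 0 < t ->
    enorm (u x t) <= C * ((1 + enorm x) ^+ 2 + t) `^ (- (n%:R / 2))) ->
  (forall t x, T <= t -> M * t <= enorm x ^+ 2 ->
    edot x m ^+ 2 <= k * (enorm x ^+ 2 * edot m m) ->
    c * (enorm x ^+ 2) `^ (- (n%:R / 2)) <= enorm (u x t)) ->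
  (forall (alpha : R) (p : \bar R), 0 <= alpha ->
     [/\ (1 < p)%E, (p < +oo)%E & alpha + dim_over n p < n%:R] \/
       alpha = n%:R /\ p = +oo%E ->
     exists t0 c c' : R, [/\ 0 < t0, 0 < c, 0 < c' & forall t, t0 < t ->
       let rate := t `^ (- (n%:R - alpha - dim_over n p) / 2) in
       ((c * rate)%:E <= weighted_Lnorm alpha p (u^~ t) <= (c' * rate)%:E)%E])
  /\
  (forall (alpha : R) (p : \bar R), 0 <= alpha ->
     [/\ (1 <= p)%E, (p < +oo)%E & n%:R <= alpha + dim_over n p] \/
       p = +oo%E /\ n%:R < alpha ->
     exists2 t0 : R, 0 < t0 & forall t, t0 < t ->
       weighted_Lnorm alpha p (u^~ t) = +oo%E).
Proof.
move=> C0 c0 k0 M0 T0 hi lo.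
have [B [w w0 mB] hB] := @cone_boxes R n m k n1 k0.
pose c9 : R := c * 9 `^ (- (n%:R / 2)).
have c90 : 0 < c9 by rewrite mulr_gt0// powR_gt0.
(* One pointwise bound drives both halves: [L = (M t)^{1/2}] gives the rates, and arbitrarily large
   [L] at a fixed [t] gives the infinite norms. *)
have low alpha t L x : 0 <= alpha -> T < t -> 0 < L -> M * t <= L ^+ 2 -> B L x ->
    c9 * L `^ (alpha - n%:R) <= (1 + enorm x) `^ alpha * enorm (u x t).
  move=> a0 Tt L0 ML Bx; have [h1 h2] := (hB L L0).2 x Bx.
  apply: weight_ge => //; first exact: ltW.
  by apply: lo => //; [exact: ltW|apply: (le_trans ML); case/andP: h1].
have pB L : 0 < L -> (0 < lebesgue_rV n (B L))%E.
  by move=> L0; rewrite mB// lte_fin exprn_gt0// mulr_gt0.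
have rt t : T < t -> 0 < t by exact: lt_trans.
have LE t : T < t -> 0 < Num.sqrt (M * t) /\ Num.sqrt (M * t) ^+ 2 = M * t.
  move=> Tt; have t0 := rt _ Tt.
  by rewrite sqrtr_gt0 mulr_gt0// sqr_sqrtr// mulr_ge0 ?(ltW M0) ?(ltW t0).
split=> alpha p a0.
  move=> [[p1 py ap]|[aE pE]].
    case: p p1 py ap => [p| |]// p1 _ /= ap; rewrite lte_fin in p1.
    have p0 : 0 < p by exact: lt_trans p1.
    have [c' c'0 hc'] := weighted_Lnorm_fin_le a0 p1 C0 ap.
    (* Height [L^{alpha - n}] times the [p]-th root of the volume scales as [L^q]; with [L^2 = M t]
       this is [t^{q/2}], matching the upper rate. *)
    pose q := alpha - n%:R + n%:R / p.
    exists T, (c9 * w `^ (n%:R / p) * M `^ (q / 2)), c'; split=> //.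
      by rewrite !mulr_gt0// powR_gt0.
    move=> t Tt; have t0 := rt _ Tt; apply/andP; split; last first.
      by apply: hc' => // x; exact: hi.
    have [L0 L2] := LE _ Tt; set L := Num.sqrt _ in L0 L2.
    have [mBL hBL] := hB _ L0.
    have := @Lnorm_fin_ge _ _ R (lebesgue_rV n) (B L) (c9 * L `^ (alpha - n%:R)) p
      ((w * L) ^+ n) (fun x => (1 + enorm x) `^ alpha * enorm (u x t)) mBL.
    move=> /(_ (mulr_ge0 (ltW c90) (powR_ge0 _ _)) p0 (mB _ L0)) h.
    apply: le_trans (h _); last first.
      by move=> x Bx; apply: low => //; rewrite L2.
    rewrite lee_fin le_eqVlt; apply/orP; left; apply/eqP.
    have wL0 : 0 <= w * L by rewrite mulr_ge0 ?(ltW w0) ?(ltW L0).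
    rewrite -(powR_mulrn n wL0) -powRrM powRM ?(ltW w0) ?(ltW L0)//.
    rewrite [RHS](_ : _ = c9 * w `^ (n%:R / p) *
      (L `^ (alpha - n%:R) * L `^ (n%:R / p))); last by ring.
    rewrite -powRD; last by rewrite (gt_eqF L0) implybT.
    rewrite -/q (_ : L `^ q = (L ^+ 2) `^ (q / 2)); last first.
      by rewrite -(powR_mulrn 2 (ltW L0)) -powRrM; congr (_ `^ _); field.
    rewrite L2 powRM ?(ltW M0) ?(ltW t0)// !mulrA.
    by congr (_ * _ `^ _); rewrite /q; field; rewrite gt_eqF.
  rewrite pE aE; exists T, c9, C; split=> // t Tt.
  rewrite /= subrr subr0 oppr0 mul0r powRr0 !mulr1; apply/andP; split; last first.
    by apply: (weighted_Lnorm_pinfty_le (rt _ Tt) (ltW C0)) => x; exact: hi (rt _ Tt).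
  have [L0 L2] := LE _ Tt; have [mBL hBL] := hB _ L0.
  apply: (@Lnorm_pinfty_ge _ _ R (lebesgue_rV n) _ c9
    (fun x => (1 + enorm x) `^ n%:R * enorm (u x t)) mBL).
    exact: pB.
  move=> x Bx; have := low n%:R t _ x (ler0n _ n) Tt L0 _ Bx.
  by rewrite subrr powRr0 mulr1; apply; rewrite L2.
move=> [[p1 py ap]|[pE na]]; exists T => // t Tt; have t0 := rt _ Tt;
  have [S0 S2] := LE _ Tt; set S := Num.sqrt _ in S0 S2.
  case: p p1 py ap => [p| |]// p1 _ /= ap; rewrite lee_fin in p1.
  have p0 : 0 < p by exact: lt_le_trans p1.
  rewrite /weighted_Lnorm unlock.
  suff -> : (\int[lebesgue_rV n]_x
      `|((1 + enorm x) `^ alpha * enorm (u x t))%:E| `^ p = +oo)%E.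
    by rewrite poweRyr// invr_eq0 gt_eqF.
  (* The ratio 4 exceeds the ratio 3 between outer and inner radius of a box, so the boxes are
     disjoint. The maximum gives [L i >= 1] as well as [M t <= (L i)^2]. *)
  pose L (i : nat) := Num.max 1 S * 4 ^+ i.
  have mx1 : 1 <= Num.max 1 S by rewrite le_max lexx.
  have L1 i : 1 <= L i by rewrite /L mulr_ege1// exprn_ege1// ler1n.
  have Lp i : 0 < L i by exact: lt_le_trans (L1 i).
  have LM i : M * t <= L i ^+ 2.
    rewrite -S2; apply: lerXn2r; rewrite ?nnegrE ?(ltW S0) ?(ltW (Lp i))//.
    apply: (@le_trans _ _ (Num.max 1 S)); first by rewrite le_max lexx orbT.
    by apply: ler_peMr; [exact: le_trans mx1|apply: exprn_ege1; rewrite ler1n].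
  have disj i j x : (i < j)%N -> B (L i) x -> B (L j) x -> False.
    move=> ij Bi Bj; have [/andP[_ h1] _] := (hB _ (Lp i)).2 x Bi.
    have [/andP[h2 _] _] := (hB _ (Lp j)).2 x Bj.
    have L4 : 4 * L i <= L j.
      rewrite /L mulrCA ler_wpM2l ?(le_trans ler01 mx1)// -exprS.
      by apply: ler_weXn2l => //; rewrite ler1n.
    have : (4 * L i) ^+ 2 <= L j ^+ 2.
      apply: lerXn2r => //; rewrite nnegrE; last exact: ltW.
      exact: mulr_ge0 (ltW (Lp i)).
    rewrite exprMn; have : 0 < L i ^+ 2 by rewrite exprn_gt0.
    have := le_trans h2 h1; lra.
  pose K i := (c9 * L i `^ (alpha - n%:R)) `^ p.
  (* Each box contributes a constant times [L^{(alpha - n) p + n}]; the exponent is nonnegative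
     because [n <= alpha + n/p], so every box adds at least a fixed amount, also in the borderline
     case. *)
  have KB i : ((c9 `^ p * w ^+ n)%:E <= (K i)%:E * lebesgue_rV n (B (L i)))%E.
    rewrite mB// -EFinM lee_fin /K powRM ?powR_ge0 ?(ltW c90)// -mulrA.
    rewrite ler_wpM2l ?powR_ge0// exprMn mulrCA ler_peMr ?exprn_ge0 ?(ltW w0)//.
    rewrite -(powR_mulrn n (ltW (Lp i))) -powRrM -powRD; last by rewrite (gt_eqF (Lp i)) implybT.
    apply: (@le_trans _ _ (L i `^ 0)); first by rewrite powRr0.
    apply: ler_powR => //.
    have : (n%:R - alpha) * p <= n%:R / p * p by rewrite ler_wpM2r ?(ltW p0)//; lra.
    by rewrite divfK ?gt_eqF//; lra.
  have c20 : 0 < c9 `^ p * w ^+ n by rewrite mulr_gt0 ?powR_gt0 ?exprn_gt0.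
  apply/eqyP => A A0.
  have [N hN] : exists N : nat, A <= c9 `^ p * w ^+ n *+ N.
    exists (Num.Def.archi_bound (A / (c9 `^ p * w ^+ n))).
    rewrite -mulr_natl -ler_pdivrMr//; apply: ltW; apply: archi_boundP.
    by rewrite divr_ge0 ?(ltW A0) ?(ltW c20).
  apply: (@le_trans _ _ (\sum_(i < N) (K i)%:E * lebesgue_rV n (B (L i)))%E).
    apply: (@le_trans _ _ (\sum_(i < N) (c9 `^ p * w ^+ n)%:E)%E).
      by rewrite sumEFin sumr_const card_ord lee_fin.
    by apply: lee_sum => i _; exact: KB.
  apply: (@integral_ge_disjoint _ _ R (lebesgue_rV n) (fun i => B (L i)) K).
  - by move=> i; exact: (hB _ (Lp i)).1.
  - by move=> i; exact: powR_ge0.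
  - move=> i j _ _ [x [Bi Bj]]; case: (ltngtP i j) => // ij.
      by case: (disj _ _ _ ij Bi Bj).
    by case: (disj _ _ _ ij Bj Bi).
  - by move=> x; exact: poweR_ge0.
  - move=> i x Bx; rewrite /= lee_fin; apply: ge0_ler_powR; rewrite ?nnegrE ?(ltW p0)//.
      by rewrite mulr_ge0 ?powR_ge0 ?(ltW c90).
    by rewrite ger0_norm ?mulr_ge0 ?powR_ge0 ?enorm_ge0//; exact: low.
rewrite pE; apply/eqyP => A A0.
have an0 : 0 < alpha - n%:R by rewrite subr_gt0.
have Ac0 : 0 < A / c9 by rewrite divr_gt0.
(* The second entry solves [c9 L^{alpha - n} = A], so the weighted field exceeds the prescribed [A]
   on a box of positive measure. *)
pose L := Num.max S ((A / c9) `^ (alpha - n%:R)^-1).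
have L0 : 0 < L by rewrite lt_max S0.
have [mBL hBL] := hB _ L0.
apply: (@Lnorm_pinfty_ge _ _ R (lebesgue_rV n) (B L) A
    (fun x => (1 + enorm x) `^ alpha * enorm (u x t)) mBL).
  exact: pB.
move=> x Bx; apply: le_trans (low alpha t L x a0 Tt L0 _ Bx); last first.
  by rewrite -S2; apply: lerXn2r; rewrite ?nnegrE ?(ltW S0) ?(ltW L0)// le_max lexx.
rewrite mulrC -ler_pdivrMr//.
apply: (@le_trans _ _ (((A / c9) `^ (alpha - n%:R)^-1) `^ (alpha - n%:R))).
  by rewrite -powRrM mulVf ?gt_eqF// powRr1// ltW.
apply: ge0_ler_powR; rewrite ?nnegrE ?(ltW an0) ?powR_ge0 ?(ltW L0)//.
by rewrite le_max lexx orbT.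
Qed.

End weighted_norms.

(** Pairing [u] with [- m] gives at least [c |m|^2 |x|^{-n}] minus an error of half that size;
    Cauchy-Schwarz and division by [|m|] turn this into a bound on [|u|]. *)
Lemma stokes_profile_cone_ge {R : realType} {n : nat} (n0 : (0 < n)%N)
    (u : 'rV[R]_n -> R -> 'rV[R]_n) (m : 'rV[R]_n) : m != 0 ->
  (forall eta : R, 0 < eta -> exists M T : R, [/\ 0 < M, 0 < T &
    forall t x j, T <= t -> M * t <= enorm x ^+ 2 ->
    `|u x t ord0 j - \sum_k stokes_kernel t j k x * m ord0 k| <=
    eta * (enorm x ^+ 2) `^ (- (n%:R / 2))]) ->
  exists c k M T : R, [/\ 0 < c, 0 < k, 0 < M, 0 < T &
    forall t x, T <= t -> M * t <= enorm x ^+ 2 ->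
    edot x m ^+ 2 <= k * (enorm x ^+ 2 * edot m m) ->
    c * (enorm x ^+ 2) `^ (- (n%:R / 2)) <= enorm (u x t)].
Proof.
move=> m0 hu; have nR : 0 < n%:R :> R by rewrite ltr0n.
have [c [M0 [k [c0 M00 k0 hK]]]] := @stokes_kernel_cone R n n0.
have em : 0 < enorm m by rewrite enorm_gt0.
(* Summing [|m_j|] times this error over the [n] coordinates gives at most [c |m|^2 / 2], half of
   the main term. *)
have eta0 : 0 < c * enorm m / (2 * n%:R) by rewrite divr_gt0 ?mulr_gt0.
have [M [T [Mp Tp hM]]] := hu _ eta0.
exists (c * enorm m / 2), k, (Num.max M M0), T.
split=> //; [by rewrite divr_gt0 ?mulr_gt0|by rewrite lt_max Mp|].
move=> t x Tt Mt xm.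
have t0 : 0 < t by exact: lt_le_trans Tt.
have Mt' : M * t <= enorm x ^+ 2.
  by apply: le_trans Mt; rewrite ler_wpM2r ?(ltW t0)// le_max lexx.
have M0t : M0 * t <= enorm x ^+ 2.
  by apply: le_trans Mt; rewrite ler_wpM2r ?(ltW t0)// le_max lexx orbT.
have r0 : 0 < enorm x ^+ 2 by apply: lt_le_trans Mt'; rewrite mulr_gt0.
have x0 : x != 0.
  by apply: contraTneq r0 => ->; rewrite sqr_enorm /edot big1 ?ltxx// => i _; rewrite mxE mul0r.
have HK := hK t x m t0 x0 M0t xm.
set P := _ `^ (- (n%:R / 2)) in HK *; have P0 : 0 <= P by exact: powR_ge0.
pose e j := u x t ord0 j - \sum_k stokes_kernel t j k x * m ord0 k.
have he j : `|m ord0 j * e j| <= c * edot m m / (2 * n%:R) * P.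
  rewrite normrM -sqr_enorm.
  rewrite [leRHS](_ : _ = enorm m * (c * enorm m / (2 * n%:R) * P)); last first.
    by field; rewrite gt_eqF.
  by apply: ler_pM => //; [exact: coord_le_enorm|exact: hM].
have uE : edot m (u x t) =
    \sum_i \sum_j m ord0 i * m ord0 j * stokes_kernel t i j x + \sum_j m ord0 j * e j.
  rewrite -big_split/=; apply: eq_bigr => i _.
  rewrite /e mulrBr [X in _ + (_ - X)]mulr_sumr addrC -[LHS]subr0 -addrA; congr (_ + _).
  rewrite [X in _ = _ + X](_ : _ = \sum_k m ord0 i * (stokes_kernel t i k x * m ord0 k)).
    by rewrite addrC subrr oppr0.
  by apply: eq_bigr => k' _; ring.
have sE : `|\sum_j m ord0 j * e j| <= c * edot m m / 2 * P.
  apply: (le_trans (ler_norm_sum _ _ _)).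
  apply: (le_trans (ler_sum _ (fun j _ => he j))).
  rewrite sumr_const card_ord -[leLHS]mulr_natl le_eqVlt; apply/orP; left; apply/eqP.
  by field; rewrite gt_eqF.
have : c * edot m m / 2 * P <= enorm m * enorm (u x t).
  apply: le_trans (edot_le _ _); rewrite ler_normr; apply/orP; right.
  rewrite uE; move: sE; rewrite ler_norml => /andP[_ sE].
  lra.
rewrite -sqr_enorm (_ : c * enorm m ^+ 2 / 2 * P = enorm m * (c * enorm m / 2 * P)).
  by rewrite ler_pM2l.
by ring.
Qed.

Theorem theorem2 (R : realType) (d : nat) (hd : (2 <= d)%N) :
  exists2 eps0 : R, 0 < eps0 &
  forall (eps : R) (f : 'rV[R]_d -> R -> 'rV[R]_d)
         (a : 'rV[R]_d -> 'rV[R]_d) (u : 'rV[R]_d -> R -> 'rV[R]_d),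
  0 < eps -> eps <= eps0 ->
  (* the force *)
  lmeasurable (lebesgue_rV d \x @lebesgue_measure R)%E
    ([set: 'rV[R]_d] `*` `[0, +oo[) (fun z => f z.1 z.2) ->
  {ae (lebesgue_rV d \x @lebesgue_measure R)%E, forall z, 0 <= z.2 ->
    enorm (f z.1 z.2) <=
      eps * Num.min ((1 + enorm z.1) ^- (d + 2))
                    ((1 + z.2) `^ (- ((d%:R + 2) / 2)))} ->
  (\int[lebesgue_rV d \x @lebesgue_measure R]_(z in
     [set: 'rV[R]_d] `*` `[0%R, +oo[) (enorm (f z.1 z.2))%:E <= eps%:E)%E ->
  (exists2 Cf : R, 0 < Cf & forall t, 0 <= t ->
    (\int[lebesgue_rV d]_x (enorm x * enorm (f x t))%:E
       <= (Cf * (1 + t) `^ (- 2^-1))%:E)%E) ->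
  (* the initial datum *)
  lmeasurable (lebesgue_rV d) setT a ->
  ('N[lebesgue_rV d]_1 [(fun x => (enorm (a x))%:E)] < eps%:E)%E ->
  divergence_free a ->
  {ae lebesgue_rV d, forall x, enorm (a x) <= eps * (1 + enorm x) ^- d} ->
  far_field_o a ->
  strong_solution eps f a u ->
  \row_(j < d) \int[@lebesgue_measure R]_(s in `[0, +oo[)
                 \int[lebesgue_rV d]_y f y s ord0 j != 0 ->
  (forall (alpha : R) (p : \bar R), 0 <= alpha ->
     [/\ (1 < p)%E, (p < +oo)%E & alpha + dim_over d p < d%:R] \/
       alpha = d%:R /\ p = +oo%E ->
     exists t0 c c' : R, [/\ 0 < t0, 0 < c, 0 < c' & forall t, t0 < t ->
       let rate := t `^ (- (d%:R - alpha - dim_over d p) / 2) in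
       ((c * rate)%:E <= weighted_Lnorm alpha p (u^~ t) <= (c' * rate)%:E)%E])
  /\
  (forall (alpha : R) (p : \bar R), 0 <= alpha ->
     [/\ (1 <= p)%E, (p < +oo)%E & d%:R <= alpha + dim_over d p] \/
       p = +oo%E /\ d%:R < alpha ->
     exists2 t0 : R, 0 < t0 & forall t, t0 < t ->
       weighted_Lnorm alpha p (u^~ t) = +oo%E).
Proof.
have n0 : (0 < d)%N by exact: ltnW.
exists 1 => // eps f a u eps0 _ mf fb fL1 [Cf Cf0 fx] ma aN _ _ ao [_ uE [C C0 uC] _ _].
set m := \row_j _ => m0.
pose K := C * eps * 2 `^ (d%:R / 2).
have K0 : 0 < K by rewrite !mulr_gt0// powR_gt0.
have hi x t : 0 < t -> enorm (u x t) <=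
    K * ((1 + enorm x) ^+ 2 + t) `^ (- (d%:R / 2)).
  move=> t0; apply: (le_trans (uC x t t0)); rewrite /K -[leRHS]mulrA ler_wpM2l//.
    by rewrite mulr_ge0// ltW.
  by apply: decay_min_le; exact: ltW.
clearbody K.
have hi' x t : 0 < t -> enorm (u x t) <= K * (enorm x ^+ 2 + (1 + t)) `^ (- (d%:R / 2)).
  move=> t0; apply: (le_trans (hi x t t0)); rewrite ler_wpM2l ?(ltW K0)//.
  apply: le_powRN; first by rewrite divr_ge0.
    by rewrite ltr_wpDl ?sqr_ge0// addr_gt0.
  rewrite -subr_ge0 (_ : _ - _ = 2 * enorm x); last by ring.
  by rewrite mulr_ge0 ?enorm_ge0.
have profile (eta : R) : 0 < eta -> exists M T : R, [/\ 0 < M, 0 < T &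
    forall t x j, T <= t -> M * t <= enorm x ^+ 2 ->
    `|u x t ord0 j - \sum_k stokes_kernel t j k x * m ord0 k| <=
    eta * (enorm x ^+ 2) `^ (- (d%:R / 2))].
  move=> eta0; have eta3 : 0 < eta / 3 by rewrite divr_gt0.
  have [M1 [r [M10 r0 h1]]] := heat_op_far n0 ma aN ao eta3.
  have [Cd Cd0 hd2] := duhamel_stokes_div_far n0 (ltW K0) hi'.
  have [M2 M21 h2] := parabolic_ratio_small Cd0 eta3.
  have fb' : {ae (lebesgue_rV d \x @lebesgue_measure R)%E, forall z, 0 <= z.2 ->
      enorm (f z.1 z.2) <= eps * (1 + enorm z.1) ^- (d + 2)}.
    have aeF := @ae_filter_ringOfSetsType _ _ R (lebesgue_rV d \x @lebesgue_measure R)%E.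
    apply: filterS fb => z /[apply] h; apply: (le_trans h).
    by rewrite ler_wpM2l ?(ltW eps0)// ge_min lexx.
  have [M3 M31 [T3 T31 h3]] := duhamel_stokes_far n0 (ltW eps0) (ltW Cf0) mf fb'
    (le_lt_trans fL1 (ltry _)) fx eta3.
  pose M := M1 + M2 + M3.
  have M0 : 0 < M by rewrite /M; lra.
  (* The summand [r / M] turns [M t <= |x|^2] into the fixed lower bound [r <= |x|^2] that the heat
     term requires; the sum [M] dominates each of the three ratios. *)
  exists M, (T3 + r / M); split=> //.
    by rewrite addr_gt0 ?divr_gt0//; lra.
  move=> t x j Tt Mt; have rM : 0 < r / M by rewrite divr_gt0.
  have T3t : T3 <= t by lra.
  have t1 : 1 <= t by lra.
  have t0 : 0 < t by lra.
  have rt : r <= M * t by rewrite mulrC -ler_pdivrMr//; lra.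
  have [q1 q2 q3] : [/\ 0 < M1 * t, t <= M2 * t & t <= M3 * t].
    by rewrite mulr_gt0// !ler_peMl// ltW.
  have MtE : M * t = M1 * t + M2 * t + M3 * t by rewrite /M; ring.
  have H1 : `|heat_op t a x ord0 j| <= eta / 3 * (enorm x ^+ 2) `^ (- (d%:R / 2)).
    by apply: h1 => //; lra.
  have H2 := hd2 t x j t1 (_ : t <= enorm x ^+ 2).
  have H2' : `|duhamel stokes_div_op u x t ord0 j| <=
      eta / 3 * (enorm x ^+ 2) `^ (- (d%:R / 2)).
    apply: (le_trans (H2 _)); first lra.
    by rewrite ler_wpM2r ?powR_ge0//; apply: h2 => //; lra.
  have H3 : `|duhamel stokes_op f x t ord0 j - \sum_k stokes_kernel t j k x * m ord0 k| <=
      eta / 3 * (enorm x ^+ 2) `^ (- (d%:R / 2)).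
    under eq_bigr do rewrite mxE.
    by apply: h3 => //; lra.
  have -> : u x t ord0 j = heat_op t a x ord0 j - duhamel stokes_div_op u x t ord0 j
      + duhamel stokes_op f x t ord0 j by rewrite uE//; rewrite mxE [X in X + _]mxE [X in _ + X + _]mxE.
  rewrite -addrA; apply: (le_trans (ler_normD _ _)).
  apply: (le_trans (lerD (ler_normB _ _) (lexx _))).
  rewrite [eta in leRHS](_ : eta = eta / 3 + eta / 3 + eta / 3); last by field.
  by rewrite !mulrDl; apply: lerD => //; exact: lerD.
have [c [k [M [T [c0 k0 M0 T0 lo]]]]] := stokes_profile_cone_ge n0 m0 profile.
exact: (weighted_Lnorm_profile hd K0 c0 k0 M0 T0 hi lo).
Qed.
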